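(* Let $S$ be a Damek-Ricci space, let $f$ be a radial $L^2$-Schwartz class function on $S$ (that is, $f\in\mathscr{S}^2(S)_o$), and let $B_R$ denote the geodesic ball centered at the identity with radius $R>0$. Then for dispersive equations $i\frac{\partial u}{\partial t}+\Psi(\sqrt{-\mathcal{L}})u=0$ on $S\times\mathbb{R}$, $u(0,\cdot)=f$, with $\mathcal{L}=\Delta$ or $\mathcal{L}=\tilde{\Delta}$, that are asymptotically concave of degree $a\in(0,1)$, with $\psi$ denoting the phase function of the multiplier, the estimate $$\|S_\psi^* f\|_{L^2(B_R)}\lesssim\|f\|_{H^\beta(S)}$$ holds for all $R>0$ and all $\beta>a/4$, with the implicit constant depending only on the radius $R$, the parameters $a$, $\beta$ and the intrinsic geometry of the space $S$.
   Context: **Damek-Ricci spaces.** Let $\mathfrak{n}$ be a two-step real nilpotent Lie algebra with inner product $\langle\cdot,\cdot\rangle$, center $\mathfrak{z}$, and $\mathfrak{v}=\mathfrak{z}^\perp$. It is of $H$-type if for every $Z\in\mathfrak{z}$ the map $J_Z:\mathfrak{v}\to\mathfrak{v}$, $\langle J_ZX,Y\rangle=\langle[X,Y],Z\rangle$, satisfies $J_Z^2=-|Z|^2 I_{\mathfrak{v}}$. The degenerate case where $\mathfrak{n}$ is abelian and coincides with its center $\mathfrak{z}$ (so $\mathfrak{v}=0$) is also allowed; it gives the real hyperbolic spaces. Let $N$ be the connected simply connected Lie group with Lie algebra $\mathfrak{n}$, with elements parametrized as $(X,Z)\in\mathfrak{v}\times\mathfrak{z}$ via the exponential map. $A=\mathbb{R}^+$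 acts on $N$ by $(X,Z)\mapsto(\sqrt{r}X,rZ)$, $r\in A$. The Damek-Ricci space is the semidirect product $S=NA$, with Lie algebra $\mathfrak{v}\oplus\mathfrak{z}\oplus\mathbb{R}$, equipped with the left-invariant Riemannian metric induced by $\langle(X,Z,l),(X',Z',l')\rangle=\langle X,X'\rangle+\langle Z,Z'\rangle+ll'$. Put $m_{\mathfrak v}=\dim\mathfrak{v}$, $m_{\mathfrak z}=\dim\mathfrak{z}$, $n=\dim S=m_{\mathfrak v}+m_{\mathfrak z}+1$, and $Q=\frac{m_{\mathfrak v}}{2}+m_{\mathfrak z}$. A function on $S$ is radial if it depends only on $s=d(e,x)$, the geodesic distance to the identity $e$; one writes $f(x)=f(s)$. The left Haar measure $dx$ is normalized so that $\int_S f\,dx=\int_0^\infty f(s)A(s)\,ds$ for radial $f$, where $A(s)=2^{m_{\mathfrak v}+m_{\mathfrak z}}(\sinh(s/2))^{m_{\mathfrak v}+m_{\mathfrak z}}(\cosh(s/2))^{m_{\mathfrak z}}$; $L^2(B_R)$ is with respect to $dx$. **Spherical analysis.** $\Delta$ is the Laplace-Beltrami operator on $S$ and $\tilde{\Delta}=\Delta+\frac{Q^2}{4}$. The spherical function $\varphi_\lambda$ is the radial solution of $\Delta\varphi_\lambda=-(\lambda^2+\frac{Q^2}{4})\varphi_\lambda$ with $\varphi_\lambda(e)=1$. For nice radial $f$, $\widehat{f}(\lambda)=\int_0^\infty f(s)\varphi_\lambda(s)A(s)\,ds$. The Harish-Chandra function is $$\mathbf{c}(\lambda)=\frac{2^{Q-2i\lambda}\,\Gamma(2i\lambda)}{\Gamma\left(\frac{Q+2i\lambda}{2}\right)}\cdot\frac{\Gamma\left(\frac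 n2\right)}{\Gamma\left(\frac{m_{\mathfrak v}+4i\lambda+2}{4}\right)}.$$ $\mathscr{S}^2(S)_o$, the radial $L^2$-Schwartz class, is the set of smooth radial $f$ on $S$ such that for all integers $M,K\ge0$, $\left|\left(\frac{d}{ds}\right)^M f(s)\right|\lesssim(1+s)^{-K}e^{-\frac Q2 s}$. For $\beta\ge0$, $H^\beta(S)$ (specialized to radial functions) consists of the $f\in L^2(S)$ for which $$\|f\|_{H^\beta(S)}=\left(\int_0^\infty\left(\lambda^2+\tfrac{Q^2}{4}\right)^\beta|\widehat f(\lambda)|^2|\mathbf{c}(\lambda)|^{-2}\,d\lambda\right)^{1/2}<\infty.$$ **Equation and maximal function.** Here $\Psi:[0,\infty)\to\mathbb{R}$. The phase function $\psi$ is that of the multiplier corresponding to $\Psi(\sqrt{-\mathcal{L}})$: $\psi(\lambda)=\Psi\left(\sqrt{\lambda^2+Q^2/4}\right)$ if $\mathcal{L}=\Delta$, and $\psi(\lambda)=\Psi(\lambda)$ if $\mathcal{L}=\tilde\Delta$. For $a\in(0,1)$ the equation is called asymptotically concave of degree $a$ if $\psi$ is a real-valued continuous function on $[0,\infty)$, $C^\infty$ away from the origin, and satisfies $\psi(\lambda)=\lambda^a+\mathcal{O}(1)$ for $\lambda\gg1$ (where $\lambda\gg1$ means $\lambda\ge M$ for some sufficiently large $M>1$). For $f\in\mathscr{S}^2(S)_o$ the solution of the equation is given by $$S_{\psi,t}f(x)=\int_0^\infty\varphi_\lambda(x)\,e^{it\psi(\lambda)}\,\widehat f(\lambda)\,|\mathbf{c}(\lambda)|^{-2}\,d\lambda,$$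 and the associated maximal function is $S_\psi^*f(x)=\sup_{0<t<1}|S_{\psi,t}f(x)|$. The notation $f_1\lesssim f_2$ means $f_1\le Cf_2$ for some constant $C\ge1$ (the implicit constant).
   Formalization: The implicit constant may also depend on the threshold M in ''λ≫1'' and on the bound of the O(1) term (uniformity over all phases fails: take ψ=λ² on a long interval, a/4<β<1/4); the zero Lie algebra (S a line, Q=0) is excluded. *)

(* Defs.v *)
From HB Require Import structures.
From mathcomp Require Import all_boot all_order all_algebra.
From mathcomp Require Import all_classical all_reals all_analysis measurable_realfun.
From mathcomp Require Import complex.

Set Implicit Arguments.
Unset Strict Implicit.
Unset Printing Implicit Defensive.

Import Order.TTheory GRing.Theory Num.Theory.
Import numFieldNormedType.Exports.

Local Open Scope classical_set_scope.
Local Open Scope ring_scope.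

Section Euclidean.
Context {R : realType}.

Definition dot d (u v : 'rV[R]_d) : R := (u *m v^T) 0 0.

(* Smoothness on R^d: every iterated partial derivative is differentiable. *)
Definition smooth d (h : 'rV[R]_d -> R) : Prop :=
  forall (s : seq 'I_d) (x : 'rV[R]_d),
    differentiable
      (foldr (fun i (g : 'rV[R]_d -> R) => fun y => 'D_(delta_mx 0 i) g y) h s) x.

(* J_Z X is the vector with <J_Z X, Y> = <[X, Y], Z> for all Y; its j-th
   coordinate is obtained with Y the j-th vector of the orthonormal basis. *)
Definition Jmap p q (br : 'rV[R]_p -> 'rV[R]_p -> 'rV[R]_q)
    (Z : 'rV[R]_q) (X : 'rV[R]_p) : 'rV[R]_p :=
  \row_j dot (br X (delta_mx 0 j)) Z.

End Euclidean.

(* An H-type algebra n = v + z, written in orthonormal bases of its center z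
   and of v = z^perp.  As [n, n] is contained in z, the bracket is determined
   by its restriction v x v -> z: [(X, Z), (X', Z')] = (0, bracket X X').
   The field [bracket_center] says that the center is not larger than z.  The
   abelian algebra n = z is the case dim_v = 0; the zero algebra, for which S
   would be a line, is excluded (a nonzero nilpotent algebra has a nonzero
   center). *)
Record htype (R : realType) := HType {
  dim_v : nat;
  dim_z : nat;
  bracket : 'rV[R]_dim_v -> 'rV[R]_dim_v -> 'rV[R]_dim_z;
  bracket_linear : forall (c : R) X X' Y,
    bracket (c *: X + X') Y = c *: bracket X Y + bracket X' Y;
  bracket_skew : forall X Y, bracket X Y = - bracket Y X;
  bracket_center : forall X, (forall Y, bracket X Y = 0) -> X = 0;
  dim_z_gt0 : (0 < dim_z)%N;
  bracket_htype : forall Z X,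
    Jmap bracket Z (Jmap bracket Z X) = - dot Z Z *: X }.

Section DamekRicci.
Context {R : realType} (n : htype R).

(* S = NA in the global chart (X, Z, l) of R^(dim_v + dim_z + 1), where l is the
   logarithm of the coordinate r in A = R^+, that is r = e^l; the identity is 0
   and the tangent space at the identity is the Lie algebra v + z + R with its
   standard inner product. *)
Definition dimS : nat := dim_v n + dim_z n + 1.
Definition DR : Type := 'rV[R]_dimS.

Definition vpart (p : DR) : 'rV[R]_(dim_v n) := lsubmx (lsubmx p).
Definition zpart (p : DR) : 'rV[R]_(dim_z n) := rsubmx (lsubmx p).
Definition apart (p : DR) : R := rsubmx p 0 0.

(* (X, Z, r)(X', Z', r') =
     (X + sqrt r X', Z + r Z' + [X, sqrt r X'] / 2, r r') *)
Definition smul (p q : DR) : DR :=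
  row_mx
    (row_mx (vpart p + expR (apart p / 2) *: vpart q)
            (zpart p + expR (apart p) *: zpart q
             + 2^-1 *: bracket (vpart p) (expR (apart p / 2) *: vpart q)))
    (apart p + apart q)%:M.

(* The Gram matrix in the chart of the left-invariant metric: the differential
   E |-> E *m left_diff p of q |-> smul p q at the identity is an isometry. *)
Definition left_diff (p : DR) : 'M[R]_dimS :=
  jacobian (smul p : 'rV[R]_dimS -> 'rV[R]_dimS) 0.
Definition metric (p : DR) : 'M[R]_dimS :=
  invmx (left_diff p) *m (invmx (left_diff p))^T.

Definition C1 (g : R -> 'rV[R]_dimS) : Prop :=
  (forall t, derivable g t 1) /\ continuous (derive1 g).

Definition curve_length (g : R -> 'rV[R]_dimS) : R :=
  \int[@lebesgue_measure R]_(t in `[0, 1])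
    Num.sqrt ((derive1 g t *m metric (g t) *m (derive1 g t)^T) 0 0).

Definition dist (p q : DR) : R :=
  inf [set L | exists g, [/\ C1 g, g 0 = p, g 1 = q & curve_length g = L]].

Definition gball (r : R) : set DR := [set x | dist 0 x < r].

(* Delta h = |g|^(-1/2) sum_(i, j) d_i (|g|^(1/2) g^(ij) d_j h) *)
Definition laplacian (h : 'rV[R]_dimS -> R) (x : 'rV[R]_dimS) : R :=
  (Num.sqrt (\det (metric x)))^-1 *
  \sum_(i < dimS) 'D_(delta_mx 0 i)
    (fun y : 'rV[R]_dimS => \sum_(j < dimS)
       Num.sqrt (\det (metric y)) * invmx (metric y) i j
       * 'D_(delta_mx 0 j) h y) x.

Definition Qdim : R := (dim_v n)%:R / 2 + (dim_z n)%:R.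

(* A radial function on S is given by its profile on [0, +oo[; the values of
   the profile at negative reals are irrelevant. *)
Definition radial T (f : R -> T) : DR -> T := fun x => f (dist 0 x).

Definition sinh (x : R) : R := (expR x - expR (- x)) / 2.
Definition cosh (x : R) : R := (expR x + expR (- x)) / 2.

Definition Adens (s : R) : R :=
  2 ^+ (dim_v n + dim_z n) * sinh (s / 2) ^+ (dim_v n + dim_z n)
  * cosh (s / 2) ^+ dim_z n.

Definition borelS := g_sigma_algebraType (@open 'rV[R]_dimS).

(* The left Haar measure, with the normalization
   \int_S f dx = \int_0^oo f(s) A(s) ds for f radial. *)
Definition normalized_left_haar (mu : {measure set borelS -> \bar R}) : Prop :=
  [/\ forall K : set 'rV[R]_dimS, compact K -> (mu K < +oo)%E,
      forall (p : DR) (B : set borelS), measurable B ->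
        mu (smul p @^-1` B) = mu B
    & forall h : R -> \bar R, measurable_fun [set: R] h ->
        (forall s, (0 <= h s)%E) ->
        (\int[mu]_x radial h x =
         \int[@lebesgue_measure R]_(s in `[0%R, +oo[) (h s * (Adens s)%:E))%E].

Definition spherical (l : R) (phi : R -> R) : Prop :=
  [/\ smooth (radial phi),
      forall x, laplacian (radial phi) x
                = - (l ^+ 2 + Qdim ^+ 2 / 4) * radial phi x
    & radial phi 0 = 1].

Definition cexp (z : R[i]) : R[i] :=
  (expR (complex.Re z))%:C%C
  * (cos (complex.Im z) +i* sin (complex.Im z))%C.

Definition cpow (x : R) (z : R[i]) : R[i] := cexp ((ln x)%:C%C * z).

Definition cintegral (D : set R) (g : R -> R[i]) : R[i] :=
  ((\int[@lebesgue_measure R]_(x in D) complex.Re (g x))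
   +i* (\int[@lebesgue_measure R]_(x in D) complex.Im (g x)))%C.

(* Euler's product Gamma(z) = lim_k k! k^z / (z (z + 1) ... (z + k)), valid for
   every z which is not a pole. *)
Definition Gamma_seq (z : R[i]) (k : nat) : R[i] :=
  (k`!)%:R * cpow k%:R z / \prod_(j < k.+1) (z + j%:R).
Definition Gamma (z : R[i]) : R[i] :=
  (lim ((fun k => complex.Re (Gamma_seq z k)) @ \oo)
   +i* lim ((fun k => complex.Im (Gamma_seq z k)) @ \oo))%C.

Definition harish_chandra (l : R) : R[i] :=
  let il : R[i] := (0 +i* l)%C in
  let Q : R[i] := Qdim%:C%C in
  (cpow 2 (Q - 2 * il) * Gamma (2 * il) / Gamma ((Q + 2 * il) / 2))
  * (Gamma (dimS%:R / 2) / Gamma (((dim_v n)%:R + 4 * il + 2) / 4)).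

Definition plancherel (l : R) : R := Normc.normc (harish_chandra l) ^- 2.

(* The derivatives of the profile are only considered at s > 0, where they do
   not depend on its values at negative reals; the estimates extend to s = 0 by
   continuity. *)
Definition schwartz2 (f : R -> R[i]) : Prop :=
  [/\ smooth (radial (fun s => complex.Re (f s))),
      smooth (radial (fun s => complex.Im (f s)))
    & forall M K : nat, exists C : R, forall s : R, 0 < s ->
        Normc.normc (derive1n M (fun s => complex.Re (f s)) s
               +i* derive1n M (fun s => complex.Im (f s)) s)%C
        <= C * ((1 + s) ^- K * expR (- (Qdim / 2) * s))].

(* In the definitions below, [phi l] is the profile of the spherical
   function of parameter l. *)
Definition transform (phi : R -> R -> R) (f : R -> R[i]) (l : R) : R[i] :=
  cintegral `[0, +oo[ (fun s => f s * (phi l s)%:C%C * (Adens s)%:C%C).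

Definition sobolev_norm (phi : R -> R -> R) (b : R) (f : R -> R[i]) : \bar R :=
  ((\int[@lebesgue_measure R]_(l in `[0%R, +oo[)
     ((l ^+ 2 + Qdim ^+ 2 / 4) `^ b
      * Normc.normc (transform phi f l) ^+ 2 * plancherel l)%:E) `^ 2^-1)%E.

Definition solution (phi : R -> R -> R) (psi : R -> R) (t : R) (f : R -> R[i])
    (x : DR) : R[i] :=
  cintegral `[0, +oo[ (fun l =>
    (radial (phi l) x)%:C%C * cexp (0 +i* (t * psi l))%C
    * transform phi f l * (plancherel l)%:C%C).

Definition maximal (phi : R -> R -> R) (psi : R -> R) (f : R -> R[i])
    (x : DR) : \bar R :=
  ereal_sup [set (Normc.normc (solution phi psi t f x))%:E | t in `]0, 1[].

Definition L2norm (mu : {measure set borelS -> \bar R}) (D : set DR)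
    (F : DR -> \bar R) : \bar R :=
  ((\int[mu]_(x in (D : set borelS)) (F x) ^+ 2) `^ 2^-1)%E.

(* L is Delta or Delta + Q^2 / 4. *)
Inductive laplace_operator := Laplace | ShiftedLaplace.

(* - L phi_l is (l^2 + Q^2 / 4) phi_l or l^2 phi_l. *)
Definition phase (L : laplace_operator) (Psi : R -> R) (l : R) : R :=
  match L with
  | Laplace => Psi (Num.sqrt (l ^+ 2 + Qdim ^+ 2 / 4))
  | ShiftedLaplace => Psi l
  end.

End DamekRicci.

(* The threshold M in "l >> 1" and the bound K of the term O(1) are part of the
   data. *)
Definition asymptotically_concave (R : realType) (a M K : R) (psi : R -> R) :
    Prop :=
  [/\ {within `[0, +oo[, continuous psi},
      forall (k : nat) (l : R), 0 < l -> derivable (derive1n k psi) l 1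
    & forall l, M <= l -> `|psi l - l `^ a| <= K].

(* Main.v *)
Require Import Defs.
From HB Require Import structures.
From mathcomp Require Import all_boot all_order all_algebra.
From mathcomp Require Import all_classical all_reals all_analysis measurable_realfun.
From mathcomp Require Import complex.
From mathcomp Require Import ring lra zify.

(** The maximal estimate reduces to a one-dimensional oscillatory problem, because
    both the solution and the maximal function are radial.

    Geometry.  The function [wfun], the squared hyperbolic cosine of half the distance
    to the identity, has a gradient that bounds the length of curves from below
    ([dwfun_le], [curve_length_ge]), and explicit geodesics attain this bound at
    the points [(X, Z, l)] with [X = 0] or [Z = 0] ([distE]).  These points contain
    the axis [A] and the lines orthogonal to it, which is all that is needed to compute
    the Laplacian of a radial function on the axis: the profile of a spherical function
    solves [f'' + kappa * f' + (l ^ 2 + Q ^ 2 / 4) * f = 0] ([spherical_ode]), where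
    [kappa] is the logarithmic derivative of the density [Adens].

    Asymptotics.  The energy of this equation decreases, so that spherical functions
    are bounded by [1].  After multiplication by [sqrt Adens] the equation becomes
    [v'' + (l ^ 2 - potential) * v = 0] with a potential of order [1 / s ^ 2], and
    variation of constants gives, on bounded intervals and for [l >= 1],
    [sqrt (Adens s) * phi_l s = c1 * cos (l * s) + c2 * sin (l * s) + error], where
    [c1] and [c2] are of order [l ^ (- m / 2)] with [m = dim_v + dim_z], and the error
    has the additional factor [min 1 (1 / (l * s))] ([spherical_asymptotics]).  The
    Plancherel density is at most of order [l ^ m]; this follows from Euler's product
    for the Gamma function, factor by factor ([Gamma_ratio_le], [plancherel_le]).
    Hence the powers of [l] cancel.

    Dyadic blocks.  For frequencies in [[N, 2 * N]] the main term is the maximal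
    function of [\int G l * cos (s * l + c0) * cos (t * psi l + c1)].  The phase [psi] is
    a bounded perturbation of [l ^ a], and this perturbation is removed by a Taylor
    expansion in [t].  For [psi l = l ^ a] and a measurable choice of the times, the
    kernel of the operator composed with its adjoint is at most of order
    [N ^ (a / 2) / |s - s'|] by van der Corput's second derivative test
    ([oscillatory_block]).  The large sieve on a grid of values of [s] then bounds the
    square of the norm of the maximal function by [N ^ (a / 2 + e)] times that of [G]
    ([maximal_block]), the loss [e] coming from the harmonic sum.  Since [a / 4 < b],
    the Sobolev weight compensates this power of [N] with a geometric gain, the blocks
    can be added ([block_estimate], [summed_estimate]), and low frequencies are
    controlled by the Cauchy-Schwarz inequality.

    Assembly.  The bound for the truncated frequency integrals passes to the solution
    ([truncated_pair_bound]), and the measure [mu] intervenes only through the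
    integration formula for radial functions, applied to a measurable radial
    majorant of the squared maximal function. *)

Set Implicit Arguments.
Unset Strict Implicit.
Unset Printing Implicit Defensive.

Import Order.TTheory GRing.Theory Num.Theory.
Import numFieldNormedType.Exports.
Local Open Scope classical_set_scope.
Local Open Scope ring_scope.

(** * Calculus on the real line *)

Section Calculus.
Context {R : realType}.
Implicit Types (f g : R -> R) (x y a b : R).

Lemma dcst x (c : R) : is_derive x (1 : R) (fun _ : R => c) 0.
Proof. exact: is_derive_cst. Qed.

Lemma did x : is_derive x (1 : R) (fun y : R => y) 1.
Proof. exact: is_derive_id. Qed.

Lemma dD f g x a b : is_derive x 1 f a -> is_derive x 1 g b ->
  is_derive x 1 (fun y => f y + g y) (a + b).
Proof. by move=> fa gb; exact: is_deriveD. Qed.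

Lemma dN f x a : is_derive x 1 f a -> is_derive x 1 (fun y => - f y) (- a).
Proof. by move=> fa; exact: is_deriveN. Qed.

Lemma dM f g x a b : is_derive x 1 f a -> is_derive x 1 g b ->
  is_derive x 1 (fun y => f y * g y) (f x * b + g x * a).
Proof. by move=> fa gb; exact: is_deriveM. Qed.

Lemma dX f n x a : is_derive x 1 f a ->
  is_derive x 1 (fun y => f y ^+ n) (n%:R * f x ^+ n.-1 * a).
Proof.
move=> fa; rewrite (_ : (fun y => f y ^+ n) = f ^+ n); last first.
  by apply/funext => y; rewrite fctE.
exact: is_deriveX.
Qed.

Lemma dV f x a : is_derive x 1 f a -> f x != 0 ->
  is_derive x 1 (fun y => (f y)^-1) (- f x ^- 2 * a).
Proof. by move=> fa fx; exact: is_deriveV. Qed.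

Lemma dcomp f g x a b : is_derive (g x) 1 f a -> is_derive x 1 g b ->
  is_derive x 1 (fun y => f (g y)) (a * b).
Proof. by move=> fa gb; exact: (is_derive1_comp fa gb). Qed.

Lemma dcos f x a : is_derive x 1 f a ->
  is_derive x 1 (fun y => cos (f y)) (- sin (f x) * a).
Proof. by apply: dcomp. Qed.

Lemma dsin f x a : is_derive x 1 f a ->
  is_derive x 1 (fun y => sin (f y)) (cos (f x) * a).
Proof. by apply: dcomp. Qed.

Lemma dexp f x a : is_derive x 1 f a ->
  is_derive x 1 (fun y => expR (f y)) (expR (f x) * a).
Proof. by apply: dcomp. Qed.

Lemma datan f x a : is_derive x 1 f a ->
  is_derive x 1 (fun y => atan (f y)) ((1 + f x ^+ 2)^-1 * a).
Proof. by apply: dcomp. Qed.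

Lemma dln f x a : is_derive x 1 f a -> 0 < f x ->
  is_derive x 1 (fun y => ln (f y)) ((f x)^-1 * a).
Proof. by move=> fa fx; apply: dcomp fa; exact: is_derive1_ln. Qed.

Lemma dsqrt f x a : is_derive x 1 f a -> 0 < f x ->
  is_derive x 1 (fun y => Num.sqrt (f y)) ((2 * Num.sqrt (f x))^-1 * a).
Proof. by move=> fa fx; apply: dcomp fa; exact: is_derive1_sqrt. Qed.

Lemma dpow (p : R) f x a : is_derive x 1 f a -> 0 < f x ->
  is_derive x 1 (fun y => f y `^ p) (p * f x `^ (p - 1) * a).
Proof.
move=> fa fx; apply: (@dcomp (fun z => z `^ p)) fa.
exact: is_derive1_powR.
Qed.

Lemma is_derive_continuous f x a : is_derive x 1 f a -> {for x, continuous f}.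
Proof.
by move=> fa; apply: differentiable_continuous; apply/derivable1_diffP.
Qed.

End Calculus.

(** Computes a derivative by following the syntax of the function; the side
    conditions (nonzero denominators, positive arguments) are left open. *)
Ltac der_hyp := match goal with
  | H : is_derive _ _ _ _ |- _ => exact H
  | H : forall _, is_derive _ _ _ _ |- _ => exact (H _)
  | H : forall _ _, is_derive _ _ _ _ |- _ => solve [apply H; assumption]
  end.
Ltac der := first [ der_hyp |
  lazymatch goal with
  | |- is_derive _ _ (fun _ => ?c) _ => notypeclasses refine (dcst _ _)
  | |- is_derive _ _ (fun y => y) _ => notypeclasses refine (did _)
  | |- is_derive _ _ (fun y => (@?f y + @?g y)%R) _ =>
    notypeclasses refine (@dD _ f g _ _ _ _ _); [der|der]
  | |- is_derive _ _ (fun y => (- (@?f y))%R) _ =>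
    notypeclasses refine (@dN _ f _ _ _); [der]
  | |- is_derive _ _ (fun y => (@?f y * @?g y)%R) _ =>
    notypeclasses refine (@dM _ f g _ _ _ _ _); [der|der]
  | |- is_derive _ _ (fun y => (@?f y ^+ ?n)%R) _ =>
    notypeclasses refine (@dX _ f n _ _ _); [der]
  | |- is_derive _ _ (fun y => ((@?f y)^-1)%R) _ =>
    notypeclasses refine (@dV _ f _ _ _ _); [der|]
  | |- is_derive _ _ (fun y => cos (@?f y)) _ =>
    notypeclasses refine (@dcos _ f _ _ _); [der]
  | |- is_derive _ _ (fun y => sin (@?f y)) _ =>
    notypeclasses refine (@dsin _ f _ _ _); [der]
  | |- is_derive _ _ (fun y => expR (@?f y)) _ =>
    notypeclasses refine (@dexp _ f _ _ _); [der]
  | |- is_derive _ _ (fun y => atan (@?f y)) _ =>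
    notypeclasses refine (@datan _ f _ _ _); [der]
  | |- is_derive _ _ (fun y => ln (@?f y)) _ =>
    notypeclasses refine (@dln _ f _ _ _ _); [der|]
  | |- is_derive _ _ (fun y => Num.sqrt (@?f y)) _ =>
    notypeclasses refine (@dsqrt _ f _ _ _ _); [der|]
  | |- is_derive _ _ (fun y => (@?f y `^ ?p)%R) _ =>
    notypeclasses refine (@dpow _ p f _ _ _ _); [der|]
  | |- _ => idtac
  end ].
Ltac derive_with := notypeclasses refine (is_derive_eq _ _); [der|]; cbv beta.

Section Calculus2.
Context {R : realType}.
Implicit Types (f g : R -> R) (x y a b : R).
Local Notation mu := (@lebesgue_measure R).

Lemma is_derive_within f (df : R -> R) a b :
  (forall x, a <= x <= b -> is_derive x 1 f (df x)) ->
  {within `[a, b], continuous f}.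
Proof.
move=> h; apply: continuous_in_subspaceT => x /[!inE]/= xab.
by apply: is_derive_continuous (h x _); move: xab; rewrite in_itv.
Qed.

Lemma is_derive_ge0_le f (df : R -> R) a b : a <= b ->
  (forall x, a < x < b -> is_derive x 1 f (df x)) ->
  {within `[a, b], continuous f} ->
  (forall x, a < x < b -> 0 <= df x) -> f a <= f b.
Proof.
rewrite le_eqVlt => /predU1P[->//|ab] h cf df0.
rewrite -subr_ge0.
have h' x : x \in `]a, b[ -> is_derive x 1 f (df x).
  by rewrite in_itv => /h.
have [c + ->] := MVT ab h' cf.
by rewrite in_itv => /df0 ?; rewrite mulr_ge0// subr_ge0 ltW.
Qed.

Lemma is_derive_ge0_le_cc f (df : R -> R) a b : a <= b ->
  (forall x, a <= x <= b -> is_derive x 1 f (df x)) ->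
  (forall x, a < x < b -> 0 <= df x) -> f a <= f b.
Proof.
move=> ab h; apply: is_derive_ge0_le => //.
- by move=> x /andP[ax xb]; apply: h; rewrite !ltW.
- exact: is_derive_within h.
Qed.

Lemma continuous_integrable f a b : {within `[a, b], continuous f} ->
  mu.-integrable `[a, b] (EFin \o f).
Proof. by move=> cf; apply: continuous_compact_integrable => //; exact: segment_compact. Qed.

(** The fundamental theorem of calculus as an inequality: the primitive of [f]
    increases slower than any function whose derivative dominates [f]. *)
Lemma Rintegral_le_derive f g (dg : R -> R) a b : a <= b ->
  (forall x, a <= x <= b -> {for x, continuous f}) ->
  (forall x, a <= x <= b -> is_derive x 1 g (dg x)) ->
  (forall x, a <= x <= b -> f x <= dg x) ->
  \int[mu]_(x in `[a, b]) f x <= g b - g a.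
Proof.
rewrite le_eqVlt => /predU1P[-> _ _ _|ab cf hg fg].
  by rewrite set_itv1 Rintegral_set1 subrr.
have wf : {within `[a, b], continuous f}.
  apply: continuous_in_subspaceT => x /[!inE]/= xab.
  by apply: cf; move: xab; rewrite in_itv.
have intf := continuous_integrable wf.
pose F x := \int[mu]_(t in `[a, x]) f t.
have Fa : F a = 0 by rewrite /F set_itv1 Rintegral_set1.
have cF : {within `[a, b], continuous F}.
  by apply: parameterized_integral_continuous => //; exact: ltW.
have dF x : a < x < b -> is_derive x 1 F (f x).
  move=> /andP[ax xb].
  have [|] := @continuous_FTC1_closed R f a x b xb intf ax.
    by apply: cf; rewrite !ltW.
  by move=> dFx <-; rewrite derive1E; exact/derivableP.
pose H x := g x - F x.
have : H a <= H b.
  apply: (@is_derive_ge0_le H (fun x => dg x - f x)) => //.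
  - exact: ltW.
  - move=> x xab; have xab' : a <= x <= b by move/andP: xab => [? ?]; rewrite !ltW.
    exact: dD (hg x xab') (dN (dF x xab)).
  - have cg := is_derive_within hg.
    rewrite (_ : H = g + (- F))//.
    move=> x; apply: continuousD _; first exact: cg.
    exact/continuousN/cF.
  - move=> x /andP[ax xb]; rewrite subr_ge0 fg//.
    by rewrite !ltW.
rewrite /H Fa -/(F b); lra.
Qed.

Lemma Rintegral_ge_derive f g (dg : R -> R) a b : a <= b ->
  (forall x, a <= x <= b -> {for x, continuous f}) ->
  (forall x, a <= x <= b -> is_derive x 1 g (dg x)) ->
  (forall x, a <= x <= b -> dg x <= f x) ->
  g b - g a <= \int[mu]_(x in `[a, b]) f x.
Proof.
move=> ab cf hg fg.
have intf : mu.-integrable `[a, b] (EFin \o f).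
  apply: continuous_integrable.
  apply: continuous_in_subspaceT => x /[!inE]/= xab.
  by apply: cf; move: xab; rewrite in_itv.
have := @Rintegral_le_derive (fun x => - f x) (fun x => - g x)
  (fun x => - dg x) a b ab.
rewrite (_ : \int[mu]_(x in `[a, b]) - f x = - \int[mu]_(x in `[a, b]) f x).
  move=> H; rewrite -lerN2 (le_trans (H _ _ _)) => //; last lra.
  - by move=> x xab; apply: continuousN; exact: cf.
  - by move=> x xab; exact: dN (hg x xab).
  - by move=> x xab; rewrite lerN2 fg.
under eq_Rintegral do rewrite -mulN1r.
by rewrite RintegralZl// mulN1r.
Qed.

End Calculus2.

(** * Oscillatory integrals *)

Section Oscillatory.
Context {R : realType}.
Local Notation mu := (@lebesgue_measure R).

Lemma cos_le1 (x : R) : - 1 <= cos x <= 1.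
Proof. by rewrite cos_geN1 cos_le1. Qed.

Lemma sin_le1 (x : R) : - 1 <= sin x <= 1.
Proof. by rewrite sin_geN1 sin_le1. Qed.

Lemma abs_cos_le1 (x : R) : `|cos x| <= 1.
Proof. by rewrite ler_norml cos_le1. Qed.

Lemma abs_sin_le1 (x : R) : `|sin x| <= 1.
Proof. by rewrite ler_norml sin_le1. Qed.

Lemma atan_le2 (x : R) : - 2 <= atan x <= 2.
Proof.
have := atan_gtNpi2 x; have := atan_ltpi2 x; have := @pihalf_lt2 R.
by move=> ? ? ?; apply/andP; split; lra.
Qed.

Section VdC.
Variables (F dF ddF : R -> R) (a b : R).
Hypothesis ab : a <= b.
Hypothesis hF : forall x, a <= x <= b -> is_derive x 1 F (dF x).
Hypothesis hdF : forall x, a <= x <= b -> is_derive x 1 dF (ddF x).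

Let ccosF x : a <= x <= b -> {for x, continuous (fun y => cos (F y))}.
Proof. by move=> /hF xab; apply: is_derive_continuous (dcos xab). Qed.

(** Van der Corput's second derivative test.  The usual proof removes the
    neighbourhood of the stationary point on which [dF] is small; here [1 / dF]
    is replaced by its bounded substitute [dF / (dF ^ 2 + rho)], for which the
    integration by parts can be done on the whole interval. *)
Lemma van_der_corput2 (q : R) : 0 < q ->
  (forall x, a <= x <= b -> q ^+ 2 <= ddF x) ->
  `|\int[mu]_(x in `[a, b]) cos (F x)| <= 9 / q.
Proof.
move=> q0 hq.
pose w x := dF x / (dF x ^+ 2 + q ^+ 2).
have D0 x : 0 < dF x ^+ 2 + q ^+ 2 by rewrite ltr_wpDl ?sqr_ge0// exprn_gt0.
have wle x : `|w x| <= (2 * q)^-1.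
  rewrite /w normrM normfV (gtr0_norm (D0 x)) ler_pdivrMr// mulrC.
  rewrite ler_pdivlMr ?mulr_gt0//.
  have : 0 <= (`|dF x| - q) ^+ 2 by rewrite sqr_ge0.
  rewrite -(real_normK (num_real (dF x))); nra.
pose dw x := dF x * (- (dF x ^+ 2 + q ^+ 2) ^- 2 * (2%:R * dF x ^+ 1 * ddF x + 0))
             + (dF x ^+ 2 + q ^+ 2)^-1 * ddF x.
pose s x := cos (F x) * dF x * w x + sin (F x) * dw x.
pose e x := 2 / q * ((1 + (dF x / q) ^+ 2)^-1 * (ddF x / q)).
have hw x : a <= x <= b -> is_derive x 1 w (dw x).
  move=> xab; rewrite /w /dw; derive_with; first by rewrite gt_eqF.
  by rewrite !addr0.
have hs x : a <= x <= b -> is_derive x 1 (fun y => sin (F y) * w y) (s x).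
  by move=> xab; derive_with; rewrite /s; ring.
have he x : a <= x <= b -> is_derive x 1 (fun y => 2 / q * atan (dF y / q)) (e x).
  by move=> xab; derive_with; rewrite /e; ring.
have [es se] : (forall x, a <= x <= b -> s x - e x <= cos (F x)) /\
               (forall x, a <= x <= b -> cos (F x) <= s x + e x).
  suff H x : a <= x <= b -> s x - e x <= cos (F x) <= s x + e x.
    by split=> x /H /andP[].
  move=> xab; have := hq x xab; have := cos_le1 (F x); have := sin_le1 (F x).
  rewrite /s /e /dw /w; set c := cos _; set sn := sin _ => /andP[s1 s2] /andP[c1 c2].
  have := D0 x; set d := dF x; set dd := ddF x => D1 hqd.
  have DN : d ^+ 2 + q ^+ 2 != 0 by rewrite gt_eqF.
  have qN : q != 0 by rewrite gt_eqF.
  have q2 : 0 < q ^+ 2 by rewrite exprn_gt0.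
  set D := d ^+ 2 + q ^+ 2 in D1 DN *.
  have -> : c * d * (d / D) + sn * (d * (- D ^- 2 * (2%:R * d ^+ 1 * dd + 0)) + D^-1 * dd)
    = c + (- (c * q ^+ 2) + dd * (sn * (q ^+ 2 - d ^+ 2) / D)) / D.
    by rewrite /D; field.
  have -> : 2 / q * ((1 + (d / q) ^+ 2)^-1 * (dd / q)) = 2 * dd / D.
    by rewrite /D; field; rewrite DN qN.
  have : `|sn * (q ^+ 2 - d ^+ 2) / D| <= 1.
    rewrite normrM normfV (gtr0_norm D1) ler_pdivrMr// mul1r normrM.
    rewrite -[X in _ <= X]mul1r ler_pM//.
      by rewrite ler_norml s1.
    by rewrite ler_norml /D; apply/andP; have d0 := sqr_ge0 d; split; lra.
  set z := sn * _ / D; rewrite ler_norml => /andP[z1 z2].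
  have ddz1 : dd * z <= dd by rewrite ler_piMr// (le_trans _ hqd)// ltW.
  have ddz2 : - dd <= dd * z.
    by rewrite -mulrN1 ler_wpM2l// (le_trans _ hqd)// ltW.
  have cq1 : c * q ^+ 2 <= q ^+ 2 by rewrite ler_piMl// ltW.
  have cq2 : - q ^+ 2 <= c * q ^+ 2 by rewrite -mulN1r ler_wpM2r// ltW.
  set u := - (c * q ^+ 2) + dd * z.
  have : 0 <= (2 * dd - u) / D by rewrite divr_ge0 ?(ltW D1)// /u; lra.
  have : 0 <= (u + 2 * dd) / D by rewrite divr_ge0 ?(ltW D1)// /u; lra.
  by rewrite mulrBl mulrDl => ? ?; apply/andP; split; lra.
have bdy : `|sin (F b) * w b - sin (F a) * w a| <= q^-1.
  rewrite (le_trans (ler_normB _ _))// (normrM (sin (F b))) (normrM (sin (F a))).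
  have := wle a; have := wle b; have := abs_sin_le1 (F a); have := abs_sin_le1 (F b).
  move=> hb ha wb wa; apply: (@le_trans _ _ ((2 * q)^-1 + (2 * q)^-1)).
    by apply: lerD; rewrite -[leRHS]mul1r; apply: ler_pM.
  by rewrite invfM; lra.
have ata : `|2 / q * atan (dF b / q) - 2 / q * atan (dF a / q)| <= 8 / q.
  rewrite -mulrBr normrM gtr0_norm ?divr_gt0//.
  have := atan_le2 (dF b / q); have := atan_le2 (dF a / q) => /andP[? ?] /andP[? ?].
  rewrite (_ : 8 / q = 2 / q * 4); last by field; rewrite gt_eqF.
  by rewrite ler_pM2l ?divr_gt0// ler_norml; apply/andP; split; lra.
have up := @Rintegral_le_derive _ (fun x => cos (F x))
  (fun x => sin (F x) * w x + 2 / q * atan (dF x / q)) (fun x => s x + e x)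
  a b ab ccosF (fun x xab => dD (hs x xab) (he x xab)) se.
have lo := @Rintegral_ge_derive _ (fun x => cos (F x))
  (fun x => sin (F x) * w x - 2 / q * atan (dF x / q)) (fun x => s x - e x)
  a b ab ccosF (fun x xab => dD (hs x xab) (dN (he x xab))) es.
move: bdy ata; rewrite !ler_norml => /andP[? ?] /andP[? ?].
have -> : 9 / q = q^-1 + 8 / q by ring.
by apply/andP; split; [move: lo|move: up] => /=; lra.
Qed.

(** Without stationary point: one integration by parts, the derivative of the phase
    being monotone. *)
Lemma van_der_corput1 (m : R) : 0 < m ->
  (forall x, a <= x <= b -> 0 <= ddF x) ->
  (forall x, a <= x <= b -> m <= `|dF x|) ->
  `|\int[mu]_(x in `[a, b]) cos (F x)| <= 4 / m.
Proof.
move=> m0 hdd hm.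
have dF0 x : a <= x <= b -> dF x != 0.
  by move=> /hm; rewrite -normr_gt0; apply: lt_le_trans.
pose e x := dF x ^- 2 * ddF x.
pose s x := cos (F x) - sin (F x) * e x.
have hv x : a <= x <= b -> is_derive x 1 (fun y => (dF y)^-1) (- e x).
  by move=> xab; rewrite /e; derive_with; [exact: dF0|ring].
have hs x : a <= x <= b -> is_derive x 1 (fun y => sin (F y) / dF y) (s x).
  move=> xab; derive_with; rewrite /s; last by field; rewrite dF0.
have e0 x : a <= x <= b -> 0 <= e x.
  by move=> xab; rewrite mulr_ge0 ?hdd// invr_ge0 sqr_ge0.
have [es se] : (forall x, a <= x <= b -> s x - e x <= cos (F x)) /\
               (forall x, a <= x <= b -> cos (F x) <= s x + e x).
  suff H x : a <= x <= b -> s x - e x <= cos (F x) <= s x + e x.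
    by split=> x /H /andP[].
  move=> /e0 e0x; have /andP[s1 s2] := sin_le1 (F x).
  have h1 : sin (F x) * e x <= e x by rewrite ler_piMl.
  have h2 : - e x <= sin (F x) * e x by rewrite -mulN1r ler_wpM2r.
  by rewrite /s; apply/andP; split; lra.
have vle x : a <= x <= b -> `|(dF x)^-1| <= m^-1.
  by move=> xab; rewrite normfV lef_pV2 ?posrE ?normr_gt0 ?dF0 ?hm.
have svle x : a <= x <= b -> `|sin (F x) / dF x| <= m^-1.
  by move=> xab; rewrite normrM -[leRHS]mul1r; apply: ler_pM; rewrite ?vle ?abs_sin_le1.
have up := @Rintegral_le_derive _ (fun x => cos (F x))
  (fun x => sin (F x) / dF x - (dF x)^-1) (fun x => s x - - e x)
  a b ab ccosF (fun x xab => dD (hs x xab) (dN (hv x xab))).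
have lo := @Rintegral_ge_derive _ (fun x => cos (F x))
  (fun x => sin (F x) / dF x + (dF x)^-1) (fun x => s x - e x)
  a b ab ccosF (fun x xab => dD (hs x xab) (hv x xab)) es.
have aab : a <= a <= b by rewrite lexx ab.
have bab : a <= b <= b by rewrite lexx ab.
have := vle _ aab; have := vle _ bab; have := svle _ aab; have := svle _ bab.
rewrite !ler_norml => /andP[? ?] /andP[? ?] /andP[? ?] /andP[? ?].
have -> : 4 / m = m^-1 + m^-1 + m^-1 + m^-1 by ring.
apply/andP; split; first by move: lo => /=; lra.
have /up : forall x, a <= x <= b -> cos (F x) <= s x - - e x.
  by move=> x xab; rewrite opprK se.
by move=> /=; lra.
Qed.

End VdC.

Lemma ler_powR_neg (p x y : R) : p <= 0 -> 0 < x -> x <= y -> y `^ p <= x `^ p.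
Proof.
move=> p0 x0 xy; have y0 := lt_le_trans x0 xy.
rewrite -(opprK p) !(powRN _ (- p)) lef_pV2 ?posrE ?powR_gt0//.
by rewrite ge0_ler_powR ?oppr_ge0 ?nnegrE ?(ltW x0) ?(ltW y0).
Qed.

Lemma gt0_powRD (x r s : R) : 0 < x -> x `^ (r + s) = x `^ r * x `^ s.
Proof. by move=> x0; rewrite powRD// (gt_eqF x0) implybT. Qed.

Lemma gt0_powRB (x r s : R) : 0 < x -> x `^ (r - s) = x `^ r / x `^ s.
Proof. by move=> x0; rewrite gt0_powRD// powRN. Qed.

Lemma powR_sqr (x p : R) : 0 < x -> (x `^ (p / 2)) ^+ 2 = x `^ p.
Proof. by move=> x0; rewrite expr2 -gt0_powRD// -splitr. Qed.

(** Bound of the kernel of the operator composed with its adjoint.  If [x]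
    dominates the derivative of [t * l `^ a] the phase has no stationary point;
    otherwise [t] is at least of order [|x| * N `^ (1 - a)], which makes the
    second derivative of the phase large.  The bound is only sharp at
    [|x| = N `^ (a - 1)], but its dependence on [N] gives the exponent [a / 4]. *)
Lemma oscillatory_block (a : R) : 0 < a < 1 -> exists2 C : R, 1 <= C &
  forall N t x c : R, 1 <= N -> `|t| <= 2 -> x != 0 ->
  `|\int[mu]_(l in `[N, 2 * N]) cos (x * l + t * l `^ a + c)|
    <= C * N `^ (a / 2) / `|x|.
Proof.
move=> /andP[a0 a1].
pose C := 8 + 9 * Num.sqrt (32 / (1 - a)).
have C0 : 0 <= 9 * Num.sqrt (32 / (1 - a)) by rewrite mulr_ge0// sqrtr_ge0.
exists C; first by rewrite /C; lra.
move=> N.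
suff H t x c : 1 <= N -> - 2 <= t <= 0 -> x != 0 ->
  `|\int[mu]_(l in `[N, 2 * N]) cos (x * l + t * l `^ a + c)|
    <= C * N `^ (a / 2) / `|x|.
  move=> t x c N1 t2 x0; have [t0|t0] := leP t 0.
    by apply: H => //; move: t2; rewrite ler_norml t0 => /andP[->].
  rewrite -(normrN x).
  under eq_Rintegral do rewrite -cosN !opprD -!mulNr.
  by apply: H; rewrite ?oppr_eq0//; move: t2; rewrite ler_norml => /andP[? ?]; lra.
move=> N1 /andP[t2 t0] x0.
have N0 : 0 < N by lra.
have x0' : 0 < `|x| by rewrite normr_gt0.
have NN : N <= 2 * N by lra.
have lpos l : N <= l <= 2 * N -> 0 < l by move=> /andP[? _]; lra.
have dF l : N <= l <= 2 * N -> is_derive l 1 (fun l => x * l + t * l `^ a + c)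
    (x + t * (a * l `^ (a - 1))).
  by move=> /lpos l0; derive_with => //; ring.
have ddF l : N <= l <= 2 * N -> is_derive l 1 (fun l => x + t * (a * l `^ (a - 1)))
    (t * (a * ((a - 1) * l `^ (a - 2)))).
  move=> /lpos l0; derive_with => //.
  by rewrite (_ : a - 1 - 1 = a - 2); ring.
have ta : 0 <= t * (a * (a - 1)) by rewrite mulr_le0// mulr_ge0_le0//; lra.
have Na : 0 < N `^ a by rewrite powR_gt0.
have Na1 : N `^ (a - 1) = N `^ a / N.
  by rewrite gt0_powRB// powRr1 ?ltW.
have Nahalf : 1 <= N `^ (a / 2).
  by apply: (@le_trans _ _ (N `^ 0)); [rewrite powRr0|rewrite ler_powR//; lra].
have Na2 : N `^ (a - 2) = N `^ a / N ^+ 2.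
  by rewrite gt0_powRB// (@powR_mulrn _ N 2)// ltW.
have [xbig|xsmall] := leP (2 * a * - t * N `^ (a - 1)) `|x|.
  have -> : C * N `^ (a / 2) / `|x| = 4 / (`|x| / 2) * (C / 8 * N `^ (a / 2)).
    by field; rewrite gt_eqF.
  apply: (@le_trans _ _ (4 / (`|x| / 2))); last first.
    have CN : 1 <= C / 8 * N `^ (a / 2).
      have C8 : 1 <= C / 8 by rewrite /C; lra.
      nra.
    by rewrite ler_peMr// !divr_ge0.
  apply: (van_der_corput1 NN dF ddF); first by rewrite divr_gt0.
    move=> l lN; rewrite [X in 0 <= X](_ : _ = t * (a * (a - 1)) * l `^ (a - 2)); last ring.
    by rewrite mulr_ge0// powR_ge0.
  move=> l lN; have l0 := lpos _ lN.
  have : `|t * (a * l `^ (a - 1))| <= `|x| / 2.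
    rewrite normrM ler0_norm// ger0_norm ?mulr_ge0 ?powR_ge0 ?(ltW a0)//.
    have : l `^ (a - 1) <= N `^ (a - 1).
      by apply: ler_powR_neg => //; [lra|case/andP: lN].
    move=> h; rewrite ler_pdivlMr//; apply: le_trans xbig.
    rewrite [leLHS](_ : _ = 2 * a * - t * l `^ (a - 1)); last ring.
    by rewrite ler_wpM2l// !mulr_ge0//; lra.
  have := lerB_normD x (t * (a * l `^ (a - 1))); lra.
pose q2 := t * (a * (a - 1)) * (2 * N) `^ (a - 2).
have tn0 : t < 0.
  rewrite lt_neqAle t0 andbT; apply: contraTneq xsmall => ->.
  by rewrite oppr0 mulr0 mul0r normr_lt0.
have q20 : 0 < q2.
  rewrite /q2 mulr_gt0//; last by rewrite powR_gt0// mulr_gt0.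
  rewrite (_ : t * _ = - t * (a * (1 - a))); last ring.
  by rewrite !mulr_gt0//; lra.
have q0 : 0 < Num.sqrt q2 by rewrite sqrtr_gt0.
apply: (@le_trans _ _ (9 / Num.sqrt q2)).
  apply: (van_der_corput2 NN dF ddF) => // l lN.
  rewrite sqr_sqrtr ?(ltW q20)// /q2.
  rewrite [leRHS](_ : _ = t * (a * (a - 1)) * l `^ (a - 2)); last ring.
  rewrite ler_wpM2l//; apply: ler_powR_neg; [lra|exact: lpos|by case/andP: lN].
rewrite ler_pdivrMr// mulrAC ler_pdivlMr//.
have q2ge : x ^+ 2 <= 32 / (1 - a) * N `^ a * q2.
  have two : 4^-1 <= (2 : R) `^ (a - 2).
    apply: (@le_trans _ _ (2 `^ (- 2%:R))); last by rewrite ler_powR//; lra.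
    by rewrite powR_invn// -natrX.
  rewrite /q2 powRM ?(ltW N0)// Na2.
  have xle : x ^+ 2 <= (2 * a * - t * (N `^ a / N)) ^+ 2.
    rewrite -Na1 -(real_normK (num_real x)) ler_pXn2r ?nnegrE ?normr_ge0//.
    - exact: ltW.
    - by rewrite mulr_ge0 ?powR_ge0// !mulr_ge0//; lra.
  apply: (le_trans xle).
  set A := N `^ a / N.
  rewrite (_ : 32 / (1 - a) * _ * _ = 32 * a * - t * 2 `^ (a - 2) * A ^+ 2); last first.
    by rewrite /A; field; apply/andP; split; [rewrite gt_eqF|lra].
  rewrite [leLHS](_ : _ = (4 * a * - t) * (a * - t) * A ^+ 2); last ring.
  rewrite ler_wpM2r ?sqr_ge0//.
  rewrite (_ : 32 * a * - t * _ = (4 * a * - t) * (8 * 2 `^ (a - 2))); last ring.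
  have h1 : 0 <= 4 * a * - t by rewrite !mulr_ge0//; lra.
  have h2 : a * - t <= 8 * 2 `^ (a - 2) by nra.
  exact: ler_wpM2l.
apply: (@le_trans _ _ (9 * Num.sqrt (32 / (1 - a) * N `^ a * q2))).
  rewrite ler_pM2l// -sqrtr_sqr ler_sqrt//.
  by rewrite (mulr_ge0 _ (ltW q20))// (mulr_ge0 _ (ltW Na))// divr_ge0//; lra.
rewrite sqrtrM; last by rewrite (mulr_ge0 _ (ltW Na))// divr_ge0//; lra.
rewrite sqrtrM; last by rewrite divr_ge0//; lra.
rewrite -(powR_sqr a N0) sqrtr_sqr (gtr0_norm (powR_gt0 _ N0)).
rewrite !mulrA ler_pM2r// ler_pM2r ?powR_gt0// /C; lra.
Qed.

End Oscillatory.

(** * Square integrable functions on a set of finite measure *)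

Section SquareIntegrable.
Context d (T : measurableType d) {R : realType} (mu : {measure set T -> \bar R}).
Variables (D : set T).
Hypotheses (mD : measurable D) (finD : (mu D < +oo)%E).
Implicit Types (f g e : T -> R).

Local Notation intble f := (mu.-integrable D (EFin \o f)).

Lemma intble_add f g : intble f -> intble g -> intble (fun x => f x + g x).
Proof. by move=> fi gi; exact: (integrableD mD fi gi). Qed.

Lemma intble_scale (k : R) f : intble f -> intble (fun x => k * f x).
Proof. by move=> fi; exact: (integrableZl mD k fi). Qed.

Lemma intble_sum n (f : 'I_n -> T -> R) : (forall i, intble (f i)) ->
  intble (fun x => \sum_(i < n) f i x).
Proof.
move=> fi; apply: (eq_integrable mD (fun x => (\sum_(i < n) (f i x)%:E)%E)).
  by move=> x _ /=; rewrite sumEFin.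
by apply: (integrable_sum mD) => i _; exact: fi.
Qed.

Lemma Rintegral_sum n (f : 'I_n -> T -> R) : (forall i, intble (f i)) ->
  \int[mu]_(x in D) (\sum_(i < n) f i x) = \sum_(i < n) \int[mu]_(x in D) f i x.
Proof.
elim: n f => [|n IH] f fi.
  under eq_Rintegral do rewrite big_ord0.
  by rewrite big_ord0 /Rintegral integral0.
under eq_Rintegral do rewrite big_ord_recr.
rewrite RintegralD//; last by apply: intble_sum => i; exact: fi.
by rewrite big_ord_recr /= IH// => i; exact: fi.
Qed.

Lemma intble_le f g : measurable_fun D f -> (forall x, D x -> `|f x| <= g x) ->
  intble g -> intble f.
Proof.
move=> mf fg; apply: le_integrable => //; first exact/measurable_EFinP.
move=> x Dx /=; rewrite lee_fin (le_trans (fg _ Dx))//; exact: ler_norm.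
Qed.

Lemma intble_bounded f (B : R) : measurable_fun D f ->
  (forall x, D x -> `|f x| <= B) -> intble f.
Proof.
move=> mf fB; apply: measurable_bounded_integrable => //.
exists B; split; first exact: num_real.
by move=> M BM x Dx /=; rewrite (le_trans (fB _ Dx))// ltW.
Qed.

Lemma intble_mul_bounded f e (B : R) : measurable_fun D f -> measurable_fun D e ->
  (forall x, D x -> `|e x| <= B) -> intble (fun x => f x ^+ 2) ->
  intble (fun x => f x * e x).
Proof.
move=> mf me eB fi.
have B1 : intble (fun=> `|B|) by apply: (@intble_bounded _ `|B|) => // x _; rewrite normr_id.
apply: (intble_le _ _ (intble_add B1 (intble_scale `|B| fi))).
  exact: measurable_funM.
move=> x Dx; rewrite normrM -{1}(mulr1 `|B|) -mulrDr mulrC.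
have f1 : `|f x| <= 1 + f x ^+ 2.
  by rewrite -(real_normK (num_real (f x))); have := normr_ge0 (f x); nra.
by rewrite ler_pM// (le_trans (eB _ Dx))// ler_norm.
Qed.

Lemma intble_sqr_mul f e (B : R) : measurable_fun D f -> measurable_fun D e ->
  (forall x, D x -> `|e x| <= B) -> intble (fun x => f x ^+ 2) ->
  intble (fun x => (f x * e x) ^+ 2).
Proof.
move=> mf me eB fi; apply: (intble_le _ _ (intble_scale (B ^+ 2) fi)).
  by apply: measurable_funX; exact: measurable_funM.
move=> x Dx; rewrite exprMn normrM mulrC !ger0_norm ?sqr_ge0//.
rewrite ler_wpM2r ?sqr_ge0// -(real_normK (num_real (e x))).
by rewrite ler_pXn2r ?nnegrE ?normr_ge0 ?eB// (le_trans _ (eB _ Dx)).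
Qed.

Lemma Rintegral_sqr_ge0 f : 0 <= \int[mu]_(x in D) (f x ^+ 2).
Proof. by apply: Rintegral_ge0 => x _; rewrite sqr_ge0. Qed.

(** Bombieri's large sieve inequality: Bessel's inequality for a family which is
    only almost orthogonal, obtained by expanding the square norm of
    [g - L^-1 * \sum_i c i * e i], where [c i] is the inner product of [g]
    and [e i]. *)
Lemma large_sieve n (e : 'I_n -> T -> R) (B L : R) g : 0 < L ->
  (forall i, measurable_fun D (e i)) ->
  (forall i x, D x -> `|e i x| <= B) ->
  (forall i, \sum_(j < n) `|\int[mu]_(x in D) (e i x * e j x)| <= L) ->
  measurable_fun D g -> intble (fun x => g x ^+ 2) ->
  \sum_(i < n) (\int[mu]_(x in D) (g x * e i x)) ^+ 2
    <= L * \int[mu]_(x in D) (g x ^+ 2).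
Proof.
move=> L0 me eB gram mg gi.
pose c i := \int[mu]_(x in D) (g x * e i x).
pose S := \sum_(i < n) c i ^+ 2.
pose h x := \sum_(i < n) c i * e i x.
have eei i j : intble (fun x => e i x * e j x).
  apply: (@intble_bounded _ (B * B)); first exact: measurable_funM.
  by move=> x Dx; rewrite normrM ler_pM ?eB.
have gei i : intble (fun x => g x * e i x).
  by apply: (@intble_mul_bounded _ _ B) => //; exact: eB.
have ghi : intble (fun x => g x * h x).
  apply: (eq_integrable mD (EFin \o (fun x => \sum_(i < n) c i * (g x * e i x)))).
    by move=> x _ /=; rewrite /h mulr_sumr; congr EFin; apply: eq_bigr => i _; ring.
  by apply: intble_sum => i; apply: intble_scale; exact: gei.
have ghE : \int[mu]_(x in D) (g x * h x) = S.
  transitivity (\int[mu]_(x in D) (\sum_(i < n) c i * (g x * e i x))).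
    by apply: eq_Rintegral => x _; rewrite /h mulr_sumr; apply: eq_bigr => i _; ring.
  rewrite Rintegral_sum; last by move=> i; apply: intble_scale; exact: gei.
  by apply: eq_bigr => i _; rewrite RintegralZl// -/(c i) expr2.
have hh x : h x ^+ 2 = \sum_(i < n) \sum_(j < n) c i * c j * (e i x * e j x).
  rewrite expr2 /h mulr_suml; apply: eq_bigr => i _.
  by rewrite mulr_sumr; apply: eq_bigr => j _; ring.
have hhi : intble (fun x => h x ^+ 2).
  apply: (eq_integrable mD (EFin \o (fun x =>
    \sum_(i < n) \sum_(j < n) c i * c j * (e i x * e j x)))).
    by move=> x _ /=; rewrite hh.
  by do 2!apply: intble_sum => ?; apply: intble_scale; exact: eei.
have hhE : \int[mu]_(x in D) (h x ^+ 2) <= L * S.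
  rewrite (_ : \int[mu]_(x in D) (h x ^+ 2) =
      \sum_(i < n) \sum_(j < n) c i * c j * \int[mu]_(x in D) (e i x * e j x)); last first.
    under eq_Rintegral do rewrite hh.
    rewrite Rintegral_sum; last first.
      by move=> i; apply: intble_sum => j; apply: intble_scale; exact: eei.
    apply: eq_bigr => i _; rewrite Rintegral_sum; last first.
      by move=> j; apply: intble_scale; exact: eei.
    by apply: eq_bigr => j _; rewrite RintegralZl//; exact: eei.
  pose I i j := `|\int[mu]_(x in D) (e i x * e j x)|.
  have Isym i j : I i j = I j i.
    by rewrite /I; under eq_Rintegral do rewrite mulrC.
  apply: (@le_trans _ _ (\sum_(i < n) \sum_(j < n) 2^-1 * (c i ^+ 2 + c j ^+ 2) * I i j)).
    apply: ler_sum => i _; apply: ler_sum => j _.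
    rewrite (le_trans (ler_norm _))// normrM ler_wpM2r// normrM.
    rewrite -(real_normK (num_real (c i))) -(real_normK (num_real (c j))).
    by have := sqr_ge0 (`|c i| - `|c j|); nra.
  have -> : \sum_(i < n) \sum_(j < n) 2^-1 * (c i ^+ 2 + c j ^+ 2) * I i j =
            \sum_(i < n) \sum_(j < n) c i ^+ 2 * I i j.
    have E : \sum_(i < n) \sum_(j < n) c j ^+ 2 * I i j =
             \sum_(i < n) \sum_(j < n) c i ^+ 2 * I i j.
      by rewrite exchange_big; do 2!apply: eq_bigr => ? _; rewrite Isym.
    transitivity (2^-1 * (\sum_(i < n) \sum_(j < n) c i ^+ 2 * I i j) +
                  2^-1 * (\sum_(i < n) \sum_(j < n) c j ^+ 2 * I i j)); last first.
      by rewrite E; set z := \sum_(_ < _) _; lra.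
    rewrite !mulr_sumr -big_split; apply: eq_bigr => i _.
    by rewrite !mulr_sumr -big_split; apply: eq_bigr => j _ /=; ring.
  rewrite /S mulr_sumr; apply: ler_sum => i _.
  by rewrite -mulr_sumr mulrC ler_wpM2r ?sqr_ge0 ?gram.
have := Rintegral_sqr_ge0 (fun x => g x - L^-1 * h x).
have -> : \int[mu]_(x in D) ((g x - L^-1 * h x) ^+ 2) =
    \int[mu]_(x in D) (g x ^+ 2) - 2 * L^-1 * S + L^-1 ^+ 2 * \int[mu]_(x in D) (h x ^+ 2).
  transitivity (\int[mu]_(x in D)
      (g x ^+ 2 + ((- (2 * L^-1)) * (g x * h x) + L^-1 ^+ 2 * h x ^+ 2))).
    by apply: eq_Rintegral => x _; ring.
  rewrite RintegralD//; last by apply: intble_add; exact: intble_scale.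
  rewrite RintegralD//; [|exact: intble_scale|exact: intble_scale].
  by rewrite !RintegralZl// ghE; ring.
move=> h0.
have : L^-1 ^+ 2 * \int[mu]_(x in D) (h x ^+ 2) <= L^-1 * S.
  apply: (@le_trans _ _ (L^-1 ^+ 2 * (L * S))); first by rewrite ler_wpM2l ?sqr_ge0.
  by rewrite expr2 -mulrA mulKf// gt_eqF.
move=> h1; rewrite -ler_pdivrMl// -/S; lra.
Qed.

Lemma cauchy_schwarz_bounded e (B : R) g :
  measurable_fun D e -> (forall x, D x -> `|e x| <= B) ->
  measurable_fun D g -> intble (fun x => g x ^+ 2) ->
  (\int[mu]_(x in D) (g x * e x)) ^+ 2
    <= (\int[mu]_(x in D) (e x ^+ 2)) * \int[mu]_(x in D) (g x ^+ 2).
Proof.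
move=> me eB mg gi; apply/ler_addgt0Pl => eps eps0.
set G := \int[mu]_(x in D) (g x ^+ 2); set E := \int[mu]_(x in D) (e x ^+ 2).
have G0 : 0 <= G := Rintegral_sqr_ge0 g.
have E0 : 0 <= E := Rintegral_sqr_ge0 e.
have eps1 : 0 < eps / (1 + G) by rewrite divr_gt0//; lra.
have := @large_sieve 1 (fun=> e) B (E + eps / (1 + G)) g.
rewrite !big_ord1 -/G => H.
apply: (@le_trans _ _ ((E + eps / (1 + G)) * G)).
  apply: H => //; first lra.
  move=> _; under eq_Rintegral do rewrite -expr2.
  by rewrite ger0_norm// -/E; lra.
clear H; rewrite mulrDl addrC lerD2r mulrAC ler_pdivrMr; last lra.
by rewrite ler_pM2l//; lra.
Qed.

End SquareIntegrable.

(** * Maximal functions on a dyadic block of frequencies *)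

Section Harmonic.
Context {R : realType}.

Definition harmonic_sum (n : nat) : R := \sum_(i < n) i.+1%:R^-1.

Lemma harmonic_sum_ge0 n : 0 <= harmonic_sum n.
Proof. by apply: sumr_ge0 => i _; rewrite invr_ge0. Qed.

Lemma harmonic_sum_homo m n : (m <= n)%N -> harmonic_sum m <= harmonic_sum n.
Proof.
move=> mn; rewrite /harmonic_sum -!(big_mkord predT (fun i => i.+1%:R^-1)).
rewrite (big_cat_nat (leq0n m) mn)/= lerDl.
by apply: sumr_ge0 => i _; rewrite invr_ge0.
Qed.

Lemma sum_inv_dist (n : nat) (m : 'I_n) :
  \sum_(j < n | j != m) `|m%:R - j%:R|^-1 <= 2 * harmonic_sum n :> R.
Proof.
pose w (j : nat) : R := if j == m :> nat then 0 else `|m%:R - j%:R|^-1.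
have -> : \sum_(j < n | j != m) `|m%:R - j%:R|^-1 = \sum_(0 <= j < n) w j.
  rewrite big_mkord big_mkcond; apply: eq_bigr => j _.
  by rewrite /w -(inj_eq val_inj); case: eqP.
have mn : (m < n)%N := ltn_ord m.
rewrite (big_cat_nat (leq0n m) (ltnW mn))/=.
rewrite [X in _ + X](big_cat_nat (leqnSn m) mn)/= big_nat1 /w eqxx add0r.
rewrite mulr_natl mulr2n; apply: lerD.
  apply: le_trans (harmonic_sum_homo (ltnW mn)).
  rewrite big_nat_rev /harmonic_sum -(big_mkord predT (fun i => i.+1%:R^-1)) add0n.
  rewrite !big_nat; apply: ler_sum => i /andP[_ im].
  rewrite ifF; last by apply/negbTE; rewrite neq_ltn; lia.
  rewrite -natrB; last lia.
  by rewrite (_ : (m - (m - i.+1))%N = i.+1) ?ger0_norm; last lia.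
apply: le_trans (harmonic_sum_homo (leq_subr m.+1 n)).
rewrite -{1}(add0n m.+1) big_addn /harmonic_sum -(big_mkord predT (fun i => i.+1%:R^-1)).
rewrite !big_nat; apply: ler_sum => i _.
rewrite ifF; last by apply/negbTE; rewrite neq_ltn; lia.
rewrite distrC -natrB; last lia.
by rewrite (_ : (i + m.+1 - m)%N = i.+1) ?ger0_norm; last lia.
Qed.

Lemma harmonic_sum_le n : (0 < n)%N -> harmonic_sum n <= 1 + ln n%:R.
Proof.
case: n => // n _; elim: n => [|n IH].
  by rewrite /harmonic_sum big_ord1 ln1 addr0 invr1.
rewrite /harmonic_sum big_ord_recr /= -/(harmonic_sum n.+1).
have n1 : 0 < n.+1%:R :> R by rewrite ltr0n.
have n2 : 0 < n.+2%:R :> R by rewrite ltr0n.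
have := @le_ln1Dx R (n.+1%:R / n.+2%:R - 1).
have q0 : 0 < n.+1%:R / n.+2%:R :> R by rewrite divr_gt0.
rewrite addrCA subrr addr0 => /(_ _); rewrite ln_div ?posrE//.
have -> : n.+1%:R / n.+2%:R - 1 = - n.+2%:R^-1 :> R.
  by rewrite -[n.+2%:R]natr1; field; have := ler0n R n => ?; rewrite gt_eqF//; lra.
move=> /(_ _); set x := n.+2%:R^-1 => h.
have : ln n.+1%:R - ln n.+2%:R <= - x by apply: h; rewrite ltrN2 /x invf_lt1// ltr1n.
by move: IH; lra.
Qed.

Lemma harmonic_sum_powR (e : R) n : 0 < e -> (0 < n)%N ->
  harmonic_sum n <= (1 + e^-1) * n%:R `^ e.
Proof.
move=> e0 n0; apply: (le_trans (harmonic_sum_le n0)).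
have n1 : 1 <= n%:R :> R by rewrite ler1n.
have np : 0 < n%:R `^ e :> R by rewrite powR_gt0// (lt_le_trans ltr01).
have p1 : 1 <= n%:R `^ e :> R.
  by apply: (@le_trans _ _ (n%:R `^ 0)); [rewrite powRr0|rewrite ler_powR// ltW].
have := ln_sublinear np; rewrite ln_powR => h.
rewrite mulrDl mul1r lerD//.
by rewrite -ler_pdivrMl ?invrK ?invr_gt0// ltW.
Qed.

End Harmonic.

Section TaylorCos.
Context {R : realType}.

Lemma dsum n (f : 'I_n -> R -> R) (df : 'I_n -> R) (x : R) :
  (forall i, is_derive x 1 (f i) (df i)) ->
  is_derive x 1 (fun y => \sum_(i < n) f i y) (\sum_(i < n) df i).
Proof.
elim: n f df => [|n IH] f df h.
  rewrite big_ord0; under eq_fun do rewrite big_ord0; exact: dcst.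
rewrite big_ord_recr; under eq_fun do rewrite big_ord_recr.
exact: dD (IH _ _ (fun i => h _)) (h _).
Qed.

Definition taylor_cos (p : nat) (x y : R) : R :=
  \sum_(k < p) y ^+ k / k`!%:R * cos (x + k%:R * (pi / 2)).

Lemma taylor_cosS p x y : taylor_cos p.+1 x y = cos x +
  \sum_(k < p) y ^+ k.+1 / k.+1`!%:R * cos (x + k.+1%:R * (pi / 2)).
Proof. by rewrite /taylor_cos big_ord_recl/= expr0 fact0 divr1 mul0r addr0 mul1r. Qed.




Lemma dtaylor_cos p (x y : R) :
  is_derive y 1 (taylor_cos p.+1 x) (taylor_cos p (x + pi / 2) y).
Proof.
rewrite (_ : taylor_cos p.+1 x = fun y => cos x +
  \sum_(k < p) y ^+ k.+1 / k.+1`!%:R * cos (x + k.+1%:R * (pi / 2))); last first.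
  by apply/funext => z; rewrite taylor_cosS.
rewrite -[taylor_cos p _ y]add0r; notypeclasses refine (dD (dcst _ _) _).
notypeclasses refine (dsum _) => k; derive_with.
have k0 : k`!%:R != 0 :> R by rewrite pnatr_eq0 -lt0n fact_gt0.
have -> : x + pi / 2 + k%:R * (pi / 2) = x + k.+1%:R * (pi / 2) :> R.
  by rewrite -natr1; ring.
have k1 : k.+1%:R != 0 :> R by rewrite pnatr_eq0.
by rewrite factS natrM /=; field; rewrite k0 nat1r k1.
Qed.

Lemma taylor_cos_remainder p (x y : R) : 0 <= y ->
  `|cos (x + y) - taylor_cos p x y| <= y ^+ p / p`!%:R.
Proof.
move=> y0; elim: p x y y0 => [|p IH] x y y0.
  by rewrite /taylor_cos big_ord0 subr0 expr0 fact0 divr1 abs_cos_le1.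
have dr (z : R) : is_derive z 1 (fun z => cos (x + z) - taylor_cos p.+1 x z)
    (cos (x + pi / 2 + z) - taylor_cos p (x + pi / 2) z).
  apply: (@is_derive_eq _ _ _ _ _ _ _ (- sin (x + z) * (0 + 1) - taylor_cos p (x + pi / 2) z)).
    by notypeclasses refine (dD _ (dN (dtaylor_cos _ _ _))); der.
  by rewrite (_ : x + pi / 2 + z = x + z + pi / 2) ?cosDpihalf; ring.
have db (z : R) : is_derive z 1 (fun z => z ^+ p.+1 / p.+1`!%:R) (z ^+ p / p`!%:R).
  have p0 : p`!%:R != 0 :> R by rewrite pnatr_eq0 -lt0n fact_gt0.
  have p1 : p.+1%:R != 0 :> R by rewrite pnatr_eq0.
  by derive_with; rewrite factS natrM /=; field; rewrite p0 nat1r p1.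
have r0 : cos (x + 0) - taylor_cos p.+1 x 0 = 0.
  rewrite taylor_cosS addr0 big1 ?addr0 ?subrr// => k _.
  by rewrite exprS !mul0r.
have b0 : 0 ^+ p.+1 / p.+1`!%:R = 0 :> R by rewrite exprS !mul0r.
rewrite ler_norml; apply/andP; split.
  have : (fun z => (cos (x + z) - taylor_cos p.+1 x z) + z ^+ p.+1 / p.+1`!%:R) 0 <=
         (fun z => (cos (x + z) - taylor_cos p.+1 x z) + z ^+ p.+1 / p.+1`!%:R) y.
    apply: (is_derive_ge0_le_cc y0 (fun z _ => dD (dr z) (db z))) => z /andP[z0 _].
    by have := IH (x + pi / 2) z (ltW z0); rewrite ler_norml => /andP[? ?]; lra.
  by rewrite /= r0 b0 addr0; lra.
have : (fun z => z ^+ p.+1 / p.+1`!%:R - (cos (x + z) - taylor_cos p.+1 x z)) 0 <=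
       (fun z => z ^+ p.+1 / p.+1`!%:R - (cos (x + z) - taylor_cos p.+1 x z)) y.
  apply: (is_derive_ge0_le_cc y0 (fun z _ => dD (db z) (dN (dr z)))) => z /andP[z0 _].
  by have := IH (x + pi / 2) z (ltW z0); rewrite ler_norml => /andP[? ?]; lra.
by rewrite /= r0 b0 subr0; lra.
Qed.

Lemma sum_exp_coeff_le (p : nat) (y : R) : 0 <= y ->
  \sum_(k < p) y ^+ k / k`!%:R <= expR y.
Proof.
move=> y0; rewrite -(big_mkord predT (fun k => y ^+ k / k`!%:R)).
apply: (nondecreasing_cvgn_le _ (@is_cvg_series_exp_coeff _ y)) => m n mn.
rewrite /series/= (big_cat_nat (leq0n m) mn)/= lerDl.
by apply: sumr_ge0 => i _; exact: exp_coeff_ge0.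
Qed.

End TaylorCos.

Section Block.
Context {R : realType}.
Local Notation mu := (@lebesgue_measure R).
Variables (a C N : R).
Hypotheses (C1 : 1 <= C) (N1 : 1 <= N).
Hypothesis osc : forall t x c : R, `|t| <= 2 -> x != 0 ->
  `|\int[mu]_(l in `[N, 2 * N]) cos (x * l + t * l `^ a + c)|
    <= C * N `^ (a / 2) / `|x|.

Local Notation D := `[N, 2 * N]%classic.
Local Notation intble f := (mu.-integrable D (EFin \o f)).

Let mD : measurable D. Proof. exact: measurable_itv. Qed.

Let muD : mu D = N%:E.
Proof.
rewrite lebesgue_measure_itv/= lte_fin ifT; last by move: N1; lra.
by rewrite -EFinD; congr EFin; ring.
Qed.

Let finD : (mu D < +oo)%E. Proof. by rewrite muD ltry. Qed.

Let N0 : 0 < N. Proof. by move: N1; lra. Qed.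

Lemma measurable_cosT d (T : measurableType d) (E : set T) (f : T -> R) :
  measurable_fun E f -> measurable_fun E (fun x => cos (f x)).
Proof.
move=> mf; apply: (measurableT_comp _ mf).
by apply: continuous_measurable_fun => x; exact: continuous_cos.
Qed.

Lemma measurable_phase (s t c : R) (psi : R -> R) : measurable_fun D psi ->
  measurable_fun D (fun l => cos (s * l + t * psi l + c)).
Proof.
move=> mpsi; apply: measurable_cosT; apply: measurable_funD => //.
by apply: measurable_funD; apply: measurable_funM.
Qed.

Lemma Rintegral_le_cst (f : R -> R) (B : R) : measurable_fun D f ->
  (forall l, D l -> `|f l| <= B) -> `|\int[mu]_(l in D) f l| <= B * N.
Proof.
move=> mf fB; have fi := @intble_bounded _ _ _ mu D mD finD f B mf fB.
apply: (le_trans (@le_normr_Rintegral _ _ _ mu D f mD fi)).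
have -> : B * N = \int[mu]_(l in D) B.
  by rewrite Rintegral_cst//; congr (_ * _); exact: (esym (congr1 fine muD)).
apply: le_Rintegral => //; first exact: (integrable_norm fi).
by apply: (@intble_bounded _ _ _ mu D mD finD _ `|B|).
Qed.

Lemma prod_cos (x y : R) : cos x * cos y = 2^-1 * (cos (x - y) + cos (x + y)).
Proof. by rewrite cosB cosD; field. Qed.

Let mpow : measurable_fun D (fun l : R => l `^ a).
Proof. by apply: measurable_funTS; exact: measurable_powR. Qed.

(** The product of the two cosines splits into phases with frequencies [s - s'] and
    [s + s'], and the first one dominates since [|s - s'| <= s + s']. *)
Lemma gram_block (s s' t t' c c' : R) : 0 <= s -> 0 <= s' -> s != s' ->
  `|t| <= 1 -> `|t'| <= 1 ->
  `|\int[mu]_(l in D) (cos (s * l + t * l `^ a + c) * cos (s' * l + t' * l `^ a + c'))|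
    <= C * N `^ (a / 2) / `|s - s'|.
Proof.
move=> s0 s0' ss' t1 t1'.
have im u v w : intble (fun l => cos (u * l + v * l `^ a + w)).
  apply: (@intble_bounded _ _ _ mu D mD finD _ 1); first exact: measurable_phase.
  by move=> l _; exact: abs_cos_le1.
rewrite (_ : \int[mu]_(l in D) _ = \int[mu]_(l in D)
  (2^-1 * (cos ((s - s') * l + (t - t') * l `^ a + (c - c')) +
           cos ((s + s') * l + (t + t') * l `^ a + (c + c'))))); last first.
  by apply: eq_Rintegral => l _; rewrite prod_cos; congr (_ * (cos _ + cos _)); ring.
rewrite RintegralZl//; last by apply: intble_add => //; exact: im.
rewrite RintegralD//.
set K := C * _.
have K0 : 0 <= K by rewrite /K mulr_ge0 ?powR_ge0//; move: C1; lra.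
have h1 : `|\int[mu]_(l in D) cos ((s - s') * l + (t - t') * l `^ a + (c - c'))|
    <= K / `|s - s'|.
  apply: osc; last by rewrite subr_eq0.
  by rewrite (le_trans (ler_normB _ _))//; lra.
have sp : 0 < `|s - s'| by rewrite normr_gt0 subr_eq0.
have ss : `|s - s'| <= `|s + s'|.
  by rewrite (ger0_norm (addr_ge0 s0 s0')) ler_norml; apply/andP; split; lra.
have h2 : `|\int[mu]_(l in D) cos ((s + s') * l + (t + t') * l `^ a + (c + c'))|
    <= K / `|s - s'|.
  apply: (@le_trans _ _ (K / `|s + s'|)).
    apply: osc; first by rewrite (le_trans (ler_normD _ _))//; lra.
    by rewrite -normr_gt0 (lt_le_trans sp).
  by rewrite ler_wpM2l// lef_pV2 ?posrE// (lt_le_trans sp).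
rewrite normrM gtr0_norm ?invr_gt0//.
by rewrite ler_pdivrMl// (le_trans (ler_normD _ _))//; lra.
Qed.

(** The large sieve for the points [i * h] with arbitrary times [t i]: by
    [gram_block] the off-diagonal entries in a row of the Gram matrix are dominated
    by a harmonic sum. *)
Lemma grid_power n (h : R) (t c : 'I_n -> R) (G : R -> R) : 0 < h ->
  (forall i, `|t i| <= 1) -> measurable_fun D G -> intble (fun l => G l ^+ 2) ->
  \sum_(i < n) (\int[mu]_(l in D)
      (G l * cos (i%:R * h * l + t i * l `^ a + c i))) ^+ 2
  <= (N + 2 * C * N `^ (a / 2) / h * harmonic_sum n) * \int[mu]_(l in D) (G l ^+ 2).
Proof.
move=> h0 t1 mG iG.
set K := C * N `^ (a / 2).
have K0 : 0 <= K by rewrite /K mulr_ge0 ?powR_ge0//; move: C1; lra.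
apply: (@large_sieve _ _ _ mu D mD finD n
  (fun i l => cos (i%:R * h * l + t i * l `^ a + c i)) 1) => //.
- rewrite ltr_pwDl// mulr_ge0 ?harmonic_sum_ge0// divr_ge0 ?(ltW h0)// -mulrA -/K.
  by rewrite mulr_ge0.
- by move=> i; exact: measurable_phase.
- by move=> i l _; exact: abs_cos_le1.
move=> i; rewrite (bigD1 i)//=; apply: lerD.
  rewrite -[leRHS]mul1r; apply: Rintegral_le_cst.
    by apply: measurable_funM; exact: measurable_phase.
  by move=> l _; rewrite normrM -[leRHS]mulr1; apply: ler_pM; rewrite ?abs_cos_le1.
apply: (@le_trans _ _ (\sum_(j < n | j != i) K / h * `|i%:R - j%:R|^-1)).
  apply: ler_sum => j ji.
  have ij : i%:R != j%:R :> R by rewrite eqr_nat eq_sym.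
  have -> : K / h * `|i%:R - j%:R|^-1 = K / `|i%:R * h - j%:R * h|.
    by rewrite -mulrBl normrM (gtr0_norm h0) invfM; ring.
  apply: gram_block => //; try by rewrite mulr_ge0// ltW.
  by rewrite (inj_eq (mulIf _))// gt_eqF.
rewrite -mulr_sumr.
have -> : 2 * C * N `^ (a / 2) / h * harmonic_sum n = K / h * (2 * harmonic_sum n).
  by rewrite /K; ring.
by rewrite ler_wpM2l ?sum_inv_dist// divr_ge0// ltW.
Qed.

(** The product formula for cosines reduces the case of separate phases in [s] and
    [t] to [grid_power]. *)
Lemma grid_power2 n (h : R) (t c0 c1 : 'I_n -> R) (G : R -> R) : 0 < h ->
  (forall i, `|t i| <= 1) -> measurable_fun D G -> intble (fun l => G l ^+ 2) ->
  \sum_(i < n) (\int[mu]_(l in D)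
      (G l * (cos (i%:R * h * l + c0 i) * cos (t i * l `^ a + c1 i)))) ^+ 2
  <= (N + 2 * C * N `^ (a / 2) / h * harmonic_sum n) * \int[mu]_(l in D) (G l ^+ 2).
Proof.
move=> h0 t1 mG iG; set B := leRHS.
pose A (sg : R) (i : 'I_n) := \int[mu]_(l in D)
      (G l * cos (i%:R * h * l + sg * t i * l `^ a + (c0 i + sg * c1 i))).
have Aint (sg : R) (i : 'I_n) : intble (fun l =>
    G l * cos (i%:R * h * l + sg * t i * l `^ a + (c0 i + sg * c1 i))).
  apply: (@intble_mul_bounded _ _ _ mu D mD finD _ _ 1) => //; first exact: measurable_phase.
  by move=> l _; exact: abs_cos_le1.
have AB sg : `|sg| = 1 -> \sum_(i < n) A sg i ^+ 2 <= B.
  by move=> s1; apply: grid_power => // i; rewrite normrM s1 mul1r.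
have E (i : 'I_n) : \int[mu]_(l in D)
      (G l * (cos (i%:R * h * l + c0 i) * cos (t i * l `^ a + c1 i))) =
    2^-1 * (A (-1) i + A 1 i).
  rewrite /A -RintegralD//.
  rewrite -RintegralZl//; last by apply: intble_add => //; exact: Aint.
  apply: eq_Rintegral => l _; rewrite prod_cos -mulrDr mulrCA; congr (_ * (_ * _)).
  by congr (cos _ + cos _); ring.
apply: (@le_trans _ _ (2^-1 * (\sum_(i < n) A (-1) i ^+ 2 + \sum_(i < n) A 1 i ^+ 2))).
  rewrite -big_split mulr_sumr; apply: ler_sum => i _; rewrite E /=.
  by have := sqr_ge0 (A (-1) i - A 1 i); lra.
have := AB (-1); have := AB 1; rewrite normrN normr1 => /(_ erefl) ? /(_ erefl) ?; lra.
Qed.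

Lemma Rintegral_mul_le (G e : R -> R) (B : R) : 
  measurable_fun D e -> (forall l, D l -> `|e l| <= B) ->
  measurable_fun D G -> intble (fun l => G l ^+ 2) ->
  (\int[mu]_(l in D) (G l * e l)) ^+ 2 <= B ^+ 2 * N * \int[mu]_(l in D) (G l ^+ 2).
Proof.
move=> me eB mG iG.
apply: (le_trans (@cauchy_schwarz_bounded _ _ _ mu D mD finD e B G me eB mG iG)).
rewrite ler_wpM2r ?(@Rintegral_sqr_ge0 _ _ _ mu D)//.
apply: le_trans (ler_norm _) _; apply: Rintegral_le_cst; first exact: measurable_funX.
move=> l Dl; rewrite normrX ler_pXn2r ?nnegrE ?normr_ge0 ?eB//.
exact: le_trans (normr_ge0 _) (eB l Dl).
Qed.

Lemma weighted_cauchy_schwarz n (w z : 'I_n -> R) : (forall i, 0 <= w i) ->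
  (\sum_(i < n) w i * z i) ^+ 2 <= (\sum_(i < n) w i) * (\sum_(i < n) w i * z i ^+ 2).
Proof.
move=> w0.
have E : (\sum_(i < n) w i) * (\sum_(i < n) w i * z i ^+ 2) =
  \sum_(i < n) \sum_(j < n) w i * w j * (2^-1 * (z i ^+ 2 + z j ^+ 2)).
  have E1 : (\sum_(i < n) w i) * (\sum_(i < n) w i * z i ^+ 2) =
      \sum_(i < n) \sum_(j < n) w i * w j * z j ^+ 2.
    rewrite mulr_suml; apply: eq_bigr => i _; rewrite mulr_sumr.
    by apply: eq_bigr => j _; ring.
  have E2 : (\sum_(i < n) w i) * (\sum_(i < n) w i * z i ^+ 2) =
      \sum_(i < n) \sum_(j < n) w i * w j * z i ^+ 2.
    by rewrite E1 exchange_big; do 2!apply: eq_bigr => ? _; ring.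
  transitivity (2^-1 * (\sum_(i < n) \sum_(j < n) w i * w j * z i ^+ 2) +
                2^-1 * (\sum_(i < n) \sum_(j < n) w i * w j * z j ^+ 2)).
    by rewrite -E1 -E2; set u := _ * _; lra.
  rewrite !mulr_sumr -big_split; apply: eq_bigr => i _.
  by rewrite !mulr_sumr -big_split; apply: eq_bigr => j _ /=; ring.
rewrite E expr2 mulr_suml; apply: ler_sum => i _.
rewrite mulr_sumr; apply: ler_sum => j _.
rewrite (_ : w i * z i * (w j * z j) = w i * w j * (z i * z j)); last ring.
by rewrite ler_wpM2l ?mulr_ge0//; have := sqr_ge0 (z i - z j); lra.
Qed.

(** A bounded perturbation [theta] of the phase is removed by expanding in powers
    of [t * theta]: the powers of [t] leave the integral and those of [theta] are
    absorbed by [G].  The order [p] of the expansion depends on the number of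
    grid points, but the bound does not. *)
Lemma grid_power3 n (h K : R) (t c0 c1 : 'I_n -> R) (theta G : R -> R) :
  0 < h -> 0 < K ->
  (forall i, 0 <= t i <= 1) -> measurable_fun D G -> intble (fun l => G l ^+ 2) ->
  measurable_fun D theta -> (forall l, D l -> 0 <= theta l <= K) ->
  \sum_(i < n) (\int[mu]_(l in D)
      (G l * (cos (i%:R * h * l + c0 i) * cos (t i * l `^ a + c1 i + t i * theta l)))) ^+ 2
  <= 4 * expR K ^+ 2 * (N + 2 * C * N `^ (a / 2) / h * harmonic_sum n)
     * \int[mu]_(l in D) (G l ^+ 2).
Proof.
move=> h0 K0 t01 mG iG mth th0.
set G2 := \int[mu]_(l in D) (G l ^+ 2).
have G20 : 0 <= G2 by exact: Rintegral_sqr_ge0.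
set B := (N + _).
have NB : N <= B.
  rewrite /B lerDl mulr_ge0 ?harmonic_sum_ge0// divr_ge0 ?(ltW h0)// mulr_ge0 ?powR_ge0//.
  by rewrite mulr_ge0//; move: C1; lra.
have t1 i : `|t i| <= 1 by have /andP[? ?] := t01 i; rewrite ger0_norm.
have eK1 : 1 <= expR K by rewrite -expR0 ler_expR ltW.
pose Ts (i : 'I_n) (u : R -> R) := \int[mu]_(l in D) (G l * (cos (i%:R * h * l + c0 i) * u l)).
have mX (i : 'I_n) c : measurable_fun D (fun l => t i * l `^ a + c).
  by apply: measurable_funD => //; apply: measurable_funM.
have mcos0 (i : 'I_n) : measurable_fun D (fun l => cos (i%:R * h * l + c0 i)).
  by apply: measurable_cosT; apply: measurable_funD => //; apply: measurable_funM.
have mcosX (i : 'I_n) c : measurable_fun D (fun l => cos (t i * l `^ a + c)).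
  by apply: measurable_cosT; exact: mX.
have [p pB] : exists p, n%:R * (K ^+ p / p`!%:R) ^+ 2 <= 1.
  have : exp_coeff K k @[k --> \oo] --> (0 : R) by exact: cvg_exp_coeff.
  move/cvgrPdist_le => /(_ (n%:R + 1)^-1); rewrite invr_gt0 ltr_wpDl// => /(_ isT).
  move=> [p _ /(_ p (leqnn p))]; rewrite /= sub0r normrN => H.
  exists p; move: H; rewrite -[exp_coeff K p]/(K ^+ p / p`!%:R).
  rewrite ger0_norm; last by rewrite divr_ge0// exprn_ge0// ltW.
  set x := K ^+ p / _ => H.
  have x0 : 0 <= x by rewrite divr_ge0// exprn_ge0// ltW.
  have n0 := ler0n R n.
  have xn : x * (n%:R + 1) <= 1 by rewrite -ler_pdivlMr ?mul1r// ltr_wpDl.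
  nra.
pose S (i : 'I_n) l := taylor_cos p (t i * l `^ a + c1 i) (t i * theta l).
pose y (i : 'I_n) (k : nat) := \int[mu]_(l in D) (G l * theta l ^+ k *
   (cos (i%:R * h * l + c0 i) * cos (t i * l `^ a + (c1 i + k%:R * (pi / 2))))).
pose GK (k : nat) l := G l * (theta l / K) ^+ k.
have thK l : D l -> `|theta l / K| <= 1.
  move=> /th0 /andP[? ?]; rewrite ger0_norm; last by rewrite divr_ge0// ltW.
  by rewrite ler_pdivrMr// mul1r.
have thKk k l : D l -> `|(theta l / K) ^+ k| <= 1.
  by move=> Dl; rewrite normrX exprn_ile1// thK.
have mthKk k : measurable_fun D (fun l => (theta l / K) ^+ k).
  by apply: measurable_funX; apply: measurable_funM.
have mGK k : measurable_fun D (GK k) by exact: measurable_funM.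
have iGK k : intble (fun l => GK k l ^+ 2).
  by apply: (@intble_sqr_mul _ _ _ mu D mD G (fun l => (theta l / K) ^+ k) 1) => //; [exact: mthKk|exact: thKk].
have GKle k : \int[mu]_(l in D) (GK k l ^+ 2) <= G2.
  apply: le_Rintegral => // l Dl; rewrite /GK exprMn ler_piMr ?sqr_ge0//.
  by rewrite -(real_normK (num_real _)) expr_le1// thKk.
have yK (i : 'I_n) (k : nat) : y i k = K ^+ k * \int[mu]_(l in D) (GK k l *
   (cos (i%:R * h * l + c0 i) * cos (t i * l `^ a + (c1 i + k%:R * (pi / 2))))).
  rewrite -RintegralZl//; last first.
    apply: (@intble_mul_bounded _ _ _ mu D mD finD _ _ 1); [exact: mGK| | |exact: iGK].
      by apply: measurable_funM; [exact: mcos0|exact: mcosX].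
    by move=> l _; rewrite normrM -[leRHS]mulr1; apply: ler_pM; rewrite ?abs_cos_le1.
  apply: eq_Rintegral => l _; rewrite /GK expr_div_n; field.
  by rewrite expf_neq0// gt_eqF.
pose main (i : 'I_n) := \sum_(k < p) t i ^+ k / k`!%:R * y i k.
have mainE (i : 'I_n) : Ts i (S i) = main i.
  rewrite /main; transitivity (\int[mu]_(l in D) (\sum_(k < p) t i ^+ k / k`!%:R *
     (G l * theta l ^+ k *
   (cos (i%:R * h * l + c0 i) * cos (t i * l `^ a + (c1 i + k%:R * (pi / 2))))))).
    apply: eq_Rintegral => l _; rewrite /S /taylor_cos !mulr_sumr.
    by apply: eq_bigr => k _; rewrite exprMn (addrA (t i * l `^ a)); ring.
  have iy k : intble (fun l => G l * theta l ^+ k *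
   (cos (i%:R * h * l + c0 i) * cos (t i * l `^ a + (c1 i + k%:R * (pi / 2))))).
    apply: (@eq_integrable _ _ _ mu D mD (EFin \o (fun l => G l * (theta l ^+ k *
   (cos (i%:R * h * l + c0 i) * cos (t i * l `^ a + (c1 i + k%:R * (pi / 2)))))))).
      by move=> l _ /=; rewrite mulrA.
    apply: (@intble_mul_bounded _ _ _ mu D mD finD _ _ (K ^+ k)) => //.
      apply: measurable_funM; first exact: measurable_funX.
      by apply: measurable_funM; [exact: mcos0|exact: mcosX].
    move=> l Dl; have /andP[? ?] := th0 l Dl.
    rewrite normrM -[leRHS]mulr1; apply: ler_pM => //.
      by rewrite normrX ger0_norm// lerXn2r ?nnegrE ?(ltW K0).
    by rewrite normrM -[leRHS]mulr1; apply: ler_pM; rewrite ?abs_cos_le1.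
  rewrite (@Rintegral_sum _ _ _ mu D mD); last by move=> k; apply: (@intble_scale _ _ _ mu D mD).
  by apply: eq_bigr => k _; rewrite RintegralZl.
have mainle : \sum_(i < n) main i ^+ 2 <= expR K ^+ 2 * (B * G2).
  apply: (@le_trans _ _ (\sum_(i < n) (\sum_(k < p) K ^+ k / k`!%:R) *
      (\sum_(k < p) K ^+ k / k`!%:R * (y i k / K ^+ k) ^+ 2))).
    apply: ler_sum => i _.
    have -> : main i = \sum_(k < p) K ^+ k / k`!%:R * (t i ^+ k * (y i k / K ^+ k)).
      apply: eq_bigr => k _; field.
      by rewrite pnatr_eq0 -lt0n fact_gt0/= expf_neq0// gt_eqF.
    have w0 (k : 'I_p) : 0 <= K ^+ k / k`!%:R by rewrite divr_ge0// exprn_ge0// ltW.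
    apply: (le_trans (weighted_cauchy_schwarz _ w0)).
    rewrite ler_wpM2l ?sumr_ge0//; apply: ler_sum => k _.
    rewrite ler_wpM2l// [leLHS]exprMn ler_piMl ?sqr_ge0//.
    have /andP[ti0 ti1] := t01 i.
    by rewrite -exprM exprn_ile1.
  rewrite -mulr_sumr exchange_big /= expr2 -mulrA; apply: ler_pM.
  - by apply: sumr_ge0 => k _; rewrite divr_ge0// exprn_ge0// ltW.
  - apply: sumr_ge0 => k _; apply: sumr_ge0 => i _.
    by rewrite mulr_ge0 ?sqr_ge0// divr_ge0// exprn_ge0// ltW.
  - by apply: sum_exp_coeff_le; exact: ltW.
  apply: (@le_trans _ _ (\sum_(k < p) K ^+ k / k`!%:R * (B * G2))).
    apply: ler_sum => k _; rewrite -mulr_sumr ler_wpM2l//.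
      by rewrite divr_ge0// exprn_ge0// ltW.
    under eq_bigr do rewrite yK mulrAC mulfV ?mul1r ?expf_neq0 ?gt_eqF//.
    apply: (le_trans (@grid_power2 n h t c0 (fun i => c1 i + k%:R * (pi / 2)) (GK k) h0 t1 (mGK k) (iGK k))).
    by rewrite ler_wpM2l ?GKle// (le_trans _ NB)// ltW.
  rewrite -mulr_suml ler_wpM2r ?sum_exp_coeff_le ?(ltW K0)//.
  by rewrite mulr_ge0// (le_trans _ NB)// ltW.
pose T (i : 'I_n) := Ts i (fun l => cos (t i * l `^ a + c1 i + t i * theta l)).
have Tmain (i : 'I_n) : (T i - main i) ^+ 2 <= (K ^+ p / p`!%:R) ^+ 2 * N * G2.
  have mS : measurable_fun D (S i).
    rewrite /S /taylor_cos; apply: measurable_sum => k.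
    apply: measurable_funM; last by apply: measurable_cosT; apply: measurable_funD.
    by apply: measurable_funM => //; apply: measurable_funX; apply: measurable_funM.
  have mc : measurable_fun D (fun l => cos (t i * l `^ a + c1 i + t i * theta l)).
    by apply: measurable_cosT; apply: measurable_funD => //; apply: measurable_funM.
  have rem l : D l -> `|cos (t i * l `^ a + c1 i + t i * theta l) - S i l| <= K ^+ p / p`!%:R.
    move=> Dl; have /andP[? ?] := th0 l Dl; have /andP[? ?] := t01 i.
    have tt0 : 0 <= t i * theta l by rewrite mulr_ge0.
    apply: (le_trans (taylor_cos_remainder p _ tt0)).
    rewrite ler_wpM2r ?invr_ge0// lerXn2r ?nnegrE ?(ltW K0)//.
    by apply: le_trans (_ : theta l <= _) => //; rewrite ler_piMl.
  have Sb l : D l -> `|S i l| <= 1 + K ^+ p / p`!%:R.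
    move=> Dl; rewrite -(subKr (cos (t i * l `^ a + c1 i + t i * theta l)) (S i l)).
    by rewrite (le_trans (ler_normB _ _))// lerD ?abs_cos_le1 ?rem.
  have -> : T i - main i = \int[mu]_(l in D) (G l * (cos (i%:R * h * l + c0 i) *
      (cos (t i * l `^ a + c1 i + t i * theta l) - S i l))).
    rewrite -mainE /T /Ts -RintegralB//; last 2 first.
    - apply: (@intble_mul_bounded _ _ _ mu D mD finD _ _ 1) => //.
        exact: measurable_funM (mcos0 i) mc.
      by move=> l _; rewrite normrM -[leRHS]mulr1; apply: ler_pM; rewrite ?abs_cos_le1.
    - apply: (@intble_mul_bounded _ _ _ mu D mD finD _ _ (1 * (1 + K ^+ p / p`!%:R))) => //.
        exact: measurable_funM (mcos0 i) mS.
      by move=> l Dl; rewrite normrM; apply: ler_pM; rewrite ?abs_cos_le1// Sb.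
    by apply: eq_Rintegral => l _; ring.
  apply: Rintegral_mul_le => //.
    exact: measurable_funM (mcos0 i) (measurable_funB mc mS).
  by move=> l Dl; rewrite normrM -[leRHS]mul1r; apply: ler_pM; rewrite ?abs_cos_le1 ?rem.
apply: (@le_trans _ _ (\sum_(i < n) (2 * main i ^+ 2 + 2 * ((K ^+ p / p`!%:R) ^+ 2 * N * G2)))).
  apply: ler_sum => i _; rewrite -[leLHS]/(T i ^+ 2).
  have := Tmain i; have := sqr_ge0 (T i - 2 * main i); lra.
rewrite big_split/= sumr_const card_ord -mulr_sumr -mulr_natl.
have BG : N * G2 <= B * G2 by rewrite ler_wpM2r.
have BG0 : 0 <= N * G2 by rewrite mulr_ge0// ltW.
set x2 := (K ^+ p / _) ^+ 2 in pB *.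
have : n%:R * x2 * (N * G2) <= B * G2.
  by apply: le_trans BG; rewrite ler_piMl.
have eK2 : 1 <= expR K ^+ 2 by rewrite expr_ge1.
have : B * G2 <= expR K ^+ 2 * (B * G2) by rewrite ler_peMl// (le_trans _ BG).
move: mainle; set M := \sum_(_ < _) _.
rewrite (_ : 4 * expR K ^+ 2 * B * G2 = 4 * (expR K ^+ 2 * (B * G2))); last ring.
by lra.
Qed.

End Block.

Section MaximalBlock.
Context {R : realType}.
Local Notation mu := (@lebesgue_measure R).

(** A bound uniform in the choice of the times passes to suprema, since each term
    depends on its own time only. *)
Lemma sum_sup_le n (F : 'I_n -> R -> R) (B : R) :
  (forall i t, 0 <= F i t) ->
  (forall t : 'I_n -> R, (forall i, 0 <= t i <= 1) -> \sum_(i < n) F i (t i) <= B) ->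
  exists2 v : 'I_n -> R, forall i t, 0 <= t <= 1 -> F i t <= v i & \sum_(i < n) v i <= B.
Proof.
move=> F0 FB.
pose E i := [set F i t | t in `[0, 1]%classic].
have E0 i : E i !=set0 by exists (F i 0); exists 0; rewrite /= ?in_itv/= ?lexx ?ler01.
have Eub i : ubound (E i) B.
  move=> y [t]; rewrite /= in_itv/= => t01 <-.
  apply: le_trans (FB (fun=> t) (fun=> t01)).
  by rewrite (bigD1 i)//= lerDl sumr_ge0.
have Esup i : has_sup (E i) by split => //; exists B.
exists (fun i => sup (E i)).
  by move=> i t t01; apply: sup_upper_bound => //; exists t => //=; rewrite in_itv.
apply/ler_addgt0Pl => d d0.
have d0' : 0 < d / (n%:R + 1) by rewrite divr_gt0// ltr_wpDl.
have H i : exists t, 0 <= t <= 1 /\ sup (E i) - d / (n%:R + 1) <= F i t.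
  have [y [t]] := sup_adherent d0' (Esup i).
  by rewrite /= in_itv/= => t01 <- h; exists t; split => //; exact: ltW.
have [t ht] := choice H.
have := FB t (fun i => (ht i).1) => hB.
apply: (@le_trans _ _ (d + \sum_(i < n) F i (t i))); last by rewrite lerD2l.
apply: (@le_trans _ _ (\sum_(i < n) (d / (n%:R + 1) + F i (t i)))).
  by apply: ler_sum => i _; have := (ht i).2; lra.
rewrite big_split/= lerD2r sumr_const card_ord -[leLHS]mulr_natr mulrAC ler_pdivrMr.
  by rewrite ler_pM2l//; lra.
by have := ler0n R n; lra.
Qed.

Lemma cos_lipschitz (x y : R) : `|cos x - cos y| <= `|x - y|.
Proof.
wlog xy : x y / y <= x.
  by move=> H; have [/H//|/ltW/H] := leP y x; rewrite distrC (distrC x).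
rewrite [leRHS]ger0_norm ?subr_ge0// ler_norml.
have d1 z : y <= z <= x -> is_derive z 1 (fun z => z + cos z) (1 + - sin z * 1).
  by move=> _; der.
have d2 z : y <= z <= x -> is_derive z 1 (fun z => z - cos z) (1 - - sin z * 1).
  by move=> _; der.
have := is_derive_ge0_le_cc xy d1; have := is_derive_ge0_le_cc xy d2.
move=> h2 h1; apply/andP; split.
  have : y + cos y <= x + cos x.
    by apply: h1 => z _; have /andP[_ ?] := sin_le1 z; lra.
  lra.
have : y - cos y <= x - cos x.
  by apply: h2 => z _; have /andP[? _] := sin_le1 z; lra.
lra.
Qed.

(** The maximal function is controlled at the points of a grid of step at most
    [N ^- 2] by the large sieve, and between these points by the trivial Lipschitz
    bound in [s]. *)
Lemma maximal_block (a e K r : R) : 0 < a < 1 -> 0 < e -> 0 < K -> 0 < r ->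
  exists2 C : R, 0 < C & forall (N : R) (psi : R -> R), 1 <= N ->
  measurable_fun `[N, 2 * N] psi ->
  (forall l, `[N, 2 * N]%classic l -> `|psi l - l `^ a| <= K) ->
  forall (c0 c1 : R) (G : R -> R), measurable_fun `[N, 2 * N] G ->
  mu.-integrable `[N, 2 * N] (EFin \o (fun l => G l ^+ 2)) ->
  exists V : R -> R, [/\ measurable_fun [set: R] V, forall s, 0 <= V s,
    forall s t, 0 <= s < r -> 0 <= t <= 1 ->
      (\int[mu]_(l in `[N, 2 * N])
          (G l * (cos (s * l + c0) * cos (t * psi l + c1)))) ^+ 2 <= V s &
    (\int[mu]_(s in `[0%R, r[) (V s)%:E
       <= (C * N `^ (a / 2 + e) * \int[mu]_(l in `[N, 2 * N]) (G l ^+ 2))%:E)%E].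
Proof.
move=> a01 e0 K0 r0.
have [C C1 osc] := oscillatory_block a01.
pose H := (1 + (e / 2)^-1) * (r + 1) `^ (e / 2).
have H0 : 0 <= H by rewrite mulr_ge0 ?powR_ge0// addr_ge0// invr_ge0; lra.
pose eK := 4 * expR (2 * K) ^+ 2.
have eK0 : 0 < eK by rewrite mulr_gt0// exprn_gt0// expR_gt0.
exists (2 * (eK * (1 + 2 * C * H)) + 8 * r).
  have CH : 0 <= 2 * C * H by rewrite mulr_ge0//; lra.
  have : 0 < eK * (1 + 2 * C * H) by rewrite mulr_gt0//; lra.
  lra.
move=> N psi N1 mpsi hpsi c0 c1 G mG iG.
have N0 : 0 < N by lra.
set D := `[N, 2 * N]%classic in mpsi hpsi mG iG *.
have mD : measurable D by exact: measurable_itv.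
have finD : (mu D < +oo)%E.
  by rewrite /D lebesgue_measure_itv/=; case: ifP => _; rewrite ?ltry.
set G2 := \int[mu]_(l in D) (G l ^+ 2).
have G20 : 0 <= G2 by exact: (@Rintegral_sqr_ge0 _ _ _ mu D).
(* [r * N ^ 2] points make the step of the grid at most [N ^- 2] *)
pose n := (Num.truncn (r * N ^+ 2)).+1.
have rN0 : 0 <= r * N ^+ 2 by rewrite mulr_ge0 ?sqr_ge0// ltW.
have nlo : r * N ^+ 2 <= n%:R by rewrite ltW// truncnS_gt.
have nhi : n%:R <= (r + 1) * N ^+ 2.
  rewrite mulrDl mul1r /n -natr1; apply: lerD; first by rewrite truncn_le.
  by rewrite -[leLHS](expr1n _ 2) ler_pXn2r ?nnegrE//; lra.
have n0 : 0 < n%:R :> R by rewrite ltr0n.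
pose h := r / n%:R.
have h0 : 0 < h by rewrite divr_gt0.
have hN : h * N ^+ 2 <= 1 by rewrite /h mulrAC ler_pdivrMr// mul1r.
have nh : n%:R * h = r by rewrite /h mulrC divfK// gt_eqF.
pose T s t := \int[mu]_(l in D) (G l * (cos (s * l + c0) * cos (t * psi l + c1))).
pose theta l := psi l - l `^ a + K.
have mth : measurable_fun D theta.
  apply: measurable_funD => //; apply: measurable_funB => //.
  by apply: measurable_funTS; exact: measurable_powR.
have th0 l : D l -> 0 <= theta l <= 2 * K.
  by move=> /hpsi; rewrite ler_norml /theta => /andP[? ?]; apply/andP; split; lra.
set Lam := N + 2 * C * N `^ (a / 2) / h * harmonic_sum n.
have power (t : 'I_n -> R) : (forall i, 0 <= t i <= 1) ->
    \sum_(i < n) T (i%:R * h) (t i) ^+ 2 <= eK * Lam * G2.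
  move=> t01; have K20 : 0 < 2 * K by rewrite mulr_gt0.
  have := @grid_power3 _ a C N C1 N1 (fun t x c => osc N t x c N1) n h (2 * K) t
    (fun=> c0) (fun i => c1 - t i * K) theta G h0 K20 t01 mG iG mth th0.
  apply: le_trans; apply: ler_sum => i _.
  rewrite [X in _ <= X ^+ 2](_ : _ = T (i%:R * h) (t i))//.
  apply: eq_Rintegral => l _; congr (_ * (_ * cos _)).
  by rewrite /theta; ring.
have [v hv sumv] := @sum_sup_le n (fun i t => T (i%:R * h) t ^+ 2) _
  (fun i t => sqr_ge0 _) power.
pose w := (h * (2 * N)) ^+ 2 * N * G2.
have mu2N : fine (mu D) = N.
  rewrite /D lebesgue_measure_itv/= lte_fin ifT; last lra.
  by rewrite -EFinD /=; ring.
have mcs s : measurable_fun D (fun l => cos (s * l + c0)).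
  by apply: measurable_cosT; apply: measurable_funD => //; apply: measurable_funM.
have mct t : measurable_fun D (fun l => cos (t * psi l + c1)).
  by apply: measurable_cosT; apply: measurable_funD => //; apply: measurable_funM.
have Tint s t : mu.-integrable D
    (EFin \o (fun l => G l * (cos (s * l + c0) * cos (t * psi l + c1)))).
  apply: (@intble_mul_bounded _ _ _ mu D mD finD _ _ 1) => //.
    exact: measurable_funM (mcs s) (mct t).
  by move=> l _; rewrite normrM -[leRHS]mulr1; apply: ler_pM; rewrite ?abs_cos_le1.
have close s s' t : `|s - s'| <= h -> (T s t - T s' t) ^+ 2 <= w.
  move=> ss'; have -> : T s t - T s' t = \int[mu]_(l in D)
      (G l * ((cos (s * l + c0) - cos (s' * l + c0)) * cos (t * psi l + c1))).
    rewrite /T -RintegralB//.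
    by apply: eq_Rintegral => l _; ring.
  apply: (@Rintegral_mul_le _ N N1) => //.
    exact: measurable_funM (measurable_funB (mcs s) (mcs s')) (mct t).
  move=> l /=; rewrite in_itv/= => /andP[Nl lN].
  rewrite normrM -[leRHS]mulr1; apply: ler_pM; rewrite ?abs_cos_le1//.
  apply: (le_trans (cos_lipschitz _ _)).
  rewrite (_ : s * l + c0 - (s' * l + c0) = (s - s') * l); last ring.
  rewrite normrM; apply: ler_pM => //; rewrite ger0_norm//; lra.
pose I (i : nat) := `[i%:R * h, i.+1%:R * h[%classic.
have mI i : measurable (I i) by exact: measurable_itv.
have v0 i : 0 <= v i.
  apply: le_trans (hv i 0 _); first exact: sqr_ge0.
  by rewrite lexx ler01.
have w0 : 0 <= w by rewrite mulr_ge0// mulr_ge0 ?sqr_ge0// ltW.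
pose V s := \sum_(i < n) (2 * v i + 2 * w) * \1_(I i) s.
have V1 i : 0 <= 2 * v i + 2 * w by rewrite addr_ge0// mulr_ge0.
exists V; split.
- apply: measurable_sum => i; apply: measurable_funM => //.
- by move=> s; apply: sumr_ge0 => i _; rewrite mulr_ge0.
- move=> s t /andP[s0 sr] t01.
  have sh0 : 0 <= s / h by rewrite divr_ge0// ltW.
  have kn : (Num.truncn (s / h) < n)%N.
    by rewrite truncn_lt_nat// ltr_pdivrMr// nh.
  pose k := Ordinal kn.
  have [kl ku] : k%:R * h <= s /\ s < k.+1%:R * h.
    rewrite -ler_pdivlMr// -ltr_pdivrMr//; split; first by rewrite truncn_le.
    exact: truncnS_gt.
  rewrite /V (bigD1 k)//= -[leLHS]addr0; apply: lerD; last first.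
    by apply: sumr_ge0 => i _; rewrite mulr_ge0.
  rewrite indicE mem_set ?mulr1; last by rewrite /I/= in_itv/= kl ku.
  have := hv k t t01; rewrite -/(T s t).
  have : (T s t - T (k%:R * h) t) ^+ 2 <= w.
    apply: close; rewrite ger0_norm ?subr_ge0//.
    by move: ku; rewrite -natr1 mulrDl mul1r; lra.
  by have := sqr_ge0 (T s t - 2 * T (k%:R * h) t); rewrite /=; lra.
have -> : (\int[mu]_(s in `[0%R, r[) (V s)%:E)%E =
    (\int[mu]_(s in `[0%R, r[) (\sum_(i < n) ((2 * v i + 2 * w) * \1_(I i) s)%:E))%E.
  by apply: eq_integral => s _; rewrite /V sumEFin.
rewrite ge0_integral_sum//=; last 2 first.
- by move=> i; apply/measurable_EFinP; apply: measurable_funM => //; exact: (measurable_indic (mI _)).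
- by move=> i s _; rewrite lee_fin mulr_ge0.
apply: (@le_trans _ _ (\sum_(i < n) ((2 * v i + 2 * w) * h)%:E)%E).
  apply: lee_sum => i _.
  under eq_integral do rewrite EFinM.
  rewrite ge0_integralZl//; last 2 first.
  - by apply/measurable_EFinP; exact: (measurable_indic (mI _)).
  - by rewrite lee_fin.
  rewrite EFinM; apply: lee_wpmul2l; first by rewrite lee_fin.
  rewrite integral_indic//; last exact: mI.
  have le_mu : (mu (I i `&` `[0%R, r[) <= mu (I i))%E.
    apply: le_measure; rewrite ?inE; [|exact: mI|exact: subIsetl].
    exact: measurableI (mI i) (measurable_itv _).
  apply: (le_trans le_mu).
  rewrite /I lebesgue_measure_itv/=; case: ifP => _; last by rewrite lee_fin ltW.
  by rewrite -EFinD lee_fin -natr1; lra.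
rewrite sumEFin lee_fin -mulr_suml big_split/= sumr_const card_ord -mulr_sumr.
rewrite -[(2 * w) *+ n]mulr_natl.
rewrite (_ : (_ + _) * h = 2 * h * (\sum_(i < n) v i) + 2 * (n%:R * h) * w); last ring.
rewrite nh.
set P := N `^ (a / 2 + e).
have P1 : 1 <= P.
  apply: (@le_trans _ _ (N `^ 0)); first by rewrite powRr0.
  by rewrite ler_powR//; move/andP: a01 => [? _]; lra.
have hs : harmonic_sum n <= H * N `^ e.
  apply: (@le_trans _ _ ((1 + (e / 2)^-1) * n%:R `^ (e / 2))).
    by apply: harmonic_sum_powR => //; rewrite divr_gt0.
  rewrite /H -mulrA ler_wpM2l ?addr_ge0 ?invr_ge0 ?divr_ge0 ?(ltW e0)//.
  have -> : N `^ e = (N ^+ 2) `^ (e / 2).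
    by rewrite -powR_mulrn ?(ltW N0)// -powRrM; congr (_ `^ _); field.
  rewrite -powRM ?sqr_ge0//; last lra.
  by rewrite ge0_ler_powR ?nnegrE ?mulr_ge0 ?sqr_ge0//; lra.
have hLam : h * Lam <= (1 + 2 * C * H) * P.
  have c0' : 0 < 2 * C by lra.
  rewrite /Lam; set c := 2 * C in c0' *; rewrite mulrDr mulrDl mul1r; apply: lerD.
    apply: le_trans P1; apply: le_trans hN.
    by rewrite ler_pM2l// -[leLHS]mul1r expr2 ler_pM2r.
  rewrite (_ : h * _ = c * (N `^ (a / 2) * harmonic_sum n)); last first.
    by field; rewrite gt_eqF.
  rewrite -mulrA ler_pM2l// /P gt0_powRD// [leRHS]mulrCA ler_pM2l// powR_gt0//.
rewrite (mulrDl _ (8 * r) P) (mulrDl _ _ G2); apply: lerD.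
  rewrite (_ : 2 * (eK * _) * P * G2 = 2 * (eK * ((1 + 2 * C * H) * P) * G2)); last ring.
  rewrite -mulrA ler_pM2l//.
  apply: (@le_trans _ _ (h * (eK * Lam * G2))); first by rewrite ler_pM2l.
  rewrite (_ : h * _ = eK * (h * Lam) * G2); last ring.
  by rewrite ler_wpM2r// ler_pM2l.
rewrite /w (_ : 2 * r * _ = 8 * r * (h * N ^+ 2) * (h * N) * G2); last ring.
have hN1 : h * N <= 1.
  by apply: le_trans hN; rewrite ler_pM2l// -[leLHS]mul1r expr2 ler_pM2r.
have hN0 : 0 <= h * N by rewrite mulr_ge0// ltW.
have hNN0 : 0 <= h * N ^+ 2 by rewrite mulr_ge0 ?sqr_ge0// ltW.
rewrite ler_wpM2r// -(mulrA (8 * r)) ler_pM2l ?mulr_gt0//.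
by apply: le_trans P1; rewrite mulr_ile1.
Qed.

End MaximalBlock.

(** * The left-invariant metric in the global chart *)

Section Dot.
Context {R : realType}.

Lemma dotE d (u v : 'rV[R]_d) : dot u v = \sum_(i < d) u 0 i * v 0 i.
Proof. by rewrite /dot mxE; apply: eq_bigr => i _; rewrite mxE. Qed.

Lemma dotC d (u v : 'rV[R]_d) : dot u v = dot v u.
Proof. by rewrite !dotE; apply: eq_bigr => i _; rewrite mulrC. Qed.

Lemma dotDl d (u v w : 'rV[R]_d) : dot (u + v) w = dot u w + dot v w.
Proof. by rewrite /dot mulmxDl mxE. Qed.

Lemma dotZl d c (u v : 'rV[R]_d) : dot (c *: u) v = c * dot u v.
Proof. by rewrite /dot -scalemxAl mxE. Qed.

Lemma dotDr d (u v w : 'rV[R]_d) : dot w (u + v) = dot w u + dot w v.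
Proof. by rewrite !(dotC w) dotDl. Qed.

Lemma dotZr d c (u v : 'rV[R]_d) : dot u (c *: v) = c * dot u v.
Proof. by rewrite !(dotC u) dotZl. Qed.

Lemma dotNl d (u v : 'rV[R]_d) : dot (- u) v = - dot u v.
Proof. by rewrite -scaleN1r dotZl mulN1r. Qed.

Lemma dotNr d (u v : 'rV[R]_d) : dot v (- u) = - dot v u.
Proof. by rewrite !(dotC v) dotNl. Qed.

Lemma dot0l d (v : 'rV[R]_d) : dot 0 v = 0.
Proof. by rewrite -(scale0r 0) dotZl mul0r. Qed.

Lemma dot0r d (v : 'rV[R]_d) : dot v 0 = 0.
Proof. by rewrite dotC dot0l. Qed.

Lemma dot_ge0 d (u : 'rV[R]_d) : 0 <= dot u u.
Proof. by rewrite dotE; apply: sumr_ge0 => i _; rewrite -expr2 sqr_ge0. Qed.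

Lemma dot_row d e (u u' : 'rV[R]_d) (v v' : 'rV[R]_e) :
  dot (row_mx u v) (row_mx u' v') = dot u u' + dot v v'.
Proof. by rewrite /dot tr_row_mx mul_row_col mxE. Qed.

Lemma dot_scalar (a b : R) : dot (a%:M : 'rV_1) (b%:M : 'rV_1) = a * b.
Proof. by rewrite dotE big_ord1 !mxE eqxx !mulr1n. Qed.

Lemma dot_cauchy_schwarz d (u v : 'rV[R]_d) : dot u v ^+ 2 <= dot u u * dot v v.
Proof.
have [v0|v0] := eqVneq (dot v v) 0.
  have {}v0 : v = 0.
    apply/rowP => i; rewrite mxE.
    have : \sum_(i < d) v 0 i * v 0 i == 0 by rewrite -dotE v0.
    rewrite psumr_eq0; last by move=> j _; rewrite -expr2 sqr_ge0.
    by move/allP => /(_ i); rewrite mem_index_enum -expr2 sqrf_eq0 => /(_ isT) /eqP.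
  by rewrite v0 !dot0r mulr0 expr0n.
have vp : 0 < dot v v by rewrite lt_neqAle eq_sym v0 dot_ge0.
have := dot_ge0 (dot v v *: u - dot u v *: v).
rewrite !(dotDl, dotDr, dotNl, dotNr, dotZl, dotZr) (dotC v u).
rewrite [X in 0 <= X](_ : _ = dot v v * (dot u u * dot v v - dot u v ^+ 2)); last by ring.
by rewrite pmulr_rge0// subr_ge0.
Qed.

Lemma dot_delta d (u : 'rV[R]_d) j : dot u (delta_mx 0 j) = u 0 j.
Proof.
rewrite dotE (bigD1 j)//= big1 ?addr0; first by rewrite mxE !eqxx mulr1.
by move=> i ij; rewrite mxE (negbTE ij) andbF mulr0.
Qed.

Lemma eq_dot d (u v : 'rV[R]_d) : (forall x, dot u x = dot v x) -> u = v.
Proof. by move=> uv; apply/rowP => j; rewrite -!dot_delta. Qed.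

End Dot.

Section Metric.
Context {R : realType} (n : htype R).
Local Notation p := (dim_v n).
Local Notation q := (dim_z n).
Implicit Types (X Y : 'rV[R]_p) (Z : 'rV[R]_q) (x y E : DR n).

Lemma bracketDl X X' Y : bracket (X + X') Y = bracket X Y + bracket X' Y.
Proof. by have := bracket_linear 1 X X' Y; rewrite !scale1r. Qed.

Lemma bracket0l Y : bracket (0 : 'rV[R]_p) Y = 0.
Proof. by have /(congr1 (+%R^~ (- bracket 0 Y))) := bracketDl 0 0 Y; rewrite addr0 subrr addrK. Qed.

Lemma bracketZl c X Y : bracket (c *: X) Y = c *: bracket X Y.
Proof. by have := bracket_linear c X 0 Y; rewrite !addr0 bracket0l addr0. Qed.

Lemma bracketDr X Y Y' : bracket X (Y + Y') = bracket X Y + bracket X Y'.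
Proof. by rewrite !(bracket_skew X) bracketDl opprD. Qed.

Lemma bracketZr c X Y : bracket X (c *: Y) = c *: bracket X Y.
Proof. by rewrite !(bracket_skew X) bracketZl scalerN. Qed.

Lemma bracketxx X : bracket X X = 0.
Proof.
have := bracket_skew X X; move/(congr1 (+%R (bracket X X))); rewrite subrr => /eqP.
by rewrite -mulr2n -scaler_nat scaler_eq0 pnatr_eq0 => /eqP.
Qed.

Lemma bracket0r X : bracket X 0 = 0.
Proof. by rewrite bracket_skew bracket0l oppr0. Qed.

Definition bracket_mx X : 'M[R]_(p, q) := \matrix_(i < p) bracket X (delta_mx 0 i).

Lemma bracket_mxE X Y : Y *m bracket_mx X = bracket X Y.
Proof.
have br_sum (I : Type) (s : seq I) (F : I -> 'rV[R]_p) :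
    bracket X (\sum_(i <- s) F i) = \sum_(i <- s) bracket X (F i).
  by elim/big_rec2: _ => [|i y1 y2 _ <-]; [exact: bracket0r|rewrite bracketDr].
rewrite mulmx_sum_row {2}(row_sum_delta Y) br_sum; apply: eq_bigr => i _.
by rewrite bracketZr rowK.
Qed.

Lemma dot_Jmap Z X Y : dot (Jmap (@bracket _ n) Z X) Y = dot (bracket X Y) Z.
Proof.
rewrite -bracket_mxE dotE /dot -mulmxA mxE; apply: eq_bigr => i _.
rewrite mulrC; congr (_ * _); rewrite !mxE /dot !mxE.
by apply: eq_bigr => j _; rewrite !mxE.
Qed.

Lemma dot_Jmap_self Z X : dot X (Jmap (@bracket _ n) Z X) = 0.
Proof. by rewrite dotC dot_Jmap bracketxx dot0l. Qed.

Lemma dot_Jmap_norm Z X : dot (Jmap (@bracket _ n) Z X) (Jmap (@bracket _ n) Z X) =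
  dot Z Z * dot X X.
Proof.
set J := Jmap _ Z X.
have : dot (Jmap (@bracket _ n) Z J) X = - dot J J.
  by rewrite dot_Jmap bracket_skew dotNl -dot_Jmap.
by rewrite /J bracket_htype dotZl mulNr => /oppr_inj.
Qed.

Definition pack X Z (l : R) : DR n := row_mx (row_mx X Z) (l%:M).

Lemma vpart_pack X Z l : vpart (pack X Z l) = X.
Proof. by rewrite /vpart /pack !row_mxKl. Qed.

Lemma zpart_pack X Z l : zpart (pack X Z l) = Z.
Proof. by rewrite /zpart /pack row_mxKl row_mxKr. Qed.

Lemma apart_pack X Z l : apart (pack X Z l) = l.
Proof. by rewrite /apart /pack row_mxKr mxE eqxx mulr1n. Qed.

Lemma packK x : pack (vpart x) (zpart x) (apart x) = x.
Proof.
rewrite /pack /vpart /zpart hsubmxK -[RHS]hsubmxK; congr row_mx.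
by apply/rowP => i; rewrite ord1 mxE eqxx mulr1n.
Qed.

Definition Lmx x : 'M[R]_(dimS n) :=
  block_mx (block_mx (expR (apart x / 2))%:M
                     ((2^-1 * expR (apart x / 2)) *: bracket_mx (vpart x))
                     0 (expR (apart x))%:M) 0 0 1%:M.

Lemma mulmx_Lmx x X Z l : pack X Z l *m Lmx x =
  pack (expR (apart x / 2) *: X)
       (expR (apart x) *: Z + (2^-1 * expR (apart x / 2)) *: bracket (vpart x) X) l.
Proof.
rewrite /pack /Lmx mul_row_block !mulmx0 addr0 add0r mulmx1; congr row_mx.
rewrite mul_row_block mulmx0 addr0 !mul_mx_scalar -scalemxAr bracket_mxE.
by rewrite addrC.
Qed.

Lemma smulE x y : smul x y = x + y *m Lmx x.
Proof.
transitivity (pack (vpart x) (zpart x) (apart x) + y *m Lmx x); last by rewrite packK.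
rewrite -[in RHS](packK y) mulmx_Lmx /smul /pack !add_row_mx; congr row_mx.
  by rewrite bracketZr scalerA addrA.
by apply/rowP => i; rewrite !mxE ord1 eqxx !mulr1n.
Qed.

Lemma left_diffE x : left_diff x = Lmx x.
Proof.
have smE : (smul x : 'rV_(dimS n) -> 'rV_(dimS n)) = (fun y => x + y *m Lmx x).
  by apply/funext => y; rewrite smulE.
have dif : differentiable (smul x : 'rV[R]_(dimS n) -> 'rV[R]_(dimS n)) 0.
  rewrite smE (_ : (fun y => _) = cst x + \sum_(i < dimS n)
      (fun y : 'rV[R]_(dimS n) => y 0 i *: row i (Lmx x))); last first.
    by apply/funext => y; rewrite mulmx_sum_row /= fctE fct_sumE.
  apply: differentiableD => //; apply: differentiable_sum => i.
  by apply: differentiableZl; exact: differentiable_coord.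
rewrite /left_diff; apply/row_matrixP => i; rewrite !rowE -deriveEjacobian//.
rewrite /derive; apply: cvg_lim => //.
apply: cvg_near_cst; near=> h.
have h0 : h != 0 by near: h; exact: nbhs_dnbhs_neq.
rewrite smE /= mul0mx addr0 addr0 addrC addKr -scalemxAl scalerA mulVf// scale1r.
by [].
Unshelve. all: by end_near. Qed.

Definition detL x : R := expR (apart x / 2) ^+ p * expR (apart x) ^+ q.

Lemma det_Lmx x : \det (Lmx x) = detL x.
Proof. by rewrite /Lmx det_lblock det1 mulr1 det_ublock !det_scalar. Qed.

Lemma detL_gt0 x : 0 < detL x.
Proof. by rewrite mulr_gt0// exprn_gt0// expR_gt0. Qed.

Lemma Lmx_unit x : Lmx x \in unitmx.
Proof. by rewrite unitmxE det_Lmx unitfE gt_eqF// detL_gt0. Qed.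

Lemma sqrt_det_metric x : Num.sqrt (\det (metric x)) = (detL x)^-1.
Proof.
rewrite /metric left_diffE det_mulmx det_tr -expr2 sqrtr_sqr det_inv det_Lmx.
by rewrite ger0_norm// invr_ge0 ltW// detL_gt0.
Qed.

Lemma inv_metric x : invmx (metric x) = (Lmx x)^T *m Lmx x.
Proof.
have u := Lmx_unit x; rewrite /metric left_diffE.
have e : (invmx (Lmx x) *m (invmx (Lmx x))^T) *m ((Lmx x)^T *m Lmx x) = 1%:M.
  by rewrite mulmxA -(mulmxA (invmx _)) -trmx_mul mulmxV// trmx1 mulmx1 mulVmx.
by have /mulmx1_unit[mu _] := e; rewrite -[RHS](mulKmx mu) e mulmx1.
Qed.

(** The square of the length of a tangent vector, read in the left-invariant
    frame. *)
Definition speed2 x E : R :=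
  expR (- apart x) * dot (vpart E) (vpart E) +
  expR (- apart x) ^+ 2 *
    dot (zpart E - 2^-1 *: bracket (vpart x) (vpart E))
        (zpart E - 2^-1 *: bracket (vpart x) (vpart E)) +
  apart E ^+ 2.

Definition frame x E : DR n :=
  pack (expR (- (apart x / 2)) *: vpart E)
       (expR (- apart x) *: (zpart E - 2^-1 *: bracket (vpart x) (vpart E))) (apart E).

Lemma frame_Lmx x E : frame x E *m Lmx x = E.
Proof.
rewrite mulmx_Lmx -[RHS]packK; congr pack.
  by rewrite scalerA -expRD subrr expR0 scale1r.
rewrite scalerA -expRD subrr expR0 scale1r bracketZr scalerA.
by rewrite -mulrA -expRD subrr expR0 mulr1 subrK.
Qed.

Lemma dot_pack X Z l X' Z' l' : dot (pack X Z l) (pack X' Z' l') =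
  dot X X' + dot Z Z' + l * l'.
Proof. by rewrite /pack !dot_row dot_scalar. Qed.

Lemma metric_speed2 x E : (E *m metric x *m E^T) 0 0 = speed2 x E.
Proof.
transitivity (dot (frame x E) (frame x E)).
  have -> : frame x E = E *m invmx (Lmx x).
    by rewrite -{2}(frame_Lmx x E) mulmxK// Lmx_unit.
  by rewrite /metric left_diffE /dot trmx_mul !mulmxA.
rewrite dot_pack /speed2 !dotZl !dotZr.
have -> : expR (- apart x) = expR (- (apart x / 2)) * expR (- (apart x / 2)).
  by rewrite -expRD; congr expR; field.
by ring.
Qed.

End Metric.

(** * The distance to the identity *)

Section Continuity.
Context {R : realType}.
Implicit Types f g : R -> R.

Lemma ccst (c : R) : continuous (fun _ : R => c).
Proof. by move=> t; exact: cvg_cst. Qed.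

Lemma cD f g : continuous f -> continuous g -> continuous (fun t => f t + g t).
Proof. by move=> cf cg t; apply: cvgD; [exact: cf|exact: cg]. Qed.

Lemma cN f : continuous f -> continuous (fun t => - f t).
Proof. by move=> cf t; apply: cvgN; exact: cf. Qed.

Lemma cM f g : continuous f -> continuous g -> continuous (fun t => f t * g t).
Proof. by move=> cf cg t; apply: cvgM; [exact: cf|exact: cg]. Qed.

Lemma csum n (f : 'I_n -> R -> R) : (forall i, continuous (f i)) ->
  continuous (fun t => \sum_(i < n) f i t).
Proof.
elim: n f => [|n IH] f cf.
  under eq_fun do rewrite big_ord0; exact: ccst.
under eq_fun do rewrite big_ord_recr.
by apply: cD; [apply: IH => i; exact: cf|exact: cf].
Qed.

Lemma ccomp f g : continuous f -> continuous g -> continuous (fun t => f (g t)).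
Proof. by move=> cf cg t; apply: continuous_comp; [exact: cg|exact: cf]. Qed.

Lemma row_continuous d (M : R -> 'rV[R]_d) :
  (forall i, continuous (fun t => M t 0 i)) -> continuous M.
Proof.
move=> cM t; apply/cvgrPdist_le => e e0; near=> s.
rewrite /Num.Def.normr/= mx_normrE (bigmax_le _ (ltW e0))//= => -[i j] _.
rewrite !mxE/= ord1; move: j; near: s; apply: filter_forall => j.
exact: ((cvgrPdist_le _ _).1 (cM j t)).
Unshelve. all: by end_near. Qed.

Lemma continuous_coord d (f : R -> 'rV[R]_d) i : continuous f ->
  continuous (fun t => f t 0 i).
Proof.
move=> cf t.
apply: (@continuous_comp _ _ _ f (fun M : 'rV[R]_d => M 0 i) t (cf t)).
exact: coord_continuous.
Qed.

Lemma is_derive_row d (M : R -> 'rV[R]_d) (dM : 'rV[R]_d) (t : R) :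
  (forall i, is_derive t (1 : R) (fun t => M t 0 i) (dM 0 i)) <-> is_derive t 1 M dM.
Proof.
split=> [h|h].
  have dM' : derivable M t 1.
    by apply/derivable_mxP => i j; rewrite ord1; have [] := h j.
  split => //; rewrite derive_mx//; apply/rowP => j; rewrite mxE.
  by have [_ ->] := h j.
move=> i; split; first by move: h => [+ _] => /derivable_mxP; apply.
by move: h => [h <-]; rewrite derive_mx// mxE.
Qed.

Lemma ddot d (f g : R -> 'rV[R]_d) (df dg : 'rV[R]_d) (t : R) :
  is_derive t 1 f df -> is_derive t 1 g dg ->
  is_derive t (1 : R) (fun t => dot (f t) (g t)) (dot (f t) dg + dot (g t) df).
Proof.
move=> /is_derive_row hf /is_derive_row hg.
rewrite !dotE -big_split; under eq_fun do rewrite dotE.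
by notypeclasses refine (dsum _) => i; apply: dM.
Qed.

End Continuity.

Section Distance.
Context {R : realType} (n : htype R).
Local Notation p := (dim_v n).
Local Notation q := (dim_z n).
Implicit Types (X Y : 'rV[R]_p) (Z : 'rV[R]_q) (x y E : DR n).
Local Notation mu := (@lebesgue_measure R).

Definition Pfun x : R := 1 + expR (apart x) + dot (vpart x) (vpart x) / 4.

(** The square of the hyperbolic cosine of half the distance to the identity. *)
Definition wfun x : R := (Pfun x ^+ 2 + dot (zpart x) (zpart x)) / (4 * expR (apart x)).

Definition dwfun x E : R :=
  (2 * Pfun x * (expR (apart x) * apart E + dot (vpart x) (vpart E) / 2)
   + 2 * dot (zpart x) (zpart E)) / (4 * expR (apart x)) - wfun x * apart E.

Lemma expR_half (l : R) : expR l = expR (l / 2) ^+ 2.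
Proof. by rewrite expr2 -expRD; congr expR; field. Qed.

Lemma wfun_ge1 x : 1 <= wfun x.
Proof.
rewrite /wfun ler_pdivlMr ?mulr_gt0 ?expR_gt0// mul1r.
have := dot_ge0 (vpart x); have := dot_ge0 (zpart x); rewrite /Pfun.
set r := expR _; set X := dot _ _; set Z := dot _ _ => Z0 X0.
have r0 : 0 < r by exact: expR_gt0.
by have := sqr_ge0 (1 - r); nra.
Qed.

(** The eikonal inequality: [wfun = cosh (d / 2) ^ 2], and [d] is 1-Lipschitz exactly
    when the differential of [wfun] is bounded by [sqrt (wfun ^ 2 - wfun)].  The only
    cross term is [dot (Jmap Z X) V], which is handled by the H-type identity. *)
Lemma dwfun_le x E : dwfun x E ^+ 2 <= (wfun x ^+ 2 - wfun x) * speed2 x E.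
Proof.
pose J := Jmap (@bracket _ n) (zpart x) (vpart x).
pose e := expR (apart x / 2).
have e0 : 0 < e by exact: expR_gt0.
have eN : e != 0 by rewrite gt_eqF.
pose V := pack ((4 * e)^-1 *: (Pfun x *: vpart x + J)) (2^-1 *: zpart x)
  (Pfun x / 2 - wfun x).
have VV : dot V V = wfun x ^+ 2 - wfun x.
  rewrite dot_pack !(dotZl, dotZr, dotDl, dotDr) dot_Jmap_norm (dotC J) dot_Jmap_self.
  rewrite /wfun /Pfun (expR_half (apart x)) -/e; set X := dot _ _; set Z := dot _ _.
  by field.
have eNh : expR (- (apart x / 2)) = e^-1 by rewrite expRN.
have FF : dot (frame x E) (frame x E) = speed2 x E.
  rewrite dot_pack /speed2 !(dotZl, dotZr) eNh (expRN (apart x)).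
  by rewrite (expR_half (apart x)) -/e; field.
have VF : dot V (frame x E) = dwfun x E.
  rewrite dot_pack !(dotZl, dotZr, dotDl, dotDr, dotNr) dot_Jmap.
  rewrite (dotC (zpart x) (bracket _ _)) eNh (expRN (apart x)).
  rewrite /dwfun /wfun (expR_half (apart x)) -/e.
  by field.
by rewrite -VF -FF -VV; exact: dot_cauchy_schwarz.
Qed.

Section Curve.
Variable g : R -> 'rV[R]_(dimS n).
Hypothesis C1g : C1 g.
Local Notation D := (derive1 g).

Let dg (t : R) : is_derive t 1 g (D t).
Proof. by rewrite derive1E; apply: derivableP; exact: C1g.1. Qed.

Lemma is_derive_vpart (f : R -> 'rV[R]_(dimS n)) df (t : R) : is_derive t 1 f df ->
  is_derive t 1 (fun t => vpart (f t) : 'rV[R]_p) (vpart df).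
Proof.
move=> /is_derive_row h; apply/is_derive_row => i.
rewrite /vpart !mxE; under eq_fun do rewrite !mxE; exact: h.
Qed.

Lemma is_derive_zpart (f : R -> 'rV[R]_(dimS n)) df (t : R) : is_derive t 1 f df ->
  is_derive t 1 (fun t => zpart (f t) : 'rV[R]_q) (zpart df).
Proof.
move=> /is_derive_row h; apply/is_derive_row => i.
rewrite /zpart !mxE; under eq_fun do rewrite !mxE; exact: h.
Qed.

Lemma is_derive_apart (f : R -> 'rV[R]_(dimS n)) df (t : R) : is_derive t 1 f df ->
  is_derive t (1 : R) (fun t => apart (f t)) (apart df).
Proof.
move=> /is_derive_row h; rewrite /apart !mxE; under eq_fun do rewrite !mxE; exact: h.
Qed.

Lemma is_derive_wfun (t : R) : is_derive t (1 : R) (fun t => wfun (g t)) (dwfun (g t) (D t)).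
Proof.
have hv := ddot (is_derive_vpart (dg t)) (is_derive_vpart (dg t)).
have hz := ddot (is_derive_zpart (dg t)) (is_derive_zpart (dg t)).
have ha := is_derive_apart (dg t).
rewrite /wfun /Pfun; derive_with.
  by rewrite mulf_neq0// gt_eqF// expR_gt0.
rewrite /dwfun /wfun /Pfun; field.
by rewrite gt_eqF// expR_gt0.
Qed.

Lemma continuous_vpart (f : R -> 'rV[R]_(dimS n)) i : continuous f ->
  continuous (fun t => vpart (f t) 0 i).
Proof.
move=> cf; rewrite /vpart; under eq_fun do rewrite !mxE.
exact: continuous_coord.
Qed.

Lemma continuous_zpart (f : R -> 'rV[R]_(dimS n)) i : continuous f ->
  continuous (fun t => zpart (f t) 0 i).
Proof.
move=> cf; rewrite /zpart; under eq_fun do rewrite !mxE.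
exact: continuous_coord.
Qed.

Lemma continuous_apart (f : R -> 'rV[R]_(dimS n)) : continuous f ->
  continuous (fun t => apart (f t)).
Proof.
move=> cf; rewrite /apart; under eq_fun do rewrite !mxE.
exact: continuous_coord.
Qed.

Lemma bracket_coord X Y j : bracket X Y 0 j =
  \sum_(i < p) \sum_(k < p) Y 0 i * (X 0 k * bracket (delta_mx 0 k) (delta_mx 0 i) 0 j) :> R.
Proof.
rewrite -bracket_mxE mxE; apply: eq_bigr => i _.
rewrite -mulr_sumr mxE; congr (_ * _).
rewrite bracket_skew -bracket_mxE !mxE -sumrN.
apply: eq_bigr => k _; rewrite [bracket_mx _ _ _]mxE (bracket_skew (delta_mx 0 k)) [in RHS]mxE.
by rewrite mulrN.
Qed.

Lemma continuous_speed2 : continuous (fun t => speed2 (g t) (D t)).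
Proof.
have cg : continuous g.
  by move=> t; apply: differentiable_continuous; apply/derivable1_diffP; exact: C1g.1.
have cD' : continuous (D : R -> 'rV[R]_(dimS n)) := C1g.2.
have cv i : continuous (fun t => vpart (g t) 0 i) by apply: continuous_vpart.
have cv' i : continuous (fun t => vpart (D t) 0 i) by apply: continuous_vpart.
have cz' i : continuous (fun t => zpart (D t) 0 i) by apply: continuous_zpart.
have ca : continuous (fun t => apart (g t)) by apply: continuous_apart.
have ca' : continuous (fun t => apart (D t)) by apply: continuous_apart.
have cE : continuous (fun t => expR (- apart (g t))).
  by apply: ccomp; [exact: continuous_expR|apply: cN; exact: (continuous_apart cg)].
have cb j : continuous (fun t => bracket (vpart (g t)) (vpart (D t)) 0 j).
  under eq_fun do rewrite bracket_coord.
  do 2!apply: csum => ?; apply: cM; first exact: cv'.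
  by apply: cM; [exact: cv|exact: ccst].
have cz j : continuous (fun t =>
    (zpart (D t) - 2^-1 *: bracket (vpart (g t)) (vpart (D t))) 0 j).
  under eq_fun do rewrite mxE [X in _ + X]mxE [X in - X]mxE.
  by apply: cD; [exact: cz'|apply: cN; apply: cM; [exact: ccst|exact: cb]].
rewrite /speed2; apply: cD; last first.
  by under eq_fun do rewrite expr2; apply: cM; exact: ca'.
apply: cD; apply: cM => //.
- under eq_fun do rewrite dotE; apply: csum => i.
  by apply: cM; exact: cv'.
- by under eq_fun do rewrite expr2; apply: cM.
- under eq_fun do rewrite dotE; apply: csum => i.
  by apply: cM; exact: cz.
Qed.

Lemma curve_lengthE : curve_length g =
  \int[mu]_(t in `[0, 1]) Num.sqrt (speed2 (g t) (D t)).
Proof. by apply: eq_Rintegral => t _; rewrite metric_speed2. Qed.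

Lemma speed2_ge0 x E : 0 <= speed2 x E.
Proof.
by rewrite !addr_ge0 ?sqr_ge0// mulr_ge0 ?dot_ge0 ?expR_ge0// exprn_ge0// expR_ge0.
Qed.

(** The function [2 * arcosh (sqrt w)] is not differentiable at the identity, where
    [w = 1]; it is approximated by replacing [w] by [w + d ^ 2]. *)
Lemma curve_length_ge : g 0 = 0 ->
  2 * ln (Num.sqrt (wfun (g 1)) + Num.sqrt (wfun (g 1) - 1)) <= curve_length g.
Proof.
move=> g0; apply/ler_addgt0Pl => d' d'0.
pose d := Num.min 1 (d' / 3).
have d0 : 0 < d by rewrite lt_min ltr01 divr_gt0.
have dd : 2 * d + d ^+ 2 <= d'.
  have d1 : d <= 1 by rewrite ge_min lexx.
  have d3 : d <= d' / 3 by rewrite ge_min lexx orbT.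
  by nra.
pose F (w : R) := 2 * ln (Num.sqrt (w + d ^+ 2) + Num.sqrt (w + d ^+ 2 - 1)).
have d20 : 0 < d ^+ 2 by rewrite exprn_gt0.
have pos1 t : 0 < wfun (g t) + d ^+ 2 by have := wfun_ge1 (g t); lra.
have pos2 t : 0 < wfun (g t) + d ^+ 2 - 1 by have := wfun_ge1 (g t); lra.
have dF (t : R) : is_derive t (1 : R) (fun t => F (wfun (g t)))
    (dwfun (g t) (D t) / (Num.sqrt (wfun (g t) + d ^+ 2) * Num.sqrt (wfun (g t) + d ^+ 2 - 1))).
  have hw := is_derive_wfun t.
  have s1 : 0 < Num.sqrt (wfun (g t) + d ^+ 2) by rewrite sqrtr_gt0.
  have s2 : 0 < Num.sqrt (wfun (g t) + d ^+ 2 - 1) by rewrite sqrtr_gt0.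
  rewrite /F; derive_with => //; first exact: addr_gt0.
  move: s1 s2; set a := Num.sqrt _; set b := Num.sqrt _ => s1 s2.
  by field; rewrite !gt_eqF// addr_gt0.
have le t : dwfun (g t) (D t) / (Num.sqrt (wfun (g t) + d ^+ 2) * Num.sqrt (wfun (g t) + d ^+ 2 - 1))
    <= Num.sqrt (speed2 (g t) (D t)).
  rewrite -sqrtrM ?(ltW (pos1 t))//.
  have P0 : 0 < (wfun (g t) + d ^+ 2) * (wfun (g t) + d ^+ 2 - 1) by rewrite mulr_gt0.
  rewrite ler_pdivrMr ?sqrtr_gt0// -sqrtrM ?speed2_ge0//.
  apply: (le_trans (ler_norm _)); rewrite -sqrtr_sqr ler_sqrt; last first.
    by rewrite mulr_ge0 ?speed2_ge0// ltW.
  apply: (le_trans (dwfun_le _ _)); rewrite mulrC ler_wpM2l ?speed2_ge0//.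
  by have := wfun_ge1 (g t); nra.
have cs : continuous (fun t => Num.sqrt (speed2 (g t) (D t))).
  by apply: ccomp; [exact: sqrt_continuous|exact: continuous_speed2].
have := @Rintegral_ge_derive _ (fun t => Num.sqrt (speed2 (g t) (D t)))
  (fun t => F (wfun (g t))) _ 0 1 ler01 (fun t _ => cs t) (fun t _ => dF t) (fun t _ => le t).
rewrite -curve_lengthE g0.
have -> : wfun 0 = 1.
  have -> : 0 = pack 0 0 0 :> DR n by rewrite /pack row_mx0 raddf0 row_mx0.
  by rewrite /wfun /Pfun vpart_pack zpart_pack apart_pack !dot0l expR0; field.
have F1 : F 1 <= 2 * d + d ^+ 2.
  rewrite /F (_ : 1 + d ^+ 2 - 1 = d ^+ 2); last ring.
  rewrite sqrtr_sqr gtr0_norm//.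
  have s0 : Num.sqrt (1 + d ^+ 2) <= 1 + d ^+ 2 / 2.
    rewrite -[leRHS]gtr0_norm; last by rewrite addr_gt0// divr_gt0.
    by rewrite -sqrtr_sqr ler_sqrt ?sqr_ge0//; nra.
  have s1 : 1 <= Num.sqrt (1 + d ^+ 2).
    by rewrite -[leLHS]sqrtr1 ler_sqrt; lra.
  have := @le_ln1Dx _ (Num.sqrt (1 + d ^+ 2) + d - 1).
  by rewrite addrCA subrr addr0 => /(_ _); lra.
have : 2 * ln (Num.sqrt (wfun (g 1)) + Num.sqrt (wfun (g 1) - 1)) <= F (wfun (g 1)).
  have w1 := wfun_ge1 (g 1); rewrite /F ler_pM2l// ler_ln ?posrE.
  - by rewrite lerD// ler_sqrt; lra.
  - by rewrite ltr_pwDl ?sqrtr_gt0 ?sqrtr_ge0//; lra.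
  - by rewrite ltr_pwDl ?sqrtr_gt0 ?sqrtr_ge0//; lra.
by lra.
Qed.

End Curve.

End Distance.

Section Geodesic.
Context {R : realType} (n : htype R).
Local Notation p := (dim_v n).
Local Notation q := (dim_z n).
Local Notation mu := (@lebesgue_measure R).

Lemma pack_lin (a b c : R) (V : 'rV[R]_p) (Y : 'rV[R]_q) k :
  (pack (a *: V) (b *: Y) c : DR n) 0 k =
  a * (pack V 0 0 : DR n) 0 k + b * (pack 0 Y 0 : DR n) 0 k + c * (pack 0 0 1 : DR n) 0 k.
Proof.
rewrite /pack; case: (splitP k) => j kj.
  have -> : k = lshift 1 j by apply/val_inj.
  rewrite !row_mxEl; case: (splitP j) => i ji.
    have -> : j = lshift q i by apply/val_inj.
    by rewrite !row_mxEl !mxE !mulr0 !addr0.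
  have -> : j = rshift p i by apply/val_inj.
  by rewrite !row_mxEr !mxE !mulr0 add0r addr0.
have -> : k = rshift (p + q) j by apply/val_inj.
by rewrite !row_mxEr !mxE ord1 eqxx !mulr1n !mulr0 !add0r mulr1.
Qed.

Lemma is_derive_pack (a b c : R -> R) (da db dc : R) V Y (t : R) :
  is_derive t 1 a da -> is_derive t 1 b db -> is_derive t 1 c dc ->
  is_derive t 1 (fun t => pack (a t *: V) (b t *: Y) (c t) : 'rV[R]_(dimS n))
    (pack (da *: V) (db *: Y) dc).
Proof.
move=> ha hb hc; apply/is_derive_row => k; rewrite pack_lin.
under eq_fun do rewrite pack_lin.
by derive_with; ring.
Qed.

Section Curve.
Variables (V : 'rV[R]_p) (Y : 'rV[R]_q) (s tau : R).
Hypothesis unit : dot V V + dot Y Y + s ^+ 2 = 1.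
Hypothesis VY : dot V V = 0 \/ dot Y Y = 0.
Hypothesis tau0 : 0 <= tau.

Let y := dot Y Y.
Let chi (x : R) := (1 - s * x) ^+ 2 + y * x ^+ 2.
Let pt (u : R) := (expR (u * tau) - 1) / (expR (u * tau) + 1).
Let al (u : R) := 2 * pt u * (1 - s * pt u) / chi (pt u).
Let be (u : R) := 2 * pt u / chi (pt u).
Let la (u : R) := ln ((1 - pt u ^+ 2) / chi (pt u)).
Let dchi (x : R) := - 2 * s * (1 - s * x) + 2 * y * x.
Let dpt (u : R) := tau / 2 * (1 - pt u ^+ 2).
Let dal (u : R) := ((2 - 4 * s * pt u) / chi (pt u)
  - 2 * pt u * (1 - s * pt u) * dchi (pt u) / chi (pt u) ^+ 2) * dpt u.
Let dbe (u : R) := (2 / chi (pt u) - 2 * pt u * dchi (pt u) / chi (pt u) ^+ 2) * dpt u.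
Let dla (u : R) := (- 2 * pt u / (1 - pt u ^+ 2) - dchi (pt u) / chi (pt u)) * dpt u.

Definition geodesic (u : R) : 'rV[R]_(dimS n) := pack (al u *: V) (be u *: Y) (la u).

Let pt_lt1 u : -1 < pt u < 1.
Proof.
have e0 := expR_gt0 (u * tau); rewrite /pt.
have e1 : 0 < expR (u * tau) + 1 by rewrite addr_gt0.
by apply/andP; split; [rewrite ltr_pdivlMr//|rewrite ltr_pdivrMr//]; lra.
Qed.

Let onep u : 0 < 1 - pt u ^+ 2.
Proof. by have /andP[? ?] := pt_lt1 u; nra. Qed.

Let sp u : 0 < 1 - s * pt u.
Proof.
have /andP[? ?] := pt_lt1 u.
have s1 : -1 <= s <= 1.
  have := dot_ge0 V; have := dot_ge0 Y; move: unit => ? ? ?.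
  by apply/andP; split; nra.
move/andP: s1 => [s1 s2]; have [s0|s0] := leP 0 s.
  have : 0 < (1 + s) * (1 - pt u) by rewrite mulr_gt0//; lra.
  have : 0 <= (1 - s) * (1 + pt u) by rewrite mulr_ge0//; lra.
  by lra.
have : 0 < (1 - s) * (1 + pt u) by rewrite mulr_gt0//; lra.
have : 0 <= (1 + s) * (1 - pt u) by rewrite mulr_ge0//; lra.
by lra.
Qed.

Let chi_gt0 u : 0 < chi (pt u).
Proof. by rewrite ltr_pwDl ?exprn_gt0// mulr_ge0 ?sqr_ge0// dot_ge0. Qed.

Let hpt (u : R) : is_derive u 1 pt (dpt u).
Proof.
have e0 := expR_gt0 (u * tau).
have e1 : expR (u * tau) + 1 != 0 by rewrite gt_eqF// addr_gt0.
by rewrite /pt /dpt /pt; derive_with => //; field.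
Qed.

Let hchi (u : R) : is_derive u 1 (fun u => chi (pt u)) (dchi (pt u) * dpt u).
Proof. by have h := hpt u; rewrite /chi; derive_with; rewrite /dchi /=; ring. Qed.

Let hal (u : R) : is_derive u 1 al (dal u).
Proof.
have h := hpt u; have hc := hchi u; have c0 := chi_gt0 u; rewrite /al.
notypeclasses refine (is_derive_eq _ _).
  by notypeclasses refine (dM _ (dV hc _)); [der|rewrite gt_eqF].
by cbv beta; rewrite /dal; field; rewrite gt_eqF.
Qed.

Let hbe (u : R) : is_derive u 1 be (dbe u).
Proof.
have h := hpt u; have hc := hchi u; have c0 := chi_gt0 u; rewrite /be.
notypeclasses refine (is_derive_eq _ _).
  by notypeclasses refine (dM _ (dV hc _)); [der|rewrite gt_eqF].
by cbv beta; rewrite /dbe; field; rewrite gt_eqF.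
Qed.

Let hla (u : R) : is_derive u 1 la (dla u).
Proof.
have h := hpt u; have hc := hchi u; have c0 := chi_gt0 u; have o0 := onep u.
rewrite /la; notypeclasses refine (is_derive_eq _ _).
  notypeclasses refine (dln (dM _ (dV hc _)) _); [der|by rewrite gt_eqF|exact: divr_gt0].
by cbv beta; rewrite /dla /=; field; rewrite !gt_eqF.
Qed.

Let hg (u : R) : is_derive u 1 geodesic (pack (dal u *: V) (dbe u *: Y) (dla u)).
Proof. exact: is_derive_pack. Qed.

Lemma geodesic_speed u :
  speed2 (geodesic u : DR n) (pack (dal u *: V) (dbe u *: Y) (dla u)) = tau ^+ 2.
Proof.
have c0 := chi_gt0 u; have o0 := onep u; have sp0 := sp u.
rewrite /speed2 /geodesic !(vpart_pack, zpart_pack, apart_pack).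
rewrite bracketZl bracketZr bracketxx !scaler0 subr0 !(dotZl, dotZr) -/y.
rewrite expRN lnK ?posrE ?divr_gt0//.
move: c0 o0 sp0; rewrite /dla /dal /dbe /dpt /dchi /chi; set x := pt u.
have [v0|y0] := VY.
  have -> : y = 1 - s ^+ 2 by rewrite /y -unit v0; ring.
  by rewrite v0 => c0 o0 sp0; field; rewrite !gt_eqF.
rewrite /y y0 (_ : dot V V = 1 - s ^+ 2); last by rewrite -unit y0; ring.
by rewrite mul0r addr0 => c0 o0 sp0; field; rewrite !gt_eqF.
Qed.

Lemma geodesic_C1 : C1 geodesic.
Proof.
split; first by move=> t; have [] := hg t.
have -> : derive1 geodesic = fun u => pack (dal u *: V) (dbe u *: Y) (dla u).
  by apply/funext => u; rewrite derive1E; have [] := hg u.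
have cont (f : R -> R) : (forall u : R, exists d, is_derive u 1 f d) -> continuous f.
  by move=> h u; have [d hd] := h u; exact: is_derive_continuous hd.
have [ca [cb cl]] : continuous dal /\ continuous dbe /\ continuous dla.
  split; [|split]; apply: cont => u; have h := hpt u; have hc := hchi u;
    have c0 : chi (pt u) != 0 by rewrite gt_eqF.
  - eexists; rewrite /dal /dpt /dchi; der; by rewrite ?expf_neq0.
  - eexists; rewrite /dbe /dpt /dchi; der; by rewrite ?expf_neq0.
  - eexists; rewrite /dla /dpt /dchi; der; by rewrite ?gt_eqF.
apply: row_continuous => k; under eq_fun do rewrite pack_lin.
exact: (cD (cD (cM ca (@ccst _ _)) (cM cb (@ccst _ _))) (cM cl (@ccst _ _))).
Qed.

Lemma geodesic0 : geodesic 0 = 0.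
Proof.
rewrite /geodesic /al /be /la /chi /pt mul0r expR0 subrr !mul0r !mulr0 !mul0r.
rewrite expr0n /= mulr0 subr0 addr0 expr1n divr1 ln1 !scale0r.
by rewrite /pack row_mx0 raddf0 row_mx0.
Qed.

Lemma geodesic_length : curve_length geodesic = tau.
Proof.
rewrite curve_lengthE; transitivity (\int[mu]_(t in `[0, 1]) tau).
  apply: eq_Rintegral => u _; rewrite derive1E; have [_ ->] := hg u.
  by rewrite geodesic_speed sqrtr_sqr ger0_norm.
have m01 : mu `[0 : R, 1] = 1%:E.
  by rewrite lebesgue_measure_itv/= lte_fin ltr01 -EFinD subr0.
by rewrite Rintegral_cst//; have /(congr1 fine) /= -> := m01; rewrite mulr1.
Qed.

Lemma geodesic1 : let x := (expR tau - 1) / (expR tau + 1) in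
  geodesic 1 = pack ((2 * x * (1 - s * x) / ((1 - s * x) ^+ 2 + dot Y Y * x ^+ 2)) *: V)
    ((2 * x / ((1 - s * x) ^+ 2 + dot Y Y * x ^+ 2)) *: Y)
    (ln ((1 - x ^+ 2) / ((1 - s * x) ^+ 2 + dot Y Y * x ^+ 2))).
Proof. by rewrite /geodesic /al /be /la /chi /pt mul1r. Qed.

End Curve.

Definition rho (w : R) : R := 2 * ln (Num.sqrt w + Num.sqrt (w - 1)).

Lemma rho_ge0 w : 1 <= w -> 0 <= rho w.
Proof.
move=> w1; rewrite mulr_ge0// ln_ge0//.
have : 1 <= Num.sqrt w by rewrite -[leLHS]sqrtr1 ler_sqrt; lra.
by have := sqrtr_ge0 (w - 1); lra.
Qed.

(** The geodesics issued from the identity that stay in the totally geodesic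
    hyperbolic planes exp(R X + a) and exp(R Z + a) are explicit; they reach all
    points for which one of the two components vanishes. *)
Lemma exists_geodesic (X : 'rV[R]_p) (Z : 'rV[R]_q) (l : R) :
  X = 0 \/ Z = 0 -> exists g, [/\ C1 g, g 0 = 0, g 1 = pack X Z l &
    curve_length g = rho (wfun (pack X Z l : DR n))].
Proof.
move=> XZ; set w := wfun _.
have w1 : 1 <= w by exact: wfun_ge1.
pose P := 1 + expR l + dot X X / 4.
pose x := dot X X; pose z := dot Z Z; pose a := expR l.
have a0 : 0 < a by exact: expR_gt0.
have x0 : 0 <= x by exact: dot_ge0.
have z0 : 0 <= z by exact: dot_ge0.
have P1 : 1 < P by rewrite /P -/a -/x; lra.
have D0 : 0 < P ^+ 2 + z by nra.
have wE : w = (P ^+ 2 + z) / (4 * a).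
  by rewrite /w /wfun /Pfun !(vpart_pack, zpart_pack, apart_pack).
have xz : x = 0 \/ z = 0.
  by case: XZ => XZ0; [left|right]; rewrite /x /z XZ0 dot0l.
move: w1; rewrite le_eqVlt => /predU1P[w1|w1].
  (* the endpoint is the identity *)
  have aN : a != 0 by rewrite gt_eqF.
  have E : 4 * a = P ^+ 2 + z.
    have : w * (4 * a) = P ^+ 2 + z by rewrite wE divfK// mulf_neq0.
    by rewrite -w1 mul1r.
  have hh : (1 - a) ^+ 2 + (1 + a) * x / 2 + x ^+ 2 / 16 + z = 0.
    by move: E; rewrite /P -/a -/x; lra.
  have ax0 : 0 <= a * x by rewrite mulr_ge0// ltW.
  have s1 := sqr_ge0 (1 - a); have s2 := sqr_ge0 x.
  have x00 : x = 0 by apply/eqP; rewrite eq_le x0 andbT; lra.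
  have z00 : z = 0 by apply/eqP; rewrite eq_le z0 andbT; lra.
  have l0 : l = 0.
    have a1 : a = 1.
      apply/eqP; rewrite -subr_eq0 -opprB oppr_eq0 -sqrf_eq0 eq_le sqr_ge0 andbT.
      by move: hh; rewrite x00 z00; lra.
    by rewrite -(expRK l) -/a a1 ln1.
  have X0 : X = 0.
    apply: eq_dot => u; rewrite dot0l; apply/eqP; rewrite -sqrf_eq0 eq_le sqr_ge0 andbT.
    by apply: (le_trans (dot_cauchy_schwarz _ _)); rewrite -/x x00 mul0r.
  have Z0 : Z = 0.
    apply: eq_dot => u; rewrite dot0l; apply/eqP; rewrite -sqrf_eq0 eq_le sqr_ge0 andbT.
    by apply: (le_trans (dot_cauchy_schwarz _ _)); rewrite -/z z00 mul0r.
  have u1 : dot (0 : 'rV[R]_p) 0 + dot (0 : 'rV[R]_q) 0 + 1 ^+ 2 = 1 :> R.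
    by rewrite !dot0l !add0r expr1n.
  have VY : dot (0 : 'rV[R]_p) 0 = 0 :> R \/ dot (0 : 'rV[R]_q) 0 = 0 :> R.
    by left; rewrite dot0l.
  exists (geodesic 0 0 1 0); split.
  - by apply: geodesic_C1.
  - exact: geodesic0.
  - rewrite geodesic1 expR0 subrr mul0r !scaler0 X0 Z0 l0 mulr0 subr0 expr0n/= mulr0.
    by rewrite expr1n subr0 addr0 divr1 ln1.
  - rewrite geodesic_length// -w1 /rho subrr sqrtr1 sqrtr0 addr0 ln1 mulr0//.
pose A := Num.sqrt w; pose B := Num.sqrt (w - 1).
have A0 : 0 < A by rewrite sqrtr_gt0; lra.
have B0 : 0 < B by rewrite sqrtr_gt0; lra.
have A2 : A ^+ 2 = w by rewrite sqr_sqrtr; lra.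
have B2 : B ^+ 2 = w - 1 by rewrite sqr_sqrtr; lra.
pose th := B / A.
have th0 : 0 < th by rewrite divr_gt0.
have thN : th != 0 by rewrite gt_eqF.
pose tau := rho w.
have tau0 : 0 <= tau by apply: rho_ge0; lra.
have eth : (expR tau - 1) / (expR tau + 1) = th.
  have -> : expR tau = (A + B) ^+ 2.
    rewrite /tau /rho mulr_natl mulr2n expRD -expr2 lnK// posrE.
    exact: addr_gt0.
  have -> : (A + B) ^+ 2 - 1 = 2 * B * (A + B).
    by transitivity (2 * B * (A + B) + (A ^+ 2 - B ^+ 2 - 1)); [ring|rewrite A2 B2; ring].
  have -> : (A + B) ^+ 2 + 1 = 2 * A * (A + B).
    by transitivity (2 * A * (A + B) + (B ^+ 2 - A ^+ 2 + 1)); [ring|rewrite A2 B2; ring].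
  by rewrite /th; field; rewrite !gt_eqF// addr_gt0.
pose c1 := 4 / (P ^+ 2 + z).
pose c := 2 * P / (P ^+ 2 + z).
have DN : P ^+ 2 + z != 0 by rewrite gt_eqF.
have th2 : th ^+ 2 = 1 - c1 * a.
  rewrite /th expr_div_n A2 B2 wE /c1; field; rewrite DN; rewrite gt_eqF//.
pose s := (1 - c) / th.
pose V := (c / (2 * th)) *: X.
pose Y := (c1 / (2 * th)) *: Z.
have VV : dot V V = c ^+ 2 * x / (4 * th ^+ 2) by rewrite /V dotZl dotZr -/x; field.
have YY : dot Y Y = c1 ^+ 2 * z / (4 * th ^+ 2) by rewrite /Y dotZl dotZr -/z; field.
have unit : dot V V + dot Y Y + s ^+ 2 = 1.
  rewrite VV YY /s.
  apply: (mulfI (expf_neq0 2 thN)); rewrite mulr1 [RHS]th2.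
  rewrite (_ : th ^+ 2 * _ = c ^+ 2 * x / 4 + c1 ^+ 2 * z / 4 + (1 - c) ^+ 2); last by field.
  case: xz => [xz|xz]; rewrite /c /c1 /P -/a -/x xz; field; rewrite gt_eqF//.
    by rewrite ltr_pwDl ?exprn_gt0 ?mulr_ge0// mulr_gt0// addr_gt0.
  by rewrite ltr_pwDl// mulr_gt0// addr_gt0.
have VY : dot V V = 0 \/ dot Y Y = 0.
  by case: xz => xz; [left; rewrite VV xz mulr0 mul0r|right; rewrite YY xz mulr0 mul0r].
exists (geodesic V Y s tau); split.
- by apply: geodesic_C1.
- exact: geodesic0.
- rewrite geodesic1 eth.
  have s1 : 1 - s * th = c by rewrite /s; field.
  have chi1 : (1 - s * th) ^+ 2 + dot Y Y * th ^+ 2 = c1.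
    by rewrite s1 YY /c /c1; field; rewrite DN.
  rewrite chi1 s1; congr pack.
  + rewrite /V scalerA; case: XZ => [X0|Z0]; first by rewrite X0 scaler0.
    have z00 : z = 0 by rewrite /z Z0 dot0l.
    rewrite (_ : _ * _ = 1) ?scale1r// /c /c1 z00 addr0.
    by field; rewrite thN gt_eqF//; lra.
  + rewrite /Y scalerA (_ : _ * _ = 1) ?scale1r// /c1.
    by field; rewrite thN DN.
  + have -> : (1 - th ^+ 2) / c1 = a by rewrite th2 /c1; field.
    by rewrite /a expRK.
- by rewrite geodesic_length.
Qed.

(** The lower bound of [curve_length_ge] is attained by [exists_geodesic]. *)
Lemma distE (X : 'rV[R]_p) (Z : 'rV[R]_q) (l : R) : X = 0 \/ Z = 0 ->
  dist 0 (pack X Z l : DR n) = rho (wfun (pack X Z l : DR n)).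
Proof.
move=> XZ; have [g [C1g g0 g1 lg]] := exists_geodesic l XZ.
rewrite /dist; set E := (X in inf X).
have lb : lbound E (rho (wfun (pack X Z l : DR n))).
  move=> L [g' [C1g' g0' g1' <-]].
  by have := curve_length_ge C1g' g0'; rewrite g1'.
have Eg : E (rho (wfun (pack X Z l : DR n))) by exists g.
apply/eqP; rewrite eq_le; apply/andP; split.
  by apply: ge_inf => //; exists (rho (wfun (pack X Z l : DR n))).
by apply: lb_le_inf => //; exists (rho (wfun (pack X Z l : DR n))).
Qed.

End Geodesic.

(** * The radial Laplacian *)

Section DirectionalDerivative.
Context {R : realType} {V : normedModType R}.

Lemma derive_eq_on_line (F G : V -> R) (x v : V) :
  (forall t : R, F (t *: v + x) = G (t *: v + x)) -> 'D_v F x = 'D_v G x.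
Proof.
move=> FG; have FGx : F x = G x by have := FG 0; rewrite scale0r add0r.
have E : (fun h : R => h^-1 *: ((F \o shift x) (h *: v) - F x)) =
         (fun h : R => h^-1 *: ((G \o shift x) (h *: v) - G x)).
  by apply/funext => h; rewrite /= /shift /= FG FGx.
by rewrite /derive E.
Qed.

Lemma is_derive_line (F : V -> R) (x v : V) (t : R) :
  differentiable F (t *: v + x) ->
  is_derive t 1 (fun t => F (t *: v + x)) ('D_v F (t *: v + x)).
Proof.
move=> dF; have E : (fun h : R => h^-1 *: (((fun t => F (t *: v + x)) \o shift t) (h *: 1) -
    F (t *: v + x))) =
  (fun h : R => h^-1 *: ((F \o shift (t *: v + x)) (h *: v) - F (t *: v + x))).
  apply/funext => h; rewrite /= /shift /=; congr (_ *: (F _ - _)).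
  by rewrite scalerDl addrA; congr (_ *: _ + _ + _); exact: mulr1.
split; first by rewrite /derivable E; exact: diff_derivable.
by rewrite /derive E.
Qed.

Lemma derive_line0 (F : V -> R) (x v : V) (d : R) :
  is_derive (0 : R) (1 : R) (fun t => F (t *: v + x)) d -> 'D_v F x = d.
Proof.
move=> [_ <-].
have E : (fun h : R => h^-1 *: ((F \o shift x) (h *: v) - F x)) =
  (fun h : R => h^-1 *: (((fun t => F (t *: v + x)) \o shift 0) (h *: 1) - F (0 *: v + x))).
  apply/funext => h; rewrite /= /shift /= scale0r add0r addr0.
  by congr (_ *: (F (_ *: _ + _) - _)); exact/esym/mulr1.
by rewrite /derive E.
Qed.

End DirectionalDerivative.

Section Ordinals.
Context {R : realType} (n : htype R).
Local Notation p := (dim_v n).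
Local Notation q := (dim_z n).

Definition iX (i : 'I_p) : 'I_(dimS n) := lshift 1 (lshift q i).
Definition iZ (i : 'I_q) : 'I_(dimS n) := lshift 1 (rshift p i).
Definition iA : 'I_(dimS n) := rshift (p + q) (ord0 : 'I_1).

Lemma sum_dimS (F : 'I_(dimS n) -> R) : \sum_(i < dimS n) F i =
  \sum_(i < p) F (iX i) + \sum_(i < q) F (iZ i) + F iA.
Proof. by rewrite /dimS big_split_ord big_split_ord big_ord1. Qed.

Lemma delta_X i : delta_mx 0 (iX i) = pack (delta_mx 0 i) 0 0 :> DR n.
Proof.
apply/rowP => k; rewrite -(scale1r (delta_mx 0 i)) -(scaler0 _ (1 : R)) pack_lin !mul1r mul0r addr0.
rewrite /pack mxE /iX; case: (splitP k) => j kj.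
  have -> : k = lshift 1 j by apply/val_inj.
  rewrite !row_mxEl (inj_eq (@lshift_inj _ _)); case: (splitP j) => u ju.
    have -> : j = lshift q u by apply/val_inj.
    by rewrite !row_mxEl !mxE (inj_eq (@lshift_inj _ _)) addr0.
  have -> : j = rshift p u by apply/val_inj.
  by rewrite !row_mxEr !mxE eq_rlshift addr0.
have -> : k = rshift (p + q) j by apply/val_inj.
by rewrite !row_mxEr !mxE eq_rlshift mul0rn addr0.
Qed.

Lemma delta_Z i : delta_mx 0 (iZ i) = pack 0 (delta_mx 0 i) 0 :> DR n.
Proof.
apply/rowP => k; rewrite /pack mxE /iZ; case: (splitP k) => j kj.
  have -> : k = lshift 1 j by apply/val_inj.
  rewrite !row_mxEl (inj_eq (@lshift_inj _ _)); case: (splitP j) => u ju.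
    have -> : j = lshift q u by apply/val_inj.
    by rewrite !row_mxEl !mxE eq_lrshift.
  have -> : j = rshift p u by apply/val_inj.
  by rewrite !row_mxEr !mxE (inj_eq (@rshift_inj _ _)).
have -> : k = rshift (p + q) j by apply/val_inj.
by rewrite !row_mxEr !mxE eq_rlshift mul0rn.
Qed.

Lemma delta_A : delta_mx 0 iA = pack 0 0 1 :> DR n.
Proof.
apply/rowP => k; rewrite /pack mxE /iA; case: (splitP k) => j kj.
  have -> : k = lshift 1 j by apply/val_inj.
  by rewrite !row_mxEl row_mx0 !mxE eq_lrshift.
have -> : k = rshift (p + q) j by apply/val_inj.
by rewrite !row_mxEr !mxE ord1 !eqxx mulr1n.
Qed.

Lemma scale_pack (t : R) X Z l : t *: (pack X Z l : DR n) = pack (t *: X) (t *: Z) (t * l).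
Proof. by rewrite /pack !scale_row_mx scale_scalar_mx. Qed.

Lemma add_pack (X X' : 'rV[R]_p) (Z Z' : 'rV[R]_q) (l l' : R) :
  (pack X Z l : DR n) + pack X' Z' l' = pack (X + X') (Z + Z') (l + l').
Proof. by rewrite /pack !add_row_mx raddfD. Qed.

Definition axis (s : R) : DR n := pack 0 0 s.

Lemma line_X i t s : t *: (delta_mx 0 (iX i) : DR n) + axis s = pack (t *: delta_mx 0 i) 0 s.
Proof. by rewrite delta_X scale_pack add_pack !scaler0 mulr0 addr0 !add0r. Qed.

Lemma line_Z i t s : t *: (delta_mx 0 (iZ i) : DR n) + axis s = pack 0 (t *: delta_mx 0 i) s.
Proof. by rewrite delta_Z scale_pack add_pack !scaler0 mulr0 !addr0 add0r. Qed.

Lemma line_A t s : t *: (delta_mx 0 iA : DR n) + axis s = axis (t + s).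
Proof. by rewrite delta_A scale_pack add_pack !scaler0 mulr1 !addr0. Qed.

Lemma inv_metricE (x : DR n) : let c := 2^-1 * expR (apart x / 2) in
  invmx (metric x) = block_mx
   (block_mx (expR (apart x))%:M ((expR (apart x / 2) * c) *: bracket_mx (vpart x))
             ((expR (apart x / 2) * c) *: (bracket_mx (vpart x))^T)
             (c ^+ 2 *: ((bracket_mx (vpart x))^T *m bracket_mx (vpart x)) +
              (expR (apart x) ^+ 2)%:M)) 0 0 1%:M.
Proof.
move=> c; rewrite inv_metric /Lmx -/c tr_block_mx mulmx_block tr_block_mx.
rewrite !trmx0 !mul0mx !mulmx0 !addr0 !add0r tr_scalar_mx mulmx1; congr block_mx.
rewrite mulmx_block !tr_scalar_mx !mul0mx !mulmx0 !addr0; congr block_mx.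
- by rewrite mul_scalar_mx scale_scalar_mx -expr2 -expR_half.
- by rewrite mul_scalar_mx scalerA.
- by rewrite linearZ/= mul_mx_scalar scalerA.
- rewrite -scalemxAr (linearZ _ (bracket_mx _))/= -scalemxAl scalerA mul_scalar_mx.
  by rewrite scale_scalar_mx -!expr2.
- by rewrite tr_scalar_mx.
Qed.

End Ordinals.

Section RadialLaplacian.
Context {R : realType} (n : htype R).
Local Notation p := (dim_v n).
Local Notation q := (dim_z n).
Variable h : DR n -> R.

Definition flux (i : 'I_(dimS n)) (y : DR n) : R := \sum_(j < dimS n)
  Num.sqrt (\det (metric y)) * invmx (metric y) i j * 'D_(delta_mx 0 j : 'rV_(dimS n)) h y.

Lemma flux_X (i : 'I_p) (t s : R) (y := t *: (delta_mx 0 (iX i) : DR n) + axis n s) :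
  flux (iX i) y = (detL y)^-1 * expR s * 'D_(delta_mx 0 (iX i) : 'rV_(dimS n)) h y.
Proof.
rewrite /flux sqrt_det_metric inv_metricE sum_dimS.
have ya : apart y = s by rewrite /y line_X apart_pack.
have yv : vpart y = t *: delta_mx 0 i by rewrite /y line_X vpart_pack.
have b0 k : bracket_mx (vpart y) i k = 0.
  by rewrite yv !mxE bracketZl bracketxx scaler0 mxE.
rewrite (bigD1 i)//= big1 ?addr0; last first.
  move=> j ji; rewrite block_mxEul block_mxEul mxE eq_sym (negbTE ji).
  by rewrite mulr0n mulr0 mul0r.
rewrite block_mxEul block_mxEul mxE eqxx mulr1n ya big1 ?addr0; last first.
  by move=> k _; rewrite block_mxEul block_mxEur mxE b0 mulr0 mulr0 mul0r.
by rewrite block_mxEur mxE mulr0 mul0r addr0.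
Qed.

Lemma flux_Z (i : 'I_q) (t s : R) (y := t *: (delta_mx 0 (iZ i) : DR n) + axis n s) :
  flux (iZ i) y = (detL y)^-1 * expR s ^+ 2 * 'D_(delta_mx 0 (iZ i) : 'rV_(dimS n)) h y.
Proof.
rewrite /flux sqrt_det_metric inv_metricE sum_dimS.
have ya : apart y = s by rewrite /y line_Z apart_pack.
have yv : vpart y = 0 by rewrite /y line_Z vpart_pack.
have b0 : bracket_mx (vpart y) = 0.
  by apply/matrixP => u v; rewrite yv !mxE bracket0l mxE.
rewrite b0 trmx0 mulmx0 !scaler0 add0r big1 ?add0r; last first.
  by move=> j _; rewrite block_mxEul block_mxEdl mxE mulr0 mul0r.
rewrite (bigD1 i)//= big1 ?addr0; last first.
  move=> j ji; rewrite block_mxEul block_mxEdr mxE eq_sym (negbTE ji).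
  by rewrite mulr0n mulr0 mul0r.
rewrite block_mxEul block_mxEdr mxE eqxx mulr1n ya.
by rewrite block_mxEur mxE mulr0 mul0r addr0.
Qed.

Lemma flux_A (y : DR n) :
  flux (iA n) y = (detL y)^-1 * 'D_(delta_mx 0 (iA n) : 'rV_(dimS n)) h y.
Proof.
rewrite /flux sqrt_det_metric inv_metricE sum_dimS.
rewrite big1 ?add0r; last by move=> j _; rewrite block_mxEdl mxE mulr0 mul0r.
rewrite big1 ?add0r; last by move=> j _; rewrite block_mxEdl mxE mulr0 mul0r.
by rewrite block_mxEdr mxE eqxx mulr1n mulr1.
Qed.

Lemma detL_axis s : detL (axis n s) = expR (Qdim n * s).
Proof.
rewrite /detL /axis apart_pack -!expRM_natl -expRD; congr expR.
by rewrite /Qdim; field.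
Qed.

(** On the axis the coefficients of the inverse metric are diagonal, and their
    derivatives in the orthogonal directions vanish; the first order term comes
    from the volume density [exp (- Q s)]. *)
Lemma laplacian_axis (s : R) (d1 : R -> R) (d2 : R) :
  (forall t, 'D_(delta_mx 0 (iA n) : 'rV_(dimS n)) h (axis n t) = d1 t) ->
  is_derive s 1 d1 d2 ->
  (forall i, differentiable (fun y : 'rV_(dimS n) => 'D_(delta_mx 0 i : 'rV_(dimS n)) h y)
     (axis n s)) ->
  laplacian h (axis n s) =
    expR s * \sum_(i < p) 'D_(delta_mx 0 (iX i) : 'rV_(dimS n))
      (fun y => 'D_(delta_mx 0 (iX i) : 'rV_(dimS n)) h y) (axis n s)
    + expR s ^+ 2 * \sum_(i < q) 'D_(delta_mx 0 (iZ i) : 'rV_(dimS n))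
      (fun y => 'D_(delta_mx 0 (iZ i) : 'rV_(dimS n)) h y) (axis n s)
    + d2 - Qdim n * d1 s.
Proof.
move=> hd1 hd2 dif.
have detX i t : detL (t *: (delta_mx 0 (iX i) : DR n) + axis n s) = expR (Qdim n * s).
  by rewrite -detL_axis /detL line_X /axis !apart_pack.
have detZ i t : detL (t *: (delta_mx 0 (iZ i) : DR n) + axis n s) = expR (Qdim n * s).
  by rewrite -detL_axis /detL line_Z /axis !apart_pack.
have scal (v : 'rV_(dimS n)) c (f : 'rV_(dimS n) -> R) : differentiable f (axis n s) ->
    'D_v (fun y => c * f y) (axis n s) = c * 'D_v f (axis n s).
  by move=> df; apply: deriveZ; exact: diff_derivable.
have -> : laplacian h (axis n s) = detL (axis n s) *
    \sum_(i < dimS n) 'D_(delta_mx 0 i : 'rV_(dimS n)) (flux i) (axis n s).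
  by rewrite -[detL _]invrK -sqrt_det_metric.
rewrite detL_axis sum_dimS.
have -> : \sum_(i < p) 'D_(delta_mx 0 (iX i) : 'rV_(dimS n)) (flux (iX i)) (axis n s) =
  (expR (Qdim n * s))^-1 * expR s * \sum_(i < p) 'D_(delta_mx 0 (iX i) : 'rV_(dimS n))
      (fun y => 'D_(delta_mx 0 (iX i) : 'rV_(dimS n)) h y) (axis n s).
  rewrite mulr_sumr; apply: eq_bigr => i _; rewrite -scal//.
  by apply: derive_eq_on_line => t; rewrite flux_X detX.
have -> : \sum_(i < q) 'D_(delta_mx 0 (iZ i) : 'rV_(dimS n)) (flux (iZ i)) (axis n s) =
  (expR (Qdim n * s))^-1 * expR s ^+ 2 * \sum_(i < q) 'D_(delta_mx 0 (iZ i) : 'rV_(dimS n))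
      (fun y => 'D_(delta_mx 0 (iZ i) : 'rV_(dimS n)) h y) (axis n s).
  rewrite mulr_sumr; apply: eq_bigr => i _; rewrite -scal//.
  by apply: derive_eq_on_line => t; rewrite flux_Z detZ.
have e0 : expR (Qdim n * s) != 0 by rewrite gt_eqF// expR_gt0.
have -> : 'D_(delta_mx 0 (iA n) : 'rV_(dimS n)) (flux (iA n)) (axis n s) =
    (expR (Qdim n * s))^-1 * (d2 - Qdim n * d1 s).
  apply: derive_line0; under eq_fun do rewrite flux_A line_A detL_axis hd1.
  have hd : is_derive (0 + s) 1 d1 d2 by rewrite add0r.
  have hd' : is_derive (0 : R) (1 : R) (fun t => d1 (t + s)) (d2 * (1 + 0)).
    exact: (@dcomp _ d1 (fun t => t + s) 0 _ _ hd (dD (did _) (dcst _ _))).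
  derive_with; first by rewrite gt_eqF// expR_gt0.
  by rewrite !add0r; field.
by field.
Qed.

End RadialLaplacian.

Section SphericalODE.
Context {R : realType} (n : htype R).
Local Notation p := (dim_v n).
Local Notation q := (dim_z n).

(** The mean curvature of the geodesic sphere of radius [s], that is, the
    logarithmic derivative of the density [Adens]. *)
Definition kappa (s : R) : R := p%:R / 2 * ((expR s + 1) / (expR s - 1)) +
  q%:R * ((expR s ^+ 2 + 1) / (expR s ^+ 2 - 1)).

Lemma wfun_X (i : 'I_p) (t s : R) : wfun (pack (t *: delta_mx 0 i) 0 s : DR n) =
  (1 + expR s + t ^+ 2 / 4) ^+ 2 / (4 * expR s).
Proof.
rewrite /wfun /Pfun vpart_pack zpart_pack apart_pack dotZl dotZr dot_delta dot0l addr0.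
by rewrite mxE !eqxx mulr1 -expr2.
Qed.

Lemma wfun_Z (i : 'I_q) (t s : R) : wfun (pack 0 (t *: delta_mx 0 i) s : DR n) =
  ((1 + expR s) ^+ 2 + t ^+ 2) / (4 * expR s).
Proof.
rewrite /wfun /Pfun vpart_pack zpart_pack apart_pack dotZl dotZr dot_delta dot0l mul0r addr0.
by rewrite mxE !eqxx mulr1 -expr2.
Qed.

Lemma wfun_axis (s : R) : wfun (axis n s) = (1 + expR s) ^+ 2 / (4 * expR s).
Proof. by rewrite /wfun /Pfun /axis vpart_pack zpart_pack apart_pack !dot0l mul0r !addr0. Qed.

Lemma sqrt_wfun_axis (s : R) : Num.sqrt (wfun (axis n s)) = (1 + expR s) / (2 * expR (s / 2)).
Proof.
have e0 := expR_gt0 (s / 2); have r0 := expR_gt0 s.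
rewrite -[RHS]ger0_norm; last by rewrite divr_ge0// ?mulr_ge0 ?addr_ge0 ?expR_ge0.
rewrite -sqrtr_sqr wfun_axis; congr Num.sqrt; rewrite (expR_half s).
by field; rewrite gt_eqF.
Qed.

Lemma sqrt_wfun_axis1 (s : R) : 0 <= s ->
  Num.sqrt (wfun (axis n s) - 1) = (expR s - 1) / (2 * expR (s / 2)).
Proof.
move=> s0; have e0 := expR_gt0 (s / 2).
have r1 : 1 <= expR s by rewrite -expR0 ler_expR.
rewrite -[RHS]ger0_norm; last by rewrite divr_ge0 ?mulr_ge0 ?expR_ge0 ?subr_ge0.
rewrite -sqrtr_sqr wfun_axis; congr Num.sqrt; rewrite (expR_half s).
by field; rewrite gt_eqF.
Qed.

Lemma rho_axis (s : R) : 0 <= s -> rho (wfun (axis n s)) = s.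
Proof.
move=> s0; rewrite /rho sqrt_wfun_axis sqrt_wfun_axis1//.
have -> : (1 + expR s) / (2 * expR (s / 2)) + (expR s - 1) / (2 * expR (s / 2)) = expR (s / 2).
  by rewrite (expR_half s); field; rewrite gt_eqF// expR_gt0.
by rewrite expRK; field.
Qed.

Lemma dist_axis (s : R) : dist 0 (axis n s) = `|s|.
Proof.
rewrite distE; last by left.
have [s0|s0] := leP 0 s; first by rewrite rho_axis// ger0_norm.
rewrite ltr0_norm// -[RHS]rho_axis; last by rewrite oppr_ge0 ltW.
congr rho; rewrite !wfun_axis expRN; field.
by rewrite gt_eqF// expR_gt0.
Qed.

(** Along a line orthogonal to the axis the distance has a critical point, so that
    the second derivative of a radial function only involves its first radial
    derivative. *)
Lemma radial_second_derivative (f d1 w c K dK : R -> R) :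
  (forall s : R, is_derive s 1 f (d1 s)) -> (forall s : R, exists d, is_derive s 1 d1 d) ->
  (forall t : R, is_derive t 1 w (t * c t)) -> (forall t, 1 < w t) ->
  (exists d, is_derive (0 : R) (1 : R) c d) ->
  (forall t, K t = f (rho (w t))) -> (forall t : R, is_derive t 1 K (dK t)) ->
  is_derive (0 : R) (1 : R) dK (d1 (rho (w 0)) * (c 0 / (Num.sqrt (w 0) * Num.sqrt (w 0 - 1)))).
Proof.
move=> hf hd1 hw w1 [dc hc] KE hK.
have hrho (t : R) : is_derive t 1 (fun t => rho (w t))
    (t * c t / (Num.sqrt (w t) * Num.sqrt (w t - 1))).
  have wt0 : 0 < w t by have := w1 t; lra.
  have wt1 : 0 < w t - 1 by have := w1 t; lra.
  have s1 : 0 < Num.sqrt (w t) by rewrite sqrtr_gt0.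
  have s2 : 0 < Num.sqrt (w t - 1) by rewrite sqrtr_gt0.
  rewrite /rho; derive_with => //; first exact: addr_gt0.
  move: s1 s2; set a := Num.sqrt _; set b := Num.sqrt _ => s1 s2.
  by field; rewrite !gt_eqF// addr_gt0.
pose m t := d1 (rho (w t)) * (c t / (Num.sqrt (w t) * Num.sqrt (w t - 1))).
have -> : dK = fun t => t * m t.
  apply/funext => t.
  have h1 : is_derive t 1 K (d1 (rho (w t)) * (t * c t / (Num.sqrt (w t) * Num.sqrt (w t - 1)))).
    rewrite (_ : K = fun t => f (rho (w t))); last by apply/funext.
    exact: (@dcomp _ f (fun t => rho (w t)) t _ _ (hf _) (hrho t)).
  have [_ <-] := hK t; have [_ ->] := h1; rewrite /m; ring.
have [e he] := hd1 (rho (w 0)).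
have hdr := @dcomp _ d1 (fun t => rho (w t)) 0 _ _ he (hrho 0).
have w0 : 0 < w 0 by have := w1 0; lra.
have w01 : 0 < w 0 - 1 by have := w1 0; lra.
have [dm hm] : exists dm, is_derive (0 : R) (1 : R) m dm.
  have s1 : Num.sqrt (w 0) * Num.sqrt (w 0 - 1) != 0.
    by rewrite mulf_neq0// gt_eqF// sqrtr_gt0.
  eexists; rewrite /m; notypeclasses refine (dM hdr _).
  notypeclasses refine (dM hc (@dV _ (fun t => Num.sqrt (w t) * Num.sqrt (w t - 1)) _ _ _ s1)).
  by der.
rewrite -/(m 0); derive_with; ring.
Qed.

Section Spherical.
Variables (l : R) (phi : R -> R).
Hypothesis sph : spherical n l phi.

Definition even_ext (s : R) : R := phi `|s|.
Let h : 'rV[R]_(dimS n) -> R := radial phi.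

Let h_axis s : h (axis n s) = even_ext s.
Proof. by rewrite /h /radial dist_axis. Qed.

Let d1 s := 'D_(delta_mx 0 (iA n) : 'rV_(dimS n)) h (axis n s).
Let d2 s := 'D_(delta_mx 0 (iA n) : 'rV_(dimS n))
  (fun y => 'D_(delta_mx 0 (iA n) : 'rV_(dimS n)) h y) (axis n s).

Let dif0 x : differentiable h x.
Proof. by case: sph => + _ _ => /(_ [::] x). Qed.

Let dif1 i x : differentiable (fun y => 'D_(delta_mx 0 i : 'rV_(dimS n)) h y) x.
Proof. by case: sph => + _ _ => /(_ [:: i] x). Qed.

Let hd1 (s : R) : is_derive s 1 even_ext (d1 s).
Proof.
have := is_derive_line (dif0 (s *: delta_mx 0 (iA n) + axis n 0)).
rewrite line_A addr0; under eq_fun do rewrite line_A addr0 h_axis.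
by [].
Qed.

Let hd2 (s : R) : is_derive s 1 d1 (d2 s).
Proof.
have := is_derive_line (dif1 (iA n) (s *: delta_mx 0 (iA n) + axis n 0)).
rewrite line_A addr0; under eq_fun do rewrite line_A addr0.
by [].
Qed.

Let d1_0 : d1 0 = 0.
Proof.
have h1 : is_derive (0 : R) (1 : R) even_ext (d1 (- 0) * - 1).
  rewrite {1}(_ : even_ext = fun s => even_ext (- s)); last first.
    by apply/funext => s; rewrite /even_ext normrN.
  exact: (@dcomp _ even_ext (fun s => - s) 0 _ _ (hd1 _) (dN (did _))).
have := hd1 0 => -[_ E1]; have := h1 => -[_ E2].
by move: E2; rewrite E1 oppr0; lra.
Qed.

Let second_X i s : 0 < s -> 'D_(delta_mx 0 (iX i) : 'rV_(dimS n))
   (fun y => 'D_(delta_mx 0 (iX i) : 'rV_(dimS n)) h y) (axis n s) = d1 s / (expR s - 1).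
Proof.
move=> s0; have r1 : 1 < expR s by rewrite expR_gt1.
have e0 := expR_gt0 (s / 2).
apply: derive_line0.
pose w t := (1 + expR s + t ^+ 2 / 4) ^+ 2 / (4 * expR s).
pose c t := (1 + expR s + t ^+ 2 / 4) / (4 * expR s).
have w0 : w 0 = wfun (axis n s) by rewrite /w wfun_axis expr0n mul0r addr0.
have := @radial_second_derivative even_ext d1 w c (fun t => h (t *: delta_mx 0 (iX i) + axis n s))
  (fun t => 'D_(delta_mx 0 (iX i) : 'rV_(dimS n)) h (t *: delta_mx 0 (iX i) + axis n s))
  hd1 (fun s => ex_intro _ _ (hd2 s)).
have -> : d1 (rho (w 0)) * (c 0 / (Num.sqrt (w 0) * Num.sqrt (w 0 - 1))) = d1 s / (expR s - 1).
  rewrite w0 rho_axis ?(ltW s0)// sqrt_wfun_axis sqrt_wfun_axis1 ?(ltW s0)// /c expr0n mul0r addr0.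
  move: r1; rewrite (expR_half s) => r1; field.
  by rewrite !gt_eqF//; lra.
apply.
- move=> t; rewrite /w /c; derive_with; field.
  by rewrite gt_eqF; lra.
- move=> t; rewrite /w ltr_pdivlMr ?mulr_gt0//; last lra.
  by have := sqr_ge0 t; nra.
- by eexists; rewrite /c; der.
- move=> t; rewrite line_X /h /radial distE; last by right.
  rewrite wfun_X -/(w t) /even_ext ger0_norm// rho_ge0//.
  rewrite /w ler_pdivlMr ?mulr_gt0//; last lra.
  by have := sqr_ge0 t; nra.
- by move=> t; exact: is_derive_line.
Qed.

Let second_Z i s : 0 < s -> 'D_(delta_mx 0 (iZ i) : 'rV_(dimS n))
   (fun y => 'D_(delta_mx 0 (iZ i) : 'rV_(dimS n)) h y) (axis n s) =
   2 * d1 s / (expR s ^+ 2 - 1).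
Proof.
move=> s0; have r1 : 1 < expR s by rewrite expR_gt1.
have e0 := expR_gt0 (s / 2).
apply: derive_line0.
pose w t := ((1 + expR s) ^+ 2 + t ^+ 2) / (4 * expR s).
pose c (t : R) := 2 / (4 * expR s).
have w0 : w 0 = wfun (axis n s) by rewrite /w wfun_axis expr0n addr0.
have := @radial_second_derivative even_ext d1 w c (fun t => h (t *: delta_mx 0 (iZ i) + axis n s))
  (fun t => 'D_(delta_mx 0 (iZ i) : 'rV_(dimS n)) h (t *: delta_mx 0 (iZ i) + axis n s))
  hd1 (fun s => ex_intro _ _ (hd2 s)).
have -> : d1 (rho (w 0)) * (c 0 / (Num.sqrt (w 0) * Num.sqrt (w 0 - 1))) =
    2 * d1 s / (expR s ^+ 2 - 1).
  rewrite w0 rho_axis ?(ltW s0)// sqrt_wfun_axis sqrt_wfun_axis1 ?(ltW s0)// /c.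
  rewrite (_ : expR s ^+ 2 - 1 = (expR s + 1) * (expR s - 1)); last ring.
  move: r1; rewrite (expR_half s) => r1; field.
  by rewrite !gt_eqF//; lra.
apply.
- move=> t; rewrite /w /c; derive_with; field.
  by rewrite gt_eqF; lra.
- move=> t; rewrite /w ltr_pdivlMr ?mulr_gt0//; last lra.
  by have := sqr_ge0 t; nra.
- by eexists; exact: dcst.
- move=> t; rewrite line_Z /h /radial distE; last by left.
  rewrite wfun_Z -/(w t) /even_ext ger0_norm// rho_ge0//.
  rewrite /w ler_pdivlMr ?mulr_gt0//; last lra.
  by have := sqr_ge0 t; nra.
- by move=> t; exact: is_derive_line.
Qed.

Lemma spherical_ode : exists d1 d2 : R -> R,
  [/\ forall s : R, is_derive s 1 even_ext (d1 s),
      forall s : R, is_derive s 1 d1 (d2 s),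
      d1 0 = 0, even_ext 0 = 1 &
      forall s, 0 < s ->
        d2 s + kappa s * d1 s + (l ^+ 2 + Qdim n ^+ 2 / 4) * even_ext s = 0].
Proof.
exists d1, d2; split => //.
  rewrite -h_axis; case: sph => _ _ <-; congr radial.
  by rewrite /axis /pack row_mx0 raddf0 row_mx0.
move=> s s0; have r1 : 1 < expR s by rewrite expR_gt1.
have := @laplacian_axis _ n h s d1 (d2 s) (fun t => erefl) (hd2 s) (fun i => dif1 i _).
have -> : \sum_(i < p) 'D_(delta_mx 0 (iX i) : 'rV_(dimS n))
    (fun y => 'D_(delta_mx 0 (iX i) : 'rV_(dimS n)) h y) (axis n s) =
    p%:R * (d1 s / (expR s - 1)).
  by under eq_bigr do rewrite second_X//; rewrite sumr_const card_ord -[LHS]mulr_natl.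
have -> : \sum_(i < q) 'D_(delta_mx 0 (iZ i) : 'rV_(dimS n))
    (fun y => 'D_(delta_mx 0 (iZ i) : 'rV_(dimS n)) h y) (axis n s) =
    q%:R * (2 * d1 s / (expR s ^+ 2 - 1)).
  by under eq_bigr do rewrite second_Z//; rewrite sumr_const card_ord -[LHS]mulr_natl.
case: sph => _ /(_ (axis n s)) + _; rewrite -[radial phi]/h h_axis => -> E.
have -> : kappa s * d1 s = expR s * (p%:R * (d1 s / (expR s - 1))) +
    expR s ^+ 2 * (q%:R * (2 * d1 s / (expR s ^+ 2 - 1))) - Qdim n * d1 s.
  rewrite /kappa /Qdim; field.
  by rewrite !gt_eqF ?subr_gt0// -[ltLHS](expr1n _ 2) ltrXn2r//.
by move: E; lra.
Qed.

End Spherical.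

End SphericalODE.

(** * Asymptotics of the spherical functions *)

Section Asymptotics.
Context {R : realType} (n : htype R).
Local Notation p := (dim_v n).
Local Notation q := (dim_z n).
Local Notation m := (p + q)%N.
Local Notation Q := (Qdim n).
Local Notation kappa := (kappa n).

Lemma Qdim_gt0 : 0 < Q.
Proof.
have : 0 < q%:R :> R by rewrite ltr0n dim_z_gt0.
by rewrite /Qdim; have := ler0n R p; lra.
Qed.

(** [f] is the even extension of the profile of a spherical function of
    eigenvalue [- mu], with its first two derivatives. *)
Definition radial_eigenfunction (mu : R) (f d1 d2 : R -> R) : Prop :=
  [/\ forall s : R, is_derive s 1 f (d1 s), forall s : R, is_derive s 1 d1 (d2 s),
      d1 0 = 0, f 0 = 1 &
      forall s, 0 < s -> d2 s + kappa s * d1 s + mu * f s = 0].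

Lemma kappa_ge0 s : 0 < s -> 0 <= kappa s.
Proof.
move=> s0; have r1 : 1 < expR s by rewrite expR_gt1.
rewrite /kappa addr_ge0// mulr_ge0 ?divr_ge0 ?subr_ge0//; nra.
Qed.

(** The energy [d1 ^ 2 + mu * f ^ 2] decreases because [kappa >= 0]. *)
Lemma energy_bound mu f d1 d2 s : 0 < mu -> radial_eigenfunction mu f d1 d2 -> 0 <= s ->
  d1 s ^+ 2 + mu * f s ^+ 2 <= mu.
Proof.
move=> mu0 [h1 h2 d10 f0 ode] s0.
have hE t : is_derive t (1 : R) (fun t => - (d1 t ^+ 2 + mu * f t ^+ 2))
    (- (2 * d1 t * (d2 t + mu * f t))).
  by derive_with; rewrite /=; ring.
have := is_derive_ge0_le_cc s0 (fun t _ => hE t).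
rewrite d10 f0 expr0n expr1n /= => H.
suff : - (0 + mu * 1) <= - (d1 s ^+ 2 + mu * f s ^+ 2) by lra.
apply: H => t /andP[t0 _]; have := ode t t0; have := kappa_ge0 t0 => k0 E.
have -> : - (2 * d1 t * (d2 t + mu * f t)) = 2 * (kappa t * d1 t ^+ 2).
  by rewrite (_ : d2 t + mu * f t = - (kappa t * d1 t)); [ring|lra].
by rewrite mulr_ge0// mulr_ge0// sqr_ge0.
Qed.

Lemma eigenfunction_le1 mu f d1 d2 s : 0 < mu -> radial_eigenfunction mu f d1 d2 -> 0 <= s ->
  `|f s| <= 1.
Proof.
move=> mu0 H s0; have := energy_bound mu0 H s0 => E.
rewrite -(@ler_pXn2r _ 2)// ?nnegrE// real_normK ?num_real// expr1n.
have : mu * f s ^+ 2 <= mu * 1 by have := sqr_ge0 (d1 s); lra.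
by rewrite ler_pM2l.
Qed.

(** Gronwall's inequality for the energy of the difference of two solutions. *)
Lemma eigenfunction_continuity mu mu' f d1 d2 f' d1' d2' s : 0 < mu -> 0 < mu' ->
  radial_eigenfunction mu f d1 d2 -> radial_eigenfunction mu' f' d1' d2' -> 0 <= s ->
  (d1 s - d1' s) ^+ 2 + mu * (f s - f' s) ^+ 2 <= (mu' - mu) ^+ 2 * expR s.
Proof.
move=> mu0 mu0' H H' s0; have [h1 h2 d10 f0 ode] := H; have [h1' h2' d10' f0' ode'] := H'.
pose E t := (d1 t - d1' t) ^+ 2 + mu * (f t - f' t) ^+ 2.
pose dE t := 2 * (d1 t - d1' t) * (d2 t - d2' t + mu * (f t - f' t)).
have hE t : is_derive t (1 : R) E (dE t).
  by rewrite /E /dE; derive_with; rewrite /=; ring.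
pose del2 := (mu' - mu) ^+ 2.
have hF t : is_derive t (1 : R) (fun t => - ((E t + del2) * expR (- t)))
    ((E t + del2 - dE t) * expR (- t)).
  by have := hE t => hEt; derive_with; ring.
have := is_derive_ge0_le_cc s0 (fun t _ => hF t).
have -> : E 0 = 0 by rewrite /E d10 d10' f0 f0' !subrr expr0n mulr0 addr0.
rewrite oppr0 expR0 add0r mulr1 => /(_ _); rewrite expRN => G.
suff : E s <= del2 * expR s by [].
have es := expR_gt0 s.
suff : - del2 <= - ((E s + del2) / expR s).
  by rewrite lerN2 ler_pdivrMr//; have : 0 <= del2 by [rewrite sqr_ge0]; lra.
apply: G => t /andP[t0 _]; rewrite mulr_ge0 ?expR_ge0//.
have o := ode t t0; have o' := ode' t t0; have k0 := kappa_ge0 t0.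
have b := eigenfunction_le1 mu0' H' (ltW t0).
have b2 : f' t ^+ 2 <= 1.
  by rewrite -(real_normK (num_real (f' t))) expr_le1.
have -> : dE t = 2 * (d1 t - d1' t) * ((mu' - mu) * f' t) - 2 * (kappa t * (d1 t - d1' t) ^+ 2).
  rewrite /dE (_ : d2 t = - (kappa t * d1 t) - mu * f t); last lra.
  by rewrite (_ : d2' t = - (kappa t * d1' t) - mu' * f' t); [ring|lra].
have kk : 0 <= kappa t * (d1 t - d1' t) ^+ 2 by rewrite mulr_ge0 ?sqr_ge0.
have : ((mu' - mu) * f' t) ^+ 2 <= del2.
  by rewrite exprMn ler_piMr ?sqr_ge0.
rewrite /E; have := sqr_ge0 (d1 t - d1' t - (mu' - mu) * f' t).
have : 0 <= mu * (f t - f' t) ^+ 2 by rewrite mulr_ge0 ?sqr_ge0// ltW.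
by lra.
Qed.

Definition sqrtA (s : R) : R := Num.sqrt (Adens n s).

Lemma sinh_gt0 (s : R) : 0 < s -> 0 < sinh (s / 2).
Proof.
move=> s0; rewrite /sinh divr_gt0// subr_gt0 ltr_expR; lra.
Qed.

Lemma cosh_gt0 (s : R) : 0 < cosh s.
Proof. by rewrite /cosh divr_gt0// addr_gt0// expR_gt0. Qed.

Lemma Adens_gt0 s : 0 < s -> 0 < Adens n s.
Proof. by move=> s0; rewrite /Adens !mulr_gt0 ?exprn_gt0 ?sinh_gt0 ?cosh_gt0. Qed.

Lemma Adens_ge0 s : 0 <= s -> 0 <= Adens n s.
Proof.
rewrite le_eqVlt => /predU1P[<-|/Adens_gt0/ltW//].
rewrite /Adens !mulr_ge0 ?exprn_ge0 ?(ltW (cosh_gt0 _))// mul0r /sinh.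
by rewrite oppr0 subrr mul0r.
Qed.

Lemma dAdens (s : R) : 0 < s -> is_derive s 1 (Adens n : R -> R) (kappa s * Adens n s).
Proof.
move=> s0; have sh := sinh_gt0 s0; have ch := cosh_gt0 (s / 2).
have r1 : 1 < expR s by rewrite expR_gt1.
have hs : is_derive s (1 : R) (fun s => sinh (s / 2)) (cosh (s / 2) / 2).
  by rewrite /sinh /cosh; derive_with; field.
have hc : is_derive s (1 : R) (fun s => cosh (s / 2)) (sinh (s / 2) / 2).
  by rewrite /sinh /cosh; derive_with; field.
have pX (x : R) k : x != 0 -> k%:R * x ^+ k.-1 = k%:R * x ^+ k / x.
  by case: k => [|k] x0; rewrite ?mul0r// exprSr mulrA mulfK.
rewrite /Adens; derive_with; rewrite !pX ?gt_eqF//.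
have -> : kappa s = m%:R / 2 * (cosh (s / 2) / sinh (s / 2)) + q%:R / 2 * (sinh (s / 2) / cosh (s / 2)).
  rewrite /kappa natrD.
  have e0 := expR_gt0 (s / 2).
  move: sh ch r1; rewrite /cosh /sinh expRN (expR_half s); set e := expR (s / 2) => sh ch r1.
  have n1 : e ^+ 2 - 1 != 0 by rewrite gt_eqF// subr_gt0.
  have n2 : e ^+ 2 + 1 != 0 by rewrite gt_eqF// addr_gt0// exprn_gt0.
  have n3 : (e ^+ 2) ^+ 2 - 1 != 0.
    by rewrite (_ : _ - 1 = (e ^+ 2 - 1) * (e ^+ 2 + 1)); [rewrite mulf_neq0|ring].
  by field; rewrite -(expr2 e) n1 n2 n3 (gt_eqF e0).
by field; rewrite !gt_eqF.
Qed.

Lemma dsqrtA (s : R) : 0 < s -> is_derive s 1 sqrtA (kappa s / 2 * sqrtA s).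
Proof.
move=> s0; have A0 := Adens_gt0 s0; have hA := dAdens s0.
rewrite /sqrtA; derive_with => //.
have b0 : Num.sqrt (Adens n s) != 0 by rewrite gt_eqF// sqrtr_gt0.
rewrite -{2}(sqr_sqrtr (ltW A0)); field => //.
Qed.

Definition dkappa (s : R) : R := - (p%:R * expR s / (expR s - 1) ^+ 2) -
  4 * q%:R * expR s ^+ 2 / (expR s ^+ 2 - 1) ^+ 2.

Lemma hkappa (s : R) : 0 < s -> is_derive s 1 kappa (dkappa s).
Proof.
move=> s0; have r1 : 1 < expR s by rewrite expR_gt1.
have n1 : expR s - 1 != 0 by rewrite gt_eqF// subr_gt0.
have n2 : expR s ^+ 2 - 1 != 0 by rewrite gt_eqF// subr_gt0 -[ltLHS](expr1n _ 2) ltrXn2r.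
by rewrite /kappa; derive_with => //; rewrite /dkappa /=; field; rewrite n1 n2.
Qed.

(** The potential of the Schroedinger equation satisfied by [sqrtA s * f s]. *)
Definition potential (s : R) : R := dkappa s / 2 + kappa s ^+ 2 / 4 - Q ^+ 2 / 4.

Lemma expR_sub1_bounds (s r : R) : 0 < s -> s <= r -> s <= expR s - 1 <= s * expR r.
Proof.
move=> s0 sr; apply/andP; split; first by have := expR_ge1Dx s; lra.
have h := expR_ge1Dx (- s); have es := expR_gt0 s.
have : expR s * (1 - s) <= expR s * expR (- s) by rewrite ler_pM2l.
rewrite expRxMexpNx_1.
have : s * expR s <= s * expR r by rewrite ler_pM2l// ler_expR.
by lra.
Qed.

Lemma geometry_bounds (r : R) : 0 < r -> exists2 C : R, 1 <= C & forall s, 0 < s <= r ->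
  [/\ `|potential s| <= C / s ^+ 2, kappa s <= C / s & Adens n s <= C * s ^+ m].
Proof.
move=> r0; pose e := expR r.
have e1 : 1 <= e by rewrite -expR0 ler_expR ltW.
have p0 := ler0n R p; have q0 := ler0n R q; have Q0 := Qdim_gt0.
pose K := p%:R / 2 * (e + 1) + q%:R * (e ^+ 2 + 1).
pose DK := p%:R * e + 4 * q%:R * e ^+ 2.
have K0 : 0 <= K by rewrite addr_ge0// mulr_ge0 ?divr_ge0// addr_ge0// ?sqr_ge0//; lra.
have DK0 : 0 <= DK by rewrite addr_ge0// !mulr_ge0 ?sqr_ge0//; lra.
pose CP := DK / 2 + K ^+ 2 / 4 + Q ^+ 2 / 4 * r ^+ 2.
have CP0 : 0 <= CP.
  have a1 : 0 <= DK / 2 by rewrite divr_ge0.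
  have a2 : 0 <= K ^+ 2 / 4 by rewrite divr_ge0// sqr_ge0.
  have a3 : 0 <= Q ^+ 2 / 4 * r ^+ 2 by rewrite mulr_ge0 ?sqr_ge0// divr_ge0// sqr_ge0.
  by rewrite /CP; lra.
pose CA := e ^+ m * e ^+ q.
have CA0 : 0 <= CA by rewrite mulr_ge0 ?exprn_ge0//; lra.
exists (1 + CP + K + CA); first lra.
move=> s /andP[s0 sr]; have /andP[l1 l2] := expR_sub1_bounds s0 sr.
have es : expR s <= e by rewrite ler_expR.
have es1 : 1 < expR s by rewrite expR_gt1.
have d1 : 0 < expR s - 1 by rewrite subr_gt0.
have l3 : s <= expR s ^+ 2 - 1 by nra.
have es2 : expR s ^+ 2 <= e ^+ 2 by rewrite lerXn2r ?nnegrE//; lra.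
have s20 : 0 < s ^+ 2 by rewrite exprn_gt0.
have inv1 : (expR s - 1)^-1 <= s^-1 by rewrite lef_pV2 ?posrE.
have inv2 : (expR s ^+ 2 - 1)^-1 <= s^-1 by rewrite lef_pV2 ?posrE//; lra.
have i1 : 0 <= (expR s - 1)^-1 by rewrite invr_ge0 ltW.
have i2 : 0 <= (expR s ^+ 2 - 1)^-1 by rewrite invr_ge0; lra.
have si0 : 0 < s^-1 by rewrite invr_gt0.
have kle : kappa s <= K / s.
  have -> : K / s = p%:R / 2 * ((e + 1) / s) + q%:R * ((e ^+ 2 + 1) / s) by rewrite /K; ring.
  rewrite /kappa; apply: lerD.
    by apply: ler_wpM2l; [rewrite divr_ge0|apply: ler_pM => //; lra].
  by apply: ler_wpM2l => //; apply: ler_pM => //; lra.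
have k0 := kappa_ge0 s0.
have k2 : kappa s ^+ 2 <= K ^+ 2 / s ^+ 2.
  by rewrite -expr_div_n lerXn2r ?nnegrE ?divr_ge0// ltW.
have dk : `|dkappa s| <= DK / s ^+ 2.
  have t1 : 0 <= p%:R * expR s / (expR s - 1) ^+ 2.
    by rewrite divr_ge0 ?sqr_ge0// mulr_ge0//; lra.
  have t2 : 0 <= 4 * q%:R * expR s ^+ 2 / (expR s ^+ 2 - 1) ^+ 2.
    by rewrite divr_ge0 ?sqr_ge0// !mulr_ge0 ?sqr_ge0//.
  have j1 : ((expR s - 1)^-1) ^+ 2 <= s^-1 ^+ 2.
    by rewrite lerXn2r ?nnegrE// ltW.
  have j2 : ((expR s ^+ 2 - 1)^-1) ^+ 2 <= s^-1 ^+ 2.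
    by rewrite lerXn2r ?nnegrE// ltW.
  have -> : DK / s ^+ 2 = p%:R * e * s^-1 ^+ 2 + 4 * q%:R * e ^+ 2 * s^-1 ^+ 2.
    by rewrite /DK exprVn; ring.
  rewrite /dkappa -opprD normrN ger0_norm; last exact: addr_ge0.
  rewrite -!exprVn; apply: lerD.
    apply: ler_pM; [by rewrite mulr_ge0//; lra|exact: exprn_ge0| |exact: j1].
    by rewrite ler_wpM2l.
  apply: ler_pM; [by rewrite !mulr_ge0 ?sqr_ge0|exact: exprn_ge0| |exact: j2].
  by rewrite ler_wpM2l// mulr_ge0.
split.
- apply: (@le_trans _ _ (CP / s ^+ 2)); last first.
    by rewrite ler_pM2r ?invr_gt0//; lra.
  have -> : CP / s ^+ 2 = DK / s ^+ 2 / 2 + K ^+ 2 / s ^+ 2 / 4 + Q ^+ 2 / 4 * r ^+ 2 / s ^+ 2.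
    by rewrite /CP; ring.
  have Q2 : 0 <= Q ^+ 2 by rewrite sqr_ge0.
  have Qr : Q ^+ 2 / 4 <= Q ^+ 2 / 4 * r ^+ 2 / s ^+ 2.
    rewrite -[leRHS]mulrA ler_peMr ?divr_ge0// ler_pdivlMr// mul1r.
    by rewrite lerXn2r ?nnegrE// ltW.
  move: dk; rewrite /potential !ler_norml => /andP[dk1 dk2].
  by have kk := sqr_ge0 (kappa s); apply/andP; split; lra.
- by apply: (le_trans kle); rewrite ler_pM2r//; lra.
- have sh0 := sinh_gt0 s0; have ch0 := cosh_gt0 (s / 2).
  have eh1 : 1 <= expR (s / 2) by rewrite -[leLHS]expR0 ler_expR; lra.
  have ehi : expR (- (s / 2)) <= 1 by rewrite -[leRHS]expR0 ler_expR; lra.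
  have ehi0 := expR_gt0 (- (s / 2)).
  have sh : 2 * sinh (s / 2) <= s * e.
    apply: le_trans l2.
    have -> : 2 * sinh (s / 2) = (expR s - 1) * expR (- (s / 2)).
      by rewrite /sinh expRN (expR_half s); field; rewrite gt_eqF// expR_gt0.
    by rewrite ler_piMr// ltW.
  have ch : cosh (s / 2) <= e.
    have ehe : expR (s / 2) <= e by rewrite ler_expR; lra.
    by rewrite /cosh; lra.
  apply: (@le_trans _ _ (CA * s ^+ m)); last first.
    by rewrite ler_pM2r ?exprn_gt0//; lra.
  rewrite /Adens -exprMn (_ : CA * s ^+ m = (s * e) ^+ m * e ^+ q); last first.
    by rewrite /CA exprMn; ring.
  have sh2 : 0 <= 2 * sinh (s / 2) by rewrite mulr_ge0// ltW.
  have se0 : 0 <= s * e by apply: le_trans sh.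
  have e0 : 0 <= e by lra.
  apply: ler_pM; [exact: exprn_ge0|by rewrite exprn_ge0// ltW| |].
    by rewrite lerXn2r.
  by rewrite lerXn2r ?nnegrE// ltW.
Qed.

End Asymptotics.

Section SphericalAsymptotics.
Context {R : realType} (n : htype R).
Local Notation p := (dim_v n).
Local Notation q := (dim_z n).
Local Notation m := (p + q)%N.
Local Notation Q := (Qdim n).

(** Variation of constants: [coef_cos * cos (l * x) + coef_sin * sin (l * x)] is the
    solution of [v'' + l ^ 2 * v = 0] that has at [s] the same value and derivative as
    [sqrtA * f]. *)
Definition coef_cos (l : R) (f d1 : R -> R) (s : R) : R :=
  sqrtA n s * f s * cos (l * s)
  - sqrtA n s * (d1 s + kappa n s / 2 * f s) / l * sin (l * s).
Definition coef_sin (l : R) (f d1 : R -> R) (s : R) : R :=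
  sqrtA n s * f s * sin (l * s)
  + sqrtA n s * (d1 s + kappa n s / 2 * f s) / l * cos (l * s).

Lemma variation_bound (u du : R -> R) (K a b : R) : 0 < a -> a <= b -> 0 <= K ->
  (forall x, a <= x <= b -> is_derive x 1 u (du x)) ->
  (forall x, a <= x <= b -> `|du x| <= K / x ^+ 2) -> `|u a - u b| <= K / a.
Proof.
move=> a0 ab K0 hu hK.
have hi x : a <= x <= b -> is_derive x 1 (fun x : R => K / x) (- K / x ^+ 2).
  move=> /andP[ax _]; have x0 : x != 0 by rewrite gt_eqF// (lt_le_trans a0).
  by derive_with => //; field.
have Kb : 0 <= K / b by rewrite divr_ge0// (le_trans (ltW a0)).
have h1 := is_derive_ge0_le_cc ab (fun x xab => dD (hu x xab) (dN (hi x xab))).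
have h2 := is_derive_ge0_le_cc ab (fun x xab => dD (dN (hu x xab)) (dN (hi x xab))).
rewrite ler_norml; apply/andP; split.
  have : - u a - K / a <= - u b - K / b.
    apply: h2 => x /andP[ax xb]; have xab : a <= x <= b by rewrite !ltW.
    by have := hK x xab; rewrite ler_norml mulNr => /andP[? ?]; lra.
  by lra.
have : u a - K / a <= u b - K / b.
  apply: h1 => x /andP[ax xb]; have xab : a <= x <= b by rewrite !ltW.
  by have := hK x xab; rewrite ler_norml mulNr => /andP[? ?]; lra.
by lra.
Qed.

(** Up to [s = 1 / l] the eigenfunction is bounded by its value at the identity;
    beyond, the potential is integrable with total mass at most of order [l] and
    the variation of constants is controlled by Gronwall's inequality. *)
Lemma spherical_asymptotics (r : R) : 1 <= r -> exists2 C : R, 1 <= C &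
  forall (l : R) (f d1 d2 : R -> R), 1 <= l ->
  radial_eigenfunction n (l ^+ 2 + Q ^+ 2 / 4) f d1 d2 ->
  [/\ `|coef_cos l f d1 r| <= C * Num.sqrt (l ^- m),
      `|coef_sin l f d1 r| <= C * Num.sqrt (l ^- m) &
      forall s, 0 < s <= r ->
        `|sqrtA n s * f s - (coef_cos l f d1 r * cos (l * s) + coef_sin l f d1 r * sin (l * s))|
        <= C * Num.sqrt (l ^- m) * Num.min 1 (l * s)^-1].
Proof.
move=> r1; have r0 : 0 < r by lra.
have [C0 C01 geo] := geometry_bounds n r0.
have Q2 : 0 <= Q ^+ 2 / 4 by rewrite divr_ge0// sqr_ge0.
pose C3 := C0 * (1 + 2 * (1 + Q ^+ 2 / 4) + C0 ^+ 2).
have C20 : 0 <= C0 ^+ 2 by rewrite sqr_ge0.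
have C30 : 0 <= C3 by rewrite mulr_ge0//; lra.
pose C4 := C3 * expR C0.
have C40 : 0 <= C4 by rewrite mulr_ge0// expR_ge0.
have s40 := sqrtr_ge0 C4; have s00 := sqrtr_ge0 C0.
exists (1 + Num.sqrt C0 + 2 * Num.sqrt C4 + 2 * C0 * Num.sqrt C4).
  have : 0 <= 2 * C0 * Num.sqrt C4 by rewrite !mulr_ge0//; lra.
  lra.
move=> l f d1 d2 l1 eig; have [hf hd1 d10 f0 ode] := eig.
have l0 : 0 < l by lra.
have lm0 : 0 < l ^- m by rewrite invr_gt0 exprn_gt0.
have mu0 : 0 < l ^+ 2 + Q ^+ 2 / 4 by rewrite ltr_pwDl// exprn_gt0.
pose b s := sqrtA n s.
pose v s := b s * f s.
pose v' s := b s * (d1 s + kappa n s / 2 * f s).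
have hv (s : R) : 0 < s -> is_derive s 1 v (v' s).
  move=> s0; have hb := dsqrtA n s0; have hfs := hf s.
  by rewrite /v /v' /b; derive_with; ring.
have hv' (s : R) : 0 < s -> is_derive s 1 v' (- (l ^+ 2 - potential n s) * v s).
  move=> s0; have hb := dsqrtA n s0; have hfs := hf s; have hds := hd1 s; have hk := hkappa n s0.
  rewrite /v' /v /b; derive_with; rewrite /potential.
  have -> : d2 s = - (kappa n s * d1 s) - (l ^+ 2 + Q ^+ 2 / 4) * f s by have := ode s s0; lra.
  by field.
pose V2 s := v s ^+ 2 + (v' s / l) ^+ 2.
have V20 s : 0 <= V2 s by rewrite addr_ge0// sqr_ge0.
have hV2 (s : R) : 0 < s -> is_derive s 1 V2 (2 * v s * (v' s / l) * (potential n s / l)).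
  move=> s0; have h1 := hv s s0; have h2 := hv' s s0.
  rewrite /V2; derive_with; rewrite /=; field.
  by rewrite gt_eqF.
have li0 : 0 < l^-1 by rewrite invr_gt0.
have lir : l^-1 <= r by rewrite (le_trans _ r1)// invf_le1.
have V2start : V2 l^-1 <= C3 * l ^- m.
  have [_ kb Ab] := geo l^-1 (introT andP (conj li0 lir)).
  have k0 := kappa_ge0 n li0.
  have E := energy_bound mu0 eig (ltW li0).
  have F := eigenfunction_le1 mu0 eig (ltW li0).
  have F2 : f l^-1 ^+ 2 <= 1.
    by rewrite -(real_normK (num_real (f l^-1))) expr_le1.
  have -> : V2 l^-1 = Adens n l^-1 * (f l^-1 ^+ 2 + (d1 l^-1 + kappa n l^-1 / 2 * f l^-1) ^+ 2 / l ^+ 2).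
    rewrite /V2 /v /v' /b /sqrtA.
    rewrite -{3}(sqr_sqrtr (Adens_ge0 n (ltW li0))); field.
    by rewrite gt_eqF.
  rewrite (_ : C3 * l ^- m = (C0 * l ^- m) * (1 + 2 * (1 + Q ^+ 2 / 4) + C0 ^+ 2)); last first.
    by rewrite /C3; ring.
  apply: ler_pM.
  - exact: Adens_ge0 (ltW li0).
  - by rewrite addr_ge0 ?sqr_ge0// divr_ge0 ?sqr_ge0.
  - by rewrite -exprVn.
  rewrite -addrA; apply: lerD => //.
  have l20 : 0 < l ^+ 2 by rewrite exprn_gt0.
  rewrite ler_pdivrMr//.
  have kl : kappa n l^-1 <= C0 * l by move: kb; rewrite invrK.
  have k2 : kappa n l^-1 ^+ 2 <= C0 ^+ 2 * l ^+ 2.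
    by rewrite -exprMn lerXn2r ?nnegrE// mulr_ge0// ltW//; lra.
  have kf : (kappa n l^-1 / 2 * f l^-1) ^+ 2 <= C0 ^+ 2 * l ^+ 2 / 4.
    have : kappa n l^-1 ^+ 2 * f l^-1 ^+ 2 <= kappa n l^-1 ^+ 2.
      by rewrite ler_piMr// sqr_ge0.
    by lra.
  have d12 : d1 l^-1 ^+ 2 <= (1 + Q ^+ 2 / 4) * l ^+ 2.
    have : 0 <= (l ^+ 2 + Q ^+ 2 / 4) * f l^-1 ^+ 2 by rewrite mulr_ge0 ?sqr_ge0// ltW.
    have : Q ^+ 2 / 4 <= Q ^+ 2 / 4 * l ^+ 2.
      by rewrite ler_peMr// expr_ge1//; lra.
    by lra.
  have CL : 0 <= C0 ^+ 2 * l ^+ 2 by rewrite mulr_ge0// ltW.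
  by have := sqr_ge0 (d1 l^-1 - kappa n l^-1 / 2 * f l^-1); lra.
have V2le s : l^-1 <= s <= r -> V2 s <= C4 * l ^- m.
  move=> /andP[ls sr]; have s0 : 0 < s := lt_le_trans li0 ls.
  have dF x : l^-1 <= x <= s -> is_derive x 1 (fun x => - (V2 x * expR (C0 / (l * x))))
      (- ((2 * v x * (v' x / l) * (potential n x / l) - C0 / (l * x ^+ 2) * V2 x) *
          expR (C0 / (l * x)))).
    move=> /andP[lx xs]; have x0 : 0 < x := lt_le_trans li0 lx.
    have h := hV2 x x0; derive_with; first by rewrite mulf_neq0// gt_eqF.
    by rewrite /=; field; rewrite !gt_eqF.
  have := is_derive_ge0_le_cc ls dF; rewrite divff ?gt_eqF// divr1 => /(_ _) H.
  have : - (V2 l^-1 * expR C0) <= - (V2 s * expR (C0 / (l * s))).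
    apply: H => x /andP[lx xs]; have x0 : 0 < x := lt_trans li0 lx.
    rewrite -mulNr mulr_ge0 ?expR_ge0// oppr_ge0 subr_le0.
    have [pb _ _] := geo x (introT andP (conj x0 (le_trans (ltW xs) sr))).
    have pb' : `|potential n x / l| <= C0 / (l * x ^+ 2).
      rewrite normrM normfV (gtr0_norm l0) invfM mulrA [leRHS]mulrAC.
      by rewrite ler_pM2r// invr_gt0.
    apply: (le_trans (ler_norm _)); rewrite normrM mulrC; apply: ler_pM => //.
    rewrite /V2 ler_norml; apply/andP; split.
      by have := sqr_ge0 (v x + v' x / l); lra.
    by have := sqr_ge0 (v x - v' x / l); lra.
  rewrite lerN2 => h.
  have : V2 s * 1 <= V2 s * expR (C0 / (l * s)).
    by rewrite ler_wpM2l// -[leLHS]expR0 ler_expR divr_ge0 ?mulr_ge0//; lra.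
  rewrite mulr1 => h2; apply: (le_trans h2); apply: (le_trans h).
  by rewrite /C4 mulrAC ler_pM2r ?expR_gt0.
pose L := Num.sqrt (l ^- m).
have L0 : 0 <= L by exact: sqrtr_ge0.
pose N := Num.sqrt C4 * L.
have N0 : 0 <= N by rewrite mulr_ge0.
have NE : N ^+ 2 = C4 * l ^- m by rewrite exprMn !sqr_sqrtr// ltW.
have vle s : l^-1 <= s <= r -> `|v s| <= N.
  move=> /V2le h; rewrite -(@ler_pXn2r _ 2)// ?nnegrE// real_normK ?num_real// NE.
  by apply: le_trans h; rewrite lerDl sqr_ge0.
have cc s : coef_cos l f d1 s = v s * cos (l * s) - v' s / l * sin (l * s) by [].
have cs s : coef_sin l f d1 s = v s * sin (l * s) + v' s / l * cos (l * s) by [].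
have trig s : coef_cos l f d1 s ^+ 2 + coef_sin l f d1 s ^+ 2 = V2 s.
  rewrite cc cs /V2; have := cos2Dsin2 (l * s); set c := cos _; set sn := sin _ => E.
  transitivity ((v s ^+ 2 + (v' s / l) ^+ 2) * (c ^+ 2 + sn ^+ 2)); first ring.
  by rewrite E mulr1.
have vE s : v s = coef_cos l f d1 s * cos (l * s) + coef_sin l f d1 s * sin (l * s).
  rewrite cc cs; have := cos2Dsin2 (l * s); set c := cos _; set sn := sin _ => E.
  transitivity (v s * (c ^+ 2 + sn ^+ 2)); first by rewrite E mulr1.
  ring.
have rr : l^-1 <= r <= r by rewrite lir lexx.
have ccN : `|coef_cos l f d1 r| <= N.
  rewrite -(@ler_pXn2r _ 2)// ?nnegrE// real_normK ?num_real// NE.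
  by apply: le_trans (V2le r rr); rewrite -trig lerDl sqr_ge0.
have csN : `|coef_sin l f d1 r| <= N.
  rewrite -(@ler_pXn2r _ 2)// ?nnegrE// real_normK ?num_real// NE.
  by apply: le_trans (V2le r rr); rewrite -trig lerDr sqr_ge0.
set C := 1 + _ + _ + _.
have CN0 : 0 <= 2 * C0 * Num.sqrt C4 by rewrite !mulr_ge0//; lra.
have NC : N <= C * L by rewrite /N ler_wpM2r// /C; lra.
split; [exact: le_trans NC|exact: le_trans NC|].
move=> s /andP[s0 sr]; rewrite -/(v s).
have [ls|sl] := leP l^-1 s.
  have ls1 : (l * s)^-1 <= 1.
    rewrite invf_le1 ?mulr_gt0//; move: ls; rewrite -(ler_pM2l l0) mulfV// gt_eqF//.
  rewrite (min_idPr ls1).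
  pose K := C0 / l * N.
  have K0 : 0 <= K by rewrite mulr_ge0// divr_ge0//; [exact: le_trans C01|exact: ltW].
  have small x (t : R) : s <= x <= r -> `|t| <= 1 -> `|t / l * (potential n x * v x)| <= K / x ^+ 2.
    move=> /andP[sx xr] t1; have x0 : 0 < x := lt_le_trans s0 sx.
    have [pb _ _] := geo x (introT andP (conj x0 xr)).
    have vx : `|v x| <= N by apply: vle; rewrite xr andbT (le_trans ls).
    rewrite !normrM normfV (gtr0_norm l0).
    have -> : K / x ^+ 2 = 1 / l * (C0 / x ^+ 2 * N) by rewrite /K; ring.
    apply: ler_pM; rewrite ?mulr_ge0 ?invr_ge0 ?(ltW l0)//.
      by rewrite ler_pM2r.
    by rewrite -normrM; apply: ler_pM.
  have hcc x : s <= x <= r -> is_derive x 1 (coef_cos l f d1)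
      (- sin (l * x) / l * (potential n x * v x)).
    move=> /andP[sx xr]; have x0 : 0 < x := lt_le_trans s0 sx.
    have h1 := hv x x0; have h2 := hv' x x0.
    rewrite (_ : coef_cos l f d1 = fun s => v s * cos (l * s) - v' s / l * sin (l * s))//.
    by derive_with; field; rewrite gt_eqF.
  have hcs x : s <= x <= r -> is_derive x 1 (coef_sin l f d1)
      (cos (l * x) / l * (potential n x * v x)).
    move=> /andP[sx xr]; have x0 : 0 < x := lt_le_trans s0 sx.
    have h1 := hv x x0; have h2 := hv' x x0.
    rewrite (_ : coef_sin l f d1 = fun s => v s * sin (l * s) + v' s / l * cos (l * s))//.
    by derive_with; field; rewrite gt_eqF.
  have b1 := variation_bound s0 sr K0 hcc (fun x xs =>
    small x _ xs (eq_ind_r (fun z => z <= 1) (abs_sin_le1 _) (normrN _))).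
  have b2 := variation_bound s0 sr K0 hcs (fun x xs => small x _ xs (abs_cos_le1 _)).
  rewrite [in X in `|X|]vE.
  rewrite (_ : _ - _ = (coef_cos l f d1 s - coef_cos l f d1 r) * cos (l * s) +
     (coef_sin l f d1 s - coef_sin l f d1 r) * sin (l * s)); last ring.
  apply: (le_trans (ler_normD _ _)); rewrite !normrM.
  apply: (@le_trans _ _ (K / s * 1 + K / s * 1)).
    by apply: lerD; apply: ler_pM; rewrite ?abs_cos_le1 ?abs_sin_le1.
  rewrite !mulr1 (_ : K / s + K / s = 2 * C0 * Num.sqrt C4 * (L * (l * s)^-1)); last first.
    by rewrite /K /N; field; rewrite !gt_eqF.
  rewrite mulrA; apply: ler_wpM2r; first by rewrite invr_ge0 ltW // mulr_gt0.
  by apply: ler_wpM2r; rewrite // /C; lra.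
have ls1 : 1 <= (l * s)^-1.
  rewrite -[leLHS]invr1 lef_pV2 ?posrE ?mulr_gt0//.
  by move: (ltW sl); rewrite -(ler_pM2l l0) mulfV// gt_eqF.
rewrite (min_idPl ls1) mulr1.
have vsmall : `|v s| <= Num.sqrt C0 * L.
  rewrite /v normrM -[leRHS]mulr1; apply: ler_pM => //; last first.
    exact: eigenfunction_le1 mu0 eig (ltW s0).
  rewrite /b /sqrtA ger0_norm ?sqrtr_ge0// /L -sqrtrM; last lra.
  rewrite ler_sqrt; last by rewrite mulr_ge0// ltW//; lra.
  have [_ _ Ab] := geo s (introT andP (conj s0 sr)).
  apply: (le_trans Ab); rewrite ler_wpM2l//; first lra.
  by rewrite -exprVn lerXn2r ?nnegrE ?(ltW s0) ?(ltW li0)// ltW.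
apply: (le_trans (ler_normB _ _)).
apply: (@le_trans _ _ (Num.sqrt C0 * L + (N * 1 + N * 1))).
  apply: lerD => //; apply: (le_trans (ler_normD _ _)); rewrite !normrM.
  by apply: lerD; apply: ler_pM; rewrite ?abs_cos_le1 ?abs_sin_le1.
rewrite (_ : _ + _ = (Num.sqrt C0 + 2 * Num.sqrt C4) * L); last by rewrite /N; ring.
by rewrite ler_wpM2r// /C; lra.
Qed.

End SphericalAsymptotics.

(** * Euler's product for the Gamma function *)

Section ComplexEstimates.
Context {R : realType}.
Local Notation normc := (@Normc.normc R).
Implicit Types (z w : R[i]) (x y : R).

Lemma normc_sqrt z : normc z = Num.sqrt (complex.Re z ^+ 2 + complex.Im z ^+ 2).
Proof. by case: z. Qed.

Lemma normc_ge0 z : 0 <= normc z. Proof. by rewrite normc_sqrt sqrtr_ge0. Qed.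

Lemma normc_real x : normc x%:C%C = `|x|.
Proof. by rewrite normc_sqrt/= expr0n addr0 sqrtr_sqr. Qed.

Lemma abs_Re_le z : `|complex.Re z| <= normc z.
Proof. by rewrite normc_sqrt -sqrtr_sqr ler_wsqrtr// lerDl sqr_ge0. Qed.

Lemma abs_Im_le z : `|complex.Im z| <= normc z.
Proof. by rewrite normc_sqrt -sqrtr_sqr ler_wsqrtr// lerDr sqr_ge0. Qed.

Lemma normc_le z : normc z <= `|complex.Re z| + `|complex.Im z|.
Proof.
rewrite normc_sqrt -(@ler_pXn2r _ 2)// ?nnegrE ?sqrtr_ge0 ?addr_ge0//.
rewrite sqr_sqrtr ?addr_ge0 ?sqr_ge0// sqrrD !real_normK ?num_real//.
have : 0 <= `|complex.Re z| * `|complex.Im z| *+ 2 by rewrite mulrn_wge0 ?mulr_ge0.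
by lra.
Qed.

Lemma ReB z w : complex.Re (z - w) = complex.Re z - complex.Re w.
Proof. by case: z w => ? ? []. Qed.

Lemma ImB z w : complex.Im (z - w) = complex.Im z - complex.Im w.
Proof. by case: z w => ? ? []. Qed.

Lemma Re_mul z w : complex.Re (z * w) =
  complex.Re z * complex.Re w - complex.Im z * complex.Im w.
Proof. by case: z => a b; case: w. Qed.

Lemma Im_mul z w : complex.Im (z * w) =
  complex.Re z * complex.Im w + complex.Im z * complex.Re w.
Proof. by case: z => a b; case: w => c d /=; rewrite addrC. Qed.

Lemma Re_real_mul x z : complex.Re (x%:C%C * z) = x * complex.Re z.
Proof. by rewrite Re_mul/= mul0r subr0. Qed.

Lemma Im_real_mul x z : complex.Im (x%:C%C * z) = x * complex.Im z.
Proof. by rewrite Im_mul/= mul0r addr0. Qed.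

Lemma complex_ext z w : complex.Re z = complex.Re w -> complex.Im z = complex.Im w -> z = w.
Proof. by case: z w => a b [c d] /= -> ->. Qed.

Lemma Re_cexp z : complex.Re (cexp z) = expR (complex.Re z) * cos (complex.Im z).
Proof. by rewrite /cexp Re_real_mul. Qed.

Lemma Im_cexp z : complex.Im (cexp z) = expR (complex.Re z) * sin (complex.Im z).
Proof. by rewrite /cexp Im_real_mul. Qed.

Lemma cexpD z w : cexp (z + w) = cexp z * cexp w.
Proof.
by apply: complex_ext; rewrite ?Re_mul ?Im_mul ?Re_cexp ?Im_cexp ?Re_cexp !raddfD/= expRD ?cosD ?sinD; ring.
Qed.

Lemma normc_cexp z : normc (cexp z) = expR (complex.Re z).
Proof.
rewrite normc_sqrt Re_cexp Im_cexp !exprMn -mulrDr cos2Dsin2 mulr1 sqrtr_sqr.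
by rewrite ger0_norm// expR_ge0.
Qed.

Lemma abs_sin_le x : `|sin x| <= `|x|.
Proof.
have := cos_lipschitz (x - pi / 2) (- (pi / 2)).
rewrite cosN cos_pihalf subr0 (_ : x - pi / 2 - - (pi / 2) = x); last ring.
by rewrite cosB cos_pihalf sin_pihalf mulr0 add0r mulr1.
Qed.

Lemma cexp_taylor2 x y : 0 <= x -> 0 <= y ->
  normc (cexp (x +i* y)%C - 1 - (x +i* y)%C) <= expR x * (x + y) ^+ 2.
Proof.
move=> x0 y0; apply: (le_trans (normc_le _)).
rewrite !ReB !ImB Re_cexp Im_cexp /= subr0.
have e1 : 1 + x <= expR x by exact: expR_ge1Dx.
have e2 : expR x * (1 - x) <= 1.
  rewrite -ler_pdivlMl ?expR_gt0// mulr1 -expRN; exact: expR_ge1Dx.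
have ex0 := expR_gt0 x; have sl := abs_sin_le y.
have hs : `|sin y| <= y by rewrite (le_trans sl)// ger0_norm.
have c1 : `|cos y - 1| <= y ^+ 2 / 2.
  have -> : cos y - 1 = - (2 * sin (y / 2) ^+ 2).
    rewrite [in cos y](_ : y = (y / 2) *+ 2); last by rewrite -mulr_natr; field.
    by rewrite cos_mulr2n cos2sin2 -mulr_natr; ring.
  rewrite normrN normrM normrX [`|2|]ger0_norm//.
  have := abs_sin_le (y / 2); rewrite [X in _ <= X]ger0_norm ?divr_ge0// => h.
  have : `|sin (y / 2)| ^+ 2 <= (y / 2) ^+ 2 by rewrite lerXn2r ?nnegrE ?divr_ge0.
  by rewrite expr_div_n; lra.
have s1 : `|sin y - y| <= y ^+ 2 / 2.
  have h1 (t : R) : 0 <= t <= y -> is_derive t 1 (fun t : R => t - sin t) (1 - cos t).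
    by move=> _; derive_with; ring.
  have h2 (t : R) : 0 <= t <= y -> is_derive t 1 (fun t : R => t ^+ 2 / 2 - t + sin t) (t - (1 - cos t)).
    by move=> _; derive_with; field.
  rewrite distrC ler_norml; apply/andP; split.
    have := is_derive_ge0_le_cc y0 h1 => /(_ _); rewrite sin0 subr0 => h.
    have : 0 <= y - sin y by apply: h => t _; rewrite subr_ge0; case/andP: (cos_le1 t).
    by have := sqr_ge0 y; lra.
  have := is_derive_ge0_le_cc y0 h2 => /(_ _); rewrite sin0 expr0n mul0r subr0 addr0 => h.
  have : 0 <= y ^+ 2 / 2 - y + sin y.
    apply: h => t /andP[t0 _]; have := cos_lipschitz 0 t; rewrite cos0 sub0r normrN (ger0_norm (ltW t0)).
    by have := ler_norm (1 - cos t); lra.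
  by lra.
have r1 : `|expR x * cos y - 1 - x| <= expR x * (y ^+ 2 / 2) + x * (x * expR x).
  rewrite (_ : _ - _ - _ = expR x * (cos y - 1) + (expR x - 1 - x)); last ring.
  apply: (le_trans (ler_normD _ _)); apply: lerD.
    by rewrite normrM (gtr0_norm ex0) ler_pM2l.
  rewrite ger0_norm; last lra.
  have : expR x - 1 - x <= x * (expR x - 1) by lra.
  move=> h; apply: (le_trans h); rewrite ler_wpM2l//; lra.
have i1 : `|expR x * sin y - y| <= x * expR x * y + y ^+ 2 / 2.
  rewrite (_ : _ - _ = (expR x - 1) * sin y + (sin y - y)); last ring.
  apply: (le_trans (ler_normD _ _)); apply: lerD => //; rewrite normrM.
  by apply: ler_pM => //; rewrite ger0_norm; lra.
have : y ^+ 2 / 2 * 1 <= y ^+ 2 / 2 * expR x.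
  by rewrite ler_wpM2l ?divr_ge0 ?sqr_ge0//; lra.
have : 0 <= expR x * (x * y) by rewrite !mulr_ge0// ltW.
by lra.
Qed.

Lemma cvgn_summable_increments (e u : nat -> R) (B : R) : (forall k, 0 <= e k) -> cvgn e ->
  0 <= B -> (forall k, `|u k| <= B) -> (forall k, `|u k.+1 - u k| <= B * (e k - e k.+1)) ->
  cvgn u.
Proof.
move=> e0 ce B0 uB du.
have : cvgn (fun k => u k - B * e k).
  apply: nondecreasing_is_cvgn.
    apply/nondecreasing_seqP => k; have := du k; rewrite ler_norml => /andP[+ _]; lra.
  exists B => _ [k _ <-]; have := uB k; rewrite ler_norml => /andP[_ h].
  by have := mulr_ge0 B0 (e0 k); lra.
move=> cv; rewrite (_ : u = (fun k => u k - B * e k) \+ (fun k => B * e k)); last first.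
  by apply/funext => k /=; ring.
by apply: is_cvgD => //; apply: is_cvgMr.
Qed.

(** A sequence of complex numbers whose successive ratios are [1 + O(1 / k^2)]
    is bounded, hence has summable increments. *)
Lemma cvgn_ratio (g : nat -> R[i]) (C : R) : 0 <= C ->
  (forall k, (0 < k)%N -> normc (g k.+1 - g k) <= C / k%:R ^+ 2 * normc (g k)) ->
  cvgn (fun k => complex.Re (g k)) /\ cvgn (fun k => complex.Im (g k)).
Proof.
move=> C0 hg; pose h k := g k.+2; pose e (k : nat) : R := C * k.+1%:R^-1.
have e0 k : 0 <= e k by rewrite mulr_ge0// invr_ge0.
have ce : cvgn e by apply: is_cvgMr; apply/cvg_ex; exists 0; exact: cvg_harmonic.
have hh k : normc (h k.+1 - h k) <= (e k - e k.+1) * normc (h k).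
  apply: (le_trans (hg k.+2 isT)); rewrite ler_wpM2r ?normc_ge0//.
  have k0 : 0 <= k%:R :> R by [].
  rewrite /e -!natr1 -mulrBr ler_wpM2l//.
  rewrite (_ : _ - _ = (k%:R + 1 + 1) ^- 2 * ((k%:R + 1 + 1) / (k%:R + 1))); last first.
    by field; rewrite !gt_eqF//; lra.
  rewrite ler_peMr ?invr_ge0 ?sqr_ge0// ler_pdivlMr ?mul1r; lra.
have de k : e k.+1 <= e k by rewrite /e ler_wpM2l// lef_pV2 ?posrE// ler_nat.
pose b k := normc (h k) * expR (e k).
have bS k : b k.+1 <= b k.
  have : normc (h k.+1) <= normc (h k) * expR (e k - e k.+1).
    have -> : h k.+1 = h k + (h k.+1 - h k) by ring.
    apply: (le_trans (le_normcD _ _)).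
    apply: (@le_trans _ _ (normc (h k) * (1 + (e k - e k.+1)))).
      by rewrite mulrDr mulr1 lerD2l mulrC hh.
    by rewrite ler_wpM2l ?normc_ge0// expR_ge1Dx.
  move=> H; rewrite /b; apply: (@le_trans _ _ (normc (h k) * expR (e k - e k.+1) * expR (e k.+1))).
    by rewrite ler_wpM2r ?expR_ge0.
  by rewrite -mulrA -expRD subrK.
have b0 k : b k <= b 0%N by elim: k => // k IH; exact: le_trans IH.
have B0 : 0 <= b 0%N by rewrite mulr_ge0 ?normc_ge0 ?expR_ge0.
have hb k : normc (h k) <= b 0%N.
  apply: le_trans (b0 k); rewrite -[leLHS]mulr1 ler_wpM2l ?normc_ge0//.
  by rewrite (le_trans _ (expR_ge1Dx _))// lerDl.
have dh k : normc (h k.+1 - h k) <= b 0%N * (e k - e k.+1).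
  by apply: (le_trans (hh k)); rewrite mulrC ler_wpM2r// subr_ge0.
have shift (u : nat -> R) : cvgn (fun k => u k.+2) -> cvgn u.
  by move=> /cvg_ex[l ul]; apply/cvg_ex; exists l; move: ul; rewrite (cvg_shiftS (fun k => u k.+1)) cvg_shiftS.
split; apply: shift.
  rewrite (_ : (fun _ => _) = fun k => complex.Re (h k)); last first.
    by [].
  apply: (cvgn_summable_increments e0 ce B0) => k.
    exact: le_trans (abs_Re_le _) (hb k).
  by rewrite -ReB; exact: le_trans (abs_Re_le _) (dh k).
rewrite (_ : (fun _ => _) = fun k => complex.Im (h k)); last first.
  by [].
apply: (cvgn_summable_increments e0 ce B0) => k.
  exact: le_trans (abs_Im_le _) (hb k).
by rewrite -ImB; exact: le_trans (abs_Im_le _) (dh k).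
Qed.

End ComplexEstimates.

Section GammaFunction.
Context {R : realType}.
Local Notation normc := (@Normc.normc R).
Implicit Types (z w : R[i]) (x y : R).

Lemma natC k : k%:R = (k%:R : R)%:C%C :> R[i].
Proof. by rewrite rmorph_nat. Qed.

Lemma Gamma_seqS z k : (0 < k)%N -> Gamma_seq z k.+1 =
  Gamma_seq z k * (cexp ((ln (1 + k%:R^-1))%:C%C * z) * (k.+1%:R / (z + k.+1%:R))).
Proof.
move=> k0; have kR : 0 < k%:R :> R by rewrite ltr0n.
rewrite /Gamma_seq big_ord_recr/= factS natrM invfM.
have -> : cpow k.+1%:R z = cpow k%:R z * cexp ((ln (1 + k%:R^-1 : R))%:C%C * z).
  have lnE : ln k.+1%:R = ln k%:R + ln (1 + k%:R^-1) :> R.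
    rewrite -lnM ?posrE ?addr_gt0 ?invr_gt0//; congr ln.
    by rewrite -natr1; field; rewrite gt_eqF.
  by rewrite /cpow -cexpD -mulrDl -rmorphD lnE.
by ring.
Qed.

(** The ratio of two consecutive terms of Euler's product is
    [(1 + 1 / k)^z (1 + z / (k + 1))^-1 = 1 + O(1 / k^2)]. *)
Lemma is_cvg_Gamma_seq x y : 0 <= x -> 0 < y ->
  cvgn (fun k => complex.Re (Gamma_seq (x +i* y)%C k)) /\
  cvgn (fun k => complex.Im (Gamma_seq (x +i* y)%C k)).
Proof.
move=> x0 y0; pose z := (x +i* y)%C.
pose C := expR x * (x + y) ^+ 2 + (x + y).
have E0 : 0 <= expR x * (x + y) ^+ 2 by rewrite mulr_ge0 ?expR_ge0 ?sqr_ge0.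
have C0 : 0 <= C by rewrite /C; lra.
apply: (@cvgn_ratio _ _ C C0) => k k0; rewrite -/z Gamma_seqS//.
have kR : 1 <= k%:R :> R by rewrite ler1n.
have kR0 : 0 < k%:R :> R by rewrite ltr0n.
set w := cexp _ * _; rewrite (_ : _ - _ = (w - 1) * Gamma_seq z k); last by ring.
rewrite Normc.normcM ler_wpM2r ?normc_ge0//.
pose L : R := ln (1 + k%:R^-1).
have ki0 : 0 < k%:R^-1 :> R by rewrite invr_gt0.
have L0 : 0 <= L by rewrite ln_ge0// lerDl ltW.
have L1 : L <= k%:R^-1.
  by rewrite -[leRHS]expRK ler_ln ?posrE ?expR_gt0 ?expR_ge1Dx// addr_gt0.
have ki1 : k%:R^-1 <= 1 :> R by rewrite invf_le1.
have L2 : 1 <= k.+1%:R * L.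
  have := expR_ge1Dx (- L); rewrite expRN lnK ?posrE ?addr_gt0//.
  have -> : (1 + k%:R^-1)^-1 = 1 - k.+1%:R^-1 :> R.
    by rewrite -natr1; field; rewrite !gt_eqF// addr_gt0.
  rewrite lerD2l lerN2.
  by rewrite -[k.+1%:R^-1]mul1r ler_pdivrMr// mulrC.
have L3 : k.+1%:R * L <= 1 + k%:R^-1.
  apply: (@le_trans _ _ (k.+1%:R * k%:R^-1)); first by rewrite ler_wpM2l.
  by rewrite -natr1 mulrDl mul1r divff// gt_eqF.
have den : k.+1%:R <= normc (z + k.+1%:R).
  apply: le_trans (abs_Re_le _); rewrite natC [complex.Re _](_ : _ = x + k.+1%:R)//.
  by rewrite ger0_norm ?addr_ge0// lerDr.
have den0 : 0 < normc (z + k.+1%:R) by rewrite (lt_le_trans _ den).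
have nz : z + k.+1%:R != 0.
  by apply: contraTneq den0 => ->; rewrite Normc.normc0 ltxx.
have -> : w - 1 = (k.+1%:R * (cexp (L%:C%C * z) - 1 - L%:C%C * z)
    + (k.+1%:R * L - 1)%:C%C * z) / (z + k.+1%:R).
  rewrite /w -/L rmorphB rmorphM rmorph1 rmorph_nat.
  apply: (mulIf nz); rewrite divfK// mulrBl mul1r mulrA divfK//.
  by ring.
rewrite Normc.normcM Normc.normcV ler_pdivrMr//.
apply: (@le_trans _ _ (C / k%:R ^+ 2 * k.+1%:R)); last first.
  by rewrite ler_wpM2l// divr_ge0// exprn_ge0.
apply: (le_trans (le_normcD _ _)); rewrite /C mulrDl mulrDl; apply: lerD.
  rewrite Normc.normcM natC normc_real normr_nat.
  have -> : L%:C%C * z = (L * x +i* (L * y))%C by apply: complex_ext; rewrite ?Re_real_mul ?Im_real_mul.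
  rewrite [leRHS]mulrC ler_wpM2l//.
  apply: (le_trans (cexp_taylor2 _ _)); rewrite ?mulr_ge0 ?(ltW y0)//.
  rewrite -mulrA; apply: ler_pM; rewrite ?expR_ge0 ?sqr_ge0//.
    by rewrite ler_expR ler_piMl// (le_trans L1).
  rewrite -mulrDr exprMn mulrC ler_wpM2l ?sqr_ge0// -exprVn.
  by rewrite lerXn2r ?nnegrE// ltW.
rewrite Normc.normcM normc_real ger0_norm ?subr_ge0//.
have nz2 : normc z <= x + y.
  by apply: (le_trans (normc_le _)); rewrite /= !ger0_norm// ltW.
apply: (@le_trans _ _ (k%:R^-1 * (x + y))).
  by apply: ler_pM; rewrite ?normc_ge0 ?subr_ge0//; lra.
rewrite (_ : _ / _ * _ = k%:R^-1 * (x + y) * (k.+1%:R / k%:R)); last first.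
  by field; rewrite gt_eqF.
rewrite ler_peMr ?mulr_ge0 ?addr_ge0// ?(ltW ki0) ?(ltW y0)//.
by rewrite ler_pdivlMr// mul1r ler_nat.
Qed.

Lemma cvg_normc_Gamma x y : 0 <= x -> 0 < y ->
  normc (Gamma_seq (x +i* y)%C k) @[k --> \oo] --> normc (Gamma (x +i* y)%C).
Proof.
move=> x0 y0; have [cR cI] := is_cvg_Gamma_seq x0 y0.
rewrite (_ : (fun k => _) = fun k => Num.sqrt (complex.Re (Gamma_seq (x +i* y)%C k) ^+ 2 +
    complex.Im (Gamma_seq (x +i* y)%C k) ^+ 2)); last first.
  by apply/funext => k; rewrite normc_sqrt.
have h : (complex.Re (Gamma_seq (x +i* y)%C k) ^+ 2 +
    complex.Im (Gamma_seq (x +i* y)%C k) ^+ 2) @[k --> \oo] -->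
    complex.Re (Gamma (x +i* y)%C) ^+ 2 + complex.Im (Gamma (x +i* y)%C) ^+ 2.
  apply: cvgD; under eq_fun do rewrite expr2; rewrite expr2; exact: cvgM.
by rewrite normc_sqrt; apply: cvg_comp h (@sqrt_continuous _ _).
Qed.

Definition modulus x y : R := Num.sqrt (x ^+ 2 + y ^+ 2).

Lemma modulus_gt0 x y : 0 < y -> 0 < modulus x y.
Proof. by move=> y0; rewrite sqrtr_gt0 ltr_wpDl ?sqr_ge0// exprn_gt0. Qed.

Lemma normc_Gamma_seq x y k : (0 < k)%N -> normc (Gamma_seq (x +i* y)%C k) =
  k`!%:R * k%:R `^ x / \prod_(j < k.+1) modulus (x + j%:R) y.
Proof.
move=> k0; rewrite /Gamma_seq Normc.normcM Normc.normcV Normc.normcM natC normc_real normr_nat.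
congr (_ * _ / _).
  rewrite /cpow normc_cexp Re_real_mul /powR pnatr_eq0 gtn_eqF// mulrC//.
rewrite (big_morph normc (@Normc.normcM R) (@Normc.normc1 R)); apply: eq_bigr => j _.
by rewrite natC normc_sqrt/= addr0.
Qed.

(** With [h u = ln (u ^ 2 + y ^ 2) / 2] the increments of [h] over a step [g] and
    over a step [1] are proportional up to the variation of [h'], of order
    [1 / u ^ 2] uniformly in [y]; the increments over unit steps telescope. *)
Lemma log_modulus_step g u y : 0 <= g -> 0 < u -> 0 < y ->
  modulus u y / modulus (u + g) y <=
  (modulus u y / modulus (u + 1) y) `^ g * expR ((g + g ^+ 2) / 2 / u ^+ 2).
Proof.
move=> g0 u0 y0; pose h (v : R) := ln (v ^+ 2 + y ^+ 2) / 2; pose h' (v : R) := v / (v ^+ 2 + y ^+ 2).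
have pos v : 0 < v ^+ 2 + y ^+ 2 by rewrite ltr_wpDl ?sqr_ge0// exprn_gt0.
have mE v : modulus v y = expR (h v).
  by rewrite /modulus /h -powR12_sqrt ?ltW// /powR gt_eqF// mulrC.
have hd (v : R) : is_derive v 1 h (h' v).
  by rewrite /h /h'; derive_with => //; field; rewrite gt_eqF.
have dh (t : R) : 0 <= t -> `|h' (u + t) - h' u| <= t / u ^+ 2.
  move=> t0; rewrite /h' (_ : _ - _ = t / u ^+ 2 * (u ^+ 2 * (y ^+ 2 - u * (u + t)) /
      (((u + t) ^+ 2 + y ^+ 2) * (u ^+ 2 + y ^+ 2)))); last first.
    by field; rewrite !gt_eqF.
  have tu : 0 <= t / u ^+ 2 by rewrite divr_ge0 ?sqr_ge0.
  rewrite normrM (ger0_norm tu) ler_piMr//.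
  have P := mulr_gt0 (pos (u + t)) (pos u).
  rewrite normrM normfV (gtr0_norm P) ler_pdivrMr// mul1r ler_norml.
  have a1 : 0 <= u * t by rewrite mulr_ge0// ltW.
  have a2 : 0 <= u ^+ 2 * y ^+ 2 by rewrite mulr_ge0 ?sqr_ge0.
  have a3 : 0 <= y ^+ 2 * y ^+ 2 by rewrite mulr_ge0 ?sqr_ge0.
  have a4 : 0 <= (u * t) * u ^+ 2 by rewrite mulr_ge0 ?sqr_ge0.
  have a5 : 0 <= (u * t) ^+ 2 by rewrite sqr_ge0.
  have a6 : 0 <= (u * t) * y ^+ 2 by rewrite mulr_ge0 ?sqr_ge0.
  have a7 : 0 <= t ^+ 2 * y ^+ 2 by rewrite mulr_ge0 ?sqr_ge0.
  have a8 : 0 <= u ^+ 2 * u ^+ 2 by rewrite mulr_ge0 ?sqr_ge0.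
  by apply/andP; split; lra.
have hu (v : R) : is_derive v 1 (fun v => h (u + v)) (h' (u + v)).
  have e : is_derive v 1 (fun v : R => u + v) 1 by derive_with; ring.
  by have := dcomp (hd (u + v)) e; rewrite mulr1.
have up (t : R) : 0 <= t -> `|h (u + t) - h u - t * h' u| <= t ^+ 2 / 2 / u ^+ 2.
  move=> t0.
  have d1 (v : R) : 0 <= v <= t -> is_derive v 1
      (fun v => h (u + v) - h u - v * h' u + v ^+ 2 / 2 / u ^+ 2) (h' (u + v) - h' u + v / u ^+ 2).
    by move=> _; have := hu v => ?; derive_with; field; rewrite gt_eqF.
  have d2 (v : R) : 0 <= v <= t -> is_derive v 1
      (fun v => - (h (u + v) - h u - v * h' u) + v ^+ 2 / 2 / u ^+ 2) (- (h' (u + v) - h' u) + v / u ^+ 2).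
    by move=> _; have := hu v => ?; derive_with; field; rewrite gt_eqF.
  have := is_derive_ge0_le_cc t0 d1 => /(_ _) /=; have := is_derive_ge0_le_cc t0 d2 => /(_ _) /=.
  rewrite addr0 subrr expr0n !mul0r subr0 oppr0 addr0 => h2 h1.
  rewrite ler_norml; apply/andP; split.
    suff : 0 <= h (u + t) - h u - t * h' u + t ^+ 2 / 2 / u ^+ 2 by lra.
    by apply: h1 => v /andP[v0 _]; have := dh v (ltW v0); rewrite ler_norml => /andP[]; lra.
  suff : 0 <= - (h (u + t) - h u - t * h' u) + t ^+ 2 / 2 / u ^+ 2 by lra.
  by apply: h2 => v /andP[v0 _]; have := dh v (ltW v0); rewrite ler_norml => /andP[]; lra.
rewrite !mE -!expRB /powR gt_eqF ?expR_gt0// expRK -expRD ler_expR.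
have := up g g0; rewrite ler_norml => /andP[H1 _].
have := up 1 ler01; rewrite ler_norml => /andP[_ H2].
have : g * (h (u + 1) - h u - 1 * h' u) <= g * (1 ^+ 2 / 2 / u ^+ 2) by rewrite ler_wpM2l.
rewrite expr1n => H3; have -> : (g + g ^+ 2) / 2 / u ^+ 2 = g * (1 / 2 / u ^+ 2) + g ^+ 2 / 2 / u ^+ 2.
  by field; rewrite gt_eqF.
by lra.
Qed.

(** Only the factors with [j >= 1] are compared by [log_modulus_step]; the factor
    [j = 0] is at most [1], which also covers the case [d = 0]. *)
Lemma shifted_product_le d g : 0 <= d -> 0 <= g -> exists2 C, 0 < C & forall y k,
  0 < y -> (0 < k)%N -> k%:R `^ g *
    \prod_(j < k.+1) (modulus (d + j%:R) y / modulus (d + g + j%:R) y) <= C * (1 + y) `^ g.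
Proof.
move=> d0 g0; pose c := g + g ^+ 2; have c0 : 0 <= c by rewrite addr_ge0 ?sqr_ge0.
exists ((d + 1) `^ g * expR (2 * c)); first by rewrite mulr_gt0 ?expR_gt0// powR_gt0//; lra.
move=> y k y0 k0; have mp u := modulus_gt0 u y0.
pose E k := (modulus (d + 1) y / modulus (d + k.+1%:R) y) `^ g * expR (c * (2 - k.+1%:R^-1)).
have prodE : \prod_(j < k.+1) (modulus (d + j%:R) y / modulus (d + g + j%:R) y) <= E k.
  elim: k {k0} => [|k IH].
    rewrite big_ord1 /E divff ?gt_eqF// powR1 mul1r !addr0 invr1.
    apply: (@le_trans _ _ 1); last by rewrite -[leLHS]expR0 ler_expR mulr_ge0//; lra.
    rewrite ler_pdivrMr// mul1r ler_wsqrtr// lerD2r lerXn2r ?nnegrE ?addr_ge0// lerDl//.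
  rewrite big_ord_recr/=; have u0 : 0 < d + k.+1%:R by rewrite ltr_wpDl.
  have st := log_modulus_step g0 u0 y0.
  apply: (@le_trans _ _ (E k * ((modulus (d + k.+1%:R) y / modulus (d + k.+1%:R + 1) y) `^ g *
      expR (c / 2 / (d + k.+1%:R) ^+ 2)))).
    apply: ler_pM => //.
    - by apply: prodr_ge0 => j _; rewrite divr_ge0 ?sqrtr_ge0.
    - by rewrite divr_ge0 ?sqrtr_ge0.
    - by rewrite addrAC.
  rewrite /E mulrACA -powRM ?divr_ge0 ?sqrtr_ge0// -expRD.
  have -> : modulus (d + 1) y / modulus (d + k.+1%:R) y *
     (modulus (d + k.+1%:R) y / modulus (d + k.+1%:R + 1) y) =
     modulus (d + 1) y / modulus (d + k.+2%:R) y.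
    rewrite -addrA natr1; field; rewrite !gt_eqF//.
  rewrite ler_wpM2l ?powR_ge0// ler_expR -[X in _ + X]mulrA -mulrDr ler_wpM2l//.
  have kp : 0 < k.+1%:R :> R by [].
  have h1 : (d + k.+1%:R) ^- 2 <= k.+1%:R ^- 2.
    by rewrite lef_pV2 ?posrE ?exprn_gt0// lerXn2r ?nnegrE ?(ltW u0)// lerDr.
  have h2 : k.+1%:R ^- 2 / 2 <= k.+1%:R^-1 - k.+2%:R^-1 :> R.
    rewrite -[k.+2%:R]natr1; set t := k.+1%:R.
    have t1 : 1 <= t by rewrite ler1n.
    rewrite (_ : _ - _ = t ^- 2 * (t / (t + 1))); last by field; rewrite !gt_eqF//; lra.
    by rewrite ler_wpM2l ?invr_ge0 ?sqr_ge0// ler_pdivlMr; lra.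
  move: h1 h2; move: (k.+1%:R^-1) (k.+2%:R^-1) (k.+1%:R ^- 2) ((d + k.+1%:R) ^- 2) => A B D F h1 h2.
  lra.
apply: (@le_trans _ _ (k%:R `^ g * E k)); first by rewrite ler_wpM2l ?powR_ge0.
rewrite /E mulrA -powRM ?divr_ge0 ?sqrtr_ge0// mulrAC -powRM; [|lra|lra].
apply: ler_pM; rewrite ?powR_ge0 ?expR_ge0//; last first.
  by rewrite ler_expR mulrC ler_wpM2r// gerBl.
apply: ge0_ler_powR => //; rewrite ?nnegrE; [by rewrite mulr_ge0 ?divr_ge0 ?sqrtr_ge0|by rewrite mulr_ge0; lra|].
rewrite mulrA ler_pdivrMr//.
have m1 : modulus (d + 1) y <= (d + 1) * (1 + y).
  have P : 0 <= (d + 1) * (1 + y) by rewrite mulr_ge0; lra.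
  rewrite -(@ler_pXn2r _ 2)// ?nnegrE ?sqrtr_ge0// sqr_sqrtr ?addr_ge0 ?sqr_ge0//.
  have a : 0 <= d * y by rewrite mulr_ge0// ltW.
  have b : 0 <= d * d by rewrite mulr_ge0.
  have e : 0 <= d * y * y by rewrite mulr_ge0// ltW.
  have f : 0 <= d * d * y by rewrite mulr_ge0// ltW.
  have f' : 0 <= d * d * y * y by rewrite mulr_ge0// ltW.
  lra.
have m2 : k%:R <= modulus (d + k.+1%:R) y.
  have P : 0 <= k%:R + 1 + d :> R by rewrite !addr_ge0.
  apply: (@le_trans _ _ (k%:R + 1 + d)); first lra.
  rewrite /modulus -[leLHS](ger0_norm P) -sqrtr_sqr ler_wsqrtr//.
  by rewrite addrC natr1 lerDl sqr_ge0.
by rewrite [leLHS]mulrC; apply: ler_pM => //; exact: sqrtr_ge0.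
Qed.

Definition wallis k : R := 4 ^+ k.+1 * k`!%:R ^+ 2 / (k.*2.+1)`!%:R.

(** Wallis' product, in the form of an exact monotonicity. *)
Lemma wallis_le k : wallis k ^+ 2 * k.+1%:R <= 16.
Proof.
elim: k => [|k IH]; first by rewrite /wallis !fact0 expr1 expr1n mulr1 divr1 mulr1; lra.
apply: le_trans IH; rewrite /wallis.
have f0 : 0 < (k.*2.+1)`!%:R :> R by rewrite ltr0n fact_gt0.
have kk : 0 <= k%:R :> R by [].
have -> : 4 ^+ k.+2 * k.+1`!%:R ^+ 2 / (k.+1.*2.+1)`!%:R =
   4 ^+ k.+1 * k`!%:R ^+ 2 / (k.*2.+1)`!%:R * ((k%:R + 1) / (k%:R + 3 / 2)) :> R.
  rewrite doubleS !factS !natrM -!natr1 -!muln2 natrM exprS.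
  by field; rewrite !gt_eqF//; lra.
set w := 4 ^+ k.+1 * _ / _.
rewrite -[k.+2%:R]natr1 -[k.+1%:R]natr1 exprMn -mulrA ler_wpM2l ?sqr_ge0//.
rewrite expr_div_n mulrAC ler_pdivrMr ?exprn_gt0//; lra.
Qed.

Lemma prod_modulus_double y k : \prod_(j < k.*2.+2) modulus j%:R (2 * y) =
  4 ^+ k.+1 * \prod_(j < k.+1) (modulus j%:R y * modulus (2^-1 + j%:R) y).
Proof.
have dbl u : modulus (2 * u) (2 * y) = 2 * modulus u y.
  rewrite /modulus !exprMn -mulrDr sqrtrM ?sqr_ge0// sqrtr_sqr ger0_norm//.
have E j : modulus (j.*2)%:R (2 * y) * modulus (j.*2.+1)%:R (2 * y) =
    4 * (modulus j%:R y * modulus (2^-1 + j%:R) y).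
  have -> : (j.*2.+1)%:R = 2 * (2^-1 + j%:R) :> R by rewrite -natr1 -muln2 natrM; field.
  have -> : (j.*2)%:R = 2 * j%:R :> R by rewrite -muln2 natrM mulrC.
  by rewrite !dbl; ring.
elim: k => [|k IH].
  by rewrite big_ord_recr big_ord1 big_ord1 /= (E 0%N) expr1.
by rewrite doubleS big_ord_recr big_ord_recr/= IH -mulrA (E k.+1) [in RHS]big_ord_recr/= [in RHS]exprS; ring.
Qed.

(** Term by term in Euler's product, [|Gamma (g1 + i y) Gamma (1 / 2 + g2 + i y)|] is
    [|Gamma (2 i y)|] (by the duplication of the factors) times two shifted products. *)
Lemma Gamma_ratio_le g1 g2 : 0 <= g1 -> 0 <= g2 -> exists2 C, 0 < C & forall y, 0 < y ->
  normc (Gamma (g1 +i* y)%C) * normc (Gamma ((2^-1 + g2) +i* y)%C) <=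
  C * (1 + y) `^ (g1 + g2) * normc (Gamma (0 +i* (2 * y))%C).
Proof.
move=> g10 g20; have half0 : 0 <= 2^-1 :> R by rewrite invr_ge0.
have [C1 C10 h1] := shifted_product_le (lexx 0) g10.
have [C2 C20 h2] := shifted_product_le half0 g20.
exists (4 * (C1 * C2)); first by rewrite !mulr_gt0.
move=> y y0; have y20 : 0 < 2 * y by rewrite mulr_gt0.
have a0 : 0 <= 2^-1 + g2 by rewrite addr_ge0.
have c1 := cvg_normc_Gamma g10 y0; have c2 := cvg_normc_Gamma a0 y0.
have c3 := cvg_normc_Gamma (lexx 0) y20.
have c3' : normc (Gamma_seq (0 +i* (2 * y))%C k.*2.+1) @[k --> \oo] -->
    normc (Gamma (0 +i* (2 * y))%C).
  apply: (cvg_comp (fun k => k.*2.+1) (fun k => normc (Gamma_seq (0 +i* (2 * y))%C k)) _ c3).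
  move=> A [N _ hN]; exists N => //= k /= Nk; apply: hN => /=.
  by rewrite -addnn ltnW// ltnS (leq_trans Nk)// leq_addr.
set K := 4 * (C1 * C2) * _.
have c12 : (normc (Gamma_seq (g1 +i* y)%C k) * normc (Gamma_seq ((2^-1 + g2) +i* y)%C k))
    @[k --> \oo] --> normc (Gamma (g1 +i* y)%C) * normc (Gamma ((2^-1 + g2) +i* y)%C).
  exact: cvgM c1 c2.
have c33 : (K * normc (Gamma_seq (0 +i* (2 * y))%C k.*2.+1)) @[k --> \oo] -->
    K * normc (Gamma (0 +i* (2 * y))%C).
  exact: cvgM (cvg_cst K) c3'.
apply: (ler_cvg_to c12 c33); rewrite /K.
exists 1%N => //= k /= k0.
rewrite !normc_Gamma_seq// powRr0 mulr1.
under [in X in _ <= X]eq_bigr do rewrite add0r.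
rewrite prod_modulus_double.
rewrite big_split/=.
set P1 := \prod_(j < k.+1) modulus j%:R y.
set P2 := \prod_(j < k.+1) modulus (2^-1 + j%:R) y.
set A := \prod_(j < k.+1) modulus (g1 + j%:R) y.
set B := \prod_(j < k.+1) modulus (2^-1 + g2 + j%:R) y.
have mp u := modulus_gt0 u y0.
have A0 : 0 < A by apply: prodr_gt0.
have B0 : 0 < B by apply: prodr_gt0.
have P10 : 0 < P1 by apply: prodr_gt0.
have P20 : 0 < P2 by apply: prodr_gt0.
have kR : 0 < k%:R :> R by rewrite ltr0n.
have := h2 y k y0 k0; rewrite prodf_div -/P2 -/B.
have := h1 y k y0 k0; rewrite (eq_bigr (fun j : 'I_k.+1 => modulus j%:R y / modulus (g1 + j%:R) y)); last first.
  by move=> j _; rewrite !add0r.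
rewrite prodf_div -/P1 -/A => H1 H2.
have f0 : 0 < (k.*2.+1)`!%:R :> R by rewrite ltr0n fact_gt0.
have W : wallis k * k%:R `^ 2^-1 <= 4.
  have w0 : 0 <= wallis k by rewrite divr_ge0 ?mulr_ge0 ?exprn_ge0.
  rewrite -(@ler_pXn2r _ 2)// ?nnegrE ?mulr_ge0 ?powR_ge0// exprMn.
  rewrite powR12_sqrt ?sqr_sqrtr ?ler0n//.
  apply: (@le_trans _ _ 16); last lra.
  by apply: le_trans (wallis_le k); rewrite ler_wpM2l ?sqr_ge0// ler_nat.
have four : 0 < 4 ^+ k.+1 :> R by rewrite exprn_gt0.
have y10 : 1 + y != 0 by rewrite gt_eqF; lra.
rewrite [k%:R `^ (_ + _)]powRD; last by rewrite (gt_eqF kR) implybT.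
rewrite [(1 + y) `^ (_ + _)]powRD; last by rewrite y10 implybT.
rewrite [leLHS](_ : _ = (wallis k * k%:R `^ 2^-1) * ((k%:R `^ g1 * (P1 / A)) * (k%:R `^ g2 * (P2 / B))) *
   ((k.*2.+1)`!%:R / (4 ^+ k.+1 * (P1 * P2)))); last first.
  by rewrite /wallis; field; rewrite !gt_eqF.
rewrite ler_pM2r; last by rewrite divr_gt0// !mulr_gt0.
rewrite [leRHS](_ : _ = 4 * ((C1 * (1 + y) `^ g1) * (C2 * (1 + y) `^ g2))); last by ring.
apply: ler_pM => //.
- by rewrite mulr_ge0 ?powR_ge0// divr_ge0 ?mulr_ge0 ?exprn_ge0.
- by rewrite !mulr_ge0 ?powR_ge0 ?invr_ge0// ltW.
by apply: ler_pM => //; rewrite mulr_ge0 ?powR_ge0 ?divr_ge0// ltW.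
Qed.

End GammaFunction.

(** * The Plancherel density *)

Section Plancherel.
Context {R : realType} (n : htype R).
Local Notation normc := (@Normc.normc R).
Local Notation p := (dim_v n).
Local Notation q := (dim_z n).
Local Notation m := (p + q)%N.
Local Notation Q := (Qdim n).
Implicit Types (z w : R[i]) (x y l : R).

Definition cmeasurable (D : set R) (g : R -> R[i]) :=
  measurable_fun D (fun l => complex.Re (g l)) /\ measurable_fun D (fun l => complex.Im (g l)).

Lemma cmeasurable_mul D f g : cmeasurable D f -> cmeasurable D g ->
  cmeasurable D (fun l => f l * g l).
Proof.
move=> [fR fI] [gR gI]; split.
  under eq_fun do rewrite Re_mul.
  by apply: measurable_funB; apply: measurable_funM.
under eq_fun do rewrite Im_mul.
by apply: measurable_funD; apply: measurable_funM.
Qed.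

Lemma measurable_inv (D : set R) (f : R -> R) : measurable_fun D f ->
  measurable_fun D (fun l => (f l)^-1).
Proof.
move=> mf; apply: (@measurableT_comp _ _ _ _ _ _ (fun x : R => x^-1)) => //.
(* [x^-1 = x (x^2)^(-1)] and real powers are measurable *)
rewrite (_ : (fun x : R => x^-1) = fun x => x * (x ^+ 2) `^ (-1)); last first.
  apply/funext => x; rewrite powR_inv1 ?sqr_ge0//.
  have [->|x0] := eqVneq x 0; first by rewrite mul0r invr0.
  by field.
apply: measurable_funM => //.
by apply: (@measurableT_comp _ _ _ _ _ _ (fun x : R => x `^ (-1))) => //; exact: measurable_funX.
Qed.

Lemma cmeasurable_inv D f : cmeasurable D f -> cmeasurable D (fun l => (f l)^-1).
Proof.
move=> [fR fI].
have m2 : measurable_fun D (fun l => (complex.Re (f l) ^+ 2 + complex.Im (f l) ^+ 2)^-1).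
  by apply: measurable_inv; apply: measurable_funD; apply: measurable_funX.
split.
  rewrite (_ : (fun l => _) = fun l => complex.Re (f l) *
      (complex.Re (f l) ^+ 2 + complex.Im (f l) ^+ 2)^-1); last first.
    by apply/funext => l; case: (f l).
  exact: measurable_funM.
rewrite (_ : (fun l => _) = fun l => - (complex.Im (f l) *
    (complex.Re (f l) ^+ 2 + complex.Im (f l) ^+ 2)^-1)); last first.
  by apply/funext => l; case: (f l).
by apply: measurableT_comp => //; exact: measurable_funM.
Qed.

Lemma cmeasurable_cst D z : cmeasurable D (fun=> z).
Proof. by split; exact: measurable_cst. Qed.

Lemma cmeasurable_prod D k (f : nat -> R -> R[i]) : (forall j, cmeasurable D (f j)) ->
  cmeasurable D (fun l => \prod_(j < k) f j l).
Proof.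
move=> mf; elim: k => [|k IH].
  by under eq_fun do rewrite big_ord0; exact: cmeasurable_cst.
by under eq_fun do rewrite big_ord_recr; exact: cmeasurable_mul.
Qed.

Lemma cmeasurable_cexp D f : cmeasurable D f -> cmeasurable D (fun l => cexp (f l)).
Proof.
move=> [fR fI]; split.
  under eq_fun do rewrite Re_cexp; apply: measurable_funM.
    exact: measurableT_comp.
  exact: measurable_cosT.
under eq_fun do rewrite Im_cexp; apply: measurable_funM.
  exact: measurableT_comp.
by apply: measurableT_comp => //; apply: continuous_measurable_fun; exact: continuous_sin.
Qed.

Lemma cmeasurable_Gamma_seq D (z : R -> R[i]) k : cmeasurable D z ->
  cmeasurable D (fun l => Gamma_seq (z l) k).
Proof.
move=> mz; rewrite /Gamma_seq; apply: cmeasurable_mul.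
  apply: cmeasurable_mul; first exact: cmeasurable_cst.
  by apply: cmeasurable_cexp; apply: cmeasurable_mul => //; exact: cmeasurable_cst.
apply/cmeasurable_inv/(@cmeasurable_prod _ _ (fun j l => z l + j%:R)) => j.
case: mz => zR zI; rewrite natC; split.
  rewrite (_ : (fun l => _) = fun l => complex.Re (z l) + j%:R); last first.
    by apply/funext => l; case: (z l).
  by apply: measurable_funD.
rewrite (_ : (fun l => _) = fun l => complex.Im (z l) + 0); last first.
  by apply/funext => l; case: (z l).
by apply: measurable_funD.
Qed.

Lemma measurable_normc D f : cmeasurable D f -> measurable_fun D (fun l => normc (f l)).
Proof.
move=> [fR fI]; under eq_fun do rewrite normc_sqrt.
apply: (@measurableT_comp _ _ _ _ _ _ (@Num.sqrt R)).
  by apply: continuous_measurable_fun; exact: sqrt_continuous.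
by apply: measurable_funD; exact: measurable_funX.
Qed.

Lemma measurable_normc_Gamma x (c : R) : 0 <= x -> 0 < c ->
  measurable_fun (`]0, +oo[%classic : set R) (fun l : R => normc (Gamma (x +i* (c * l))%C)).
Proof.
move=> x0 c0.
apply: (@measurable_fun_cvg _ _ _ _ (fun k l => normc (Gamma_seq (x +i* (c * l))%C k))).
  move=> k; apply: measurable_normc; apply: cmeasurable_Gamma_seq; split => /=.
    exact: measurable_cst.
  by apply: measurable_funM.
move=> l; rewrite /= in_itv/= andbT => l0.
by apply: cvg_normc_Gamma => //; exact: mulr_gt0.
Qed.

Definition gamma_quotient l : R := normc (Gamma ((Q / 2) +i* l)%C) *
  normc (Gamma ((2^-1 + p%:R / 4) +i* l)%C) / normc (Gamma (0 +i* (2 * l))%C).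

(** The formula also holds when one of the Gamma values vanishes, since the inverse
    of [0] is [0]. *)
Lemma plancherelE l : plancherel n l =
  (expR (ln 2 * Q) * normc (Gamma ((dimS n)%:R / 2))) ^- 2 * gamma_quotient l ^+ 2.
Proof.
rewrite /plancherel /harish_chandra /gamma_quotient.
have two : (2 : R[i]) != 0 by rewrite pnatr_eq0.
have four : (4 : R[i]) != 0 by rewrite pnatr_eq0.
have il : 2 * (0 +i* l)%C = (0 +i* (2 * l))%C :> R[i].
  by rewrite natC; apply: complex_ext; rewrite ?Re_real_mul ?Im_real_mul/= ?mulr0.
have -> : (Q%:C%C + 2 * (0 +i* l)%C) / 2 = ((Q / 2) +i* l)%C :> R[i].
  apply: (mulIf two); rewrite divfK// il natC.
  by apply: complex_ext; rewrite ?Re_mul ?Im_mul/=; field.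
have -> : (p%:R + 4 * (0 +i* l)%C + 2) / 4 = ((2^-1 + p%:R / 4) +i* l)%C :> R[i].
  apply: (mulIf four); rewrite divfK// !natC.
  by apply: complex_ext; rewrite ?Re_mul ?Im_mul/=; field.
rewrite il; set c := cpow _ _; have <- : normc c = expR (ln 2 * Q).
  by rewrite /c /cpow normc_cexp Re_real_mul; congr (expR (_ * _)); rewrite /= subr0.
move: c (Gamma _) (Gamma _) (Gamma _) (Gamma _) => c g1 g2 g3 g4.
rewrite !Normc.normcM !Normc.normcV -!exprVn -exprMn; congr (_ ^+ 2).
by rewrite !invfM !invrK; ring.
Qed.

Lemma measurable_plancherel : measurable_fun (`]0, +oo[%classic : set R) (plancherel n).
Proof.
have Q0 := Qdim_gt0 n.
rewrite (_ : plancherel n = fun l => (expR (ln 2 * Q) * normc (Gamma ((dimS n)%:R / 2))) ^- 2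
    * gamma_quotient l ^+ 2); last by apply/funext => l; exact: plancherelE.
apply: measurable_funM => //; apply: measurable_funX.
have h x : 0 <= x -> measurable_fun (`]0, +oo[%classic : set R) (fun l : R => normc (Gamma (x +i* l)%C)).
  move=> x0; rewrite (_ : (fun l => _) = fun l => normc (Gamma (x +i* (1 * l))%C)).
    exact: measurable_normc_Gamma.
  by apply/funext => l; rewrite mul1r.
apply: measurable_funM; last by apply: measurable_inv; apply: measurable_normc_Gamma.
by apply: measurable_funM; apply: h; rewrite ?addr_ge0 ?divr_ge0// ltW.
Qed.

Lemma plancherel_ge0 l : 0 <= plancherel n l.
Proof. by rewrite plancherelE mulr_ge0 ?invr_ge0 ?sqr_ge0. Qed.

(** The shifts in [Gamma_ratio_le] are [Q / 2] and [dim_v / 4], whose sum is [m / 2]. *)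
Lemma plancherel_le : exists2 C, 0 < C & forall l, 0 < l -> plancherel n l <= C * (1 + l) ^+ m.
Proof.
have Q0 := Qdim_gt0 n.
have g1 : 0 <= Q / 2 by rewrite divr_ge0// ltW.
have g2 : 0 <= p%:R / 4 :> R by rewrite divr_ge0.
have [C C0 hC] := Gamma_ratio_le g1 g2.
set a := (expR (ln 2 * Q) * normc (Gamma ((dimS n)%:R / 2))) ^- 2.
have a0 : 0 <= a by rewrite invr_ge0 sqr_ge0.
exists (a * C ^+ 2 + 1); first by rewrite ltr_wpDl// mulr_ge0 ?sqr_ge0.
move=> l l0; rewrite plancherelE -/a.
have l1 : 0 <= 1 + l by lra.
have q0 : 0 <= gamma_quotient l by rewrite divr_ge0 ?mulr_ge0 ?normc_ge0.
have h : gamma_quotient l <= C * (1 + l) `^ (Q / 2 + p%:R / 4).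
  have R0 : 0 <= C * (1 + l) `^ (Q / 2 + p%:R / 4) by rewrite mulr_ge0 ?powR_ge0// ltW.
  have := hC l l0; rewrite /gamma_quotient.
  have := normc_ge0 (Gamma (0 +i* (2 * l))%C); rewrite le_eqVlt => /predU1P[<- _|d0].
    by rewrite invr0 mulr0.
  by rewrite ler_pdivrMr.
have : gamma_quotient l ^+ 2 <= C ^+ 2 * (1 + l) ^+ m.
  apply: (@le_trans _ _ ((C * (1 + l) `^ (Q / 2 + p%:R / 4)) ^+ 2)).
    by rewrite lerXn2r// nnegrE (le_trans q0).
  rewrite exprMn ler_wpM2l ?sqr_ge0// (_ : Q / 2 + p%:R / 4 = m%:R / 2); last by rewrite /Qdim natrD; field.
  by rewrite powR_sqr ?powR_mulrn//; lra.
move=> /(ler_wpM2l a0) H; apply: (le_trans H).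
by rewrite mulrA ler_wpM2r ?exprn_ge0// lerDl.
Qed.

End Plancherel.

(** * Integrals over the half-line *)

Section Truncation.
Context {R : realType}.
Local Notation mu := (@lebesgue_measure R).

Lemma bigcup_itv0 (T : nat -> R) : (forall x, exists k, x <= T k) ->
  \bigcup_k `[0, T k]%classic = `[0, +oo[%classic :> set R.
Proof.
move=> hT; apply/seteqP; split => x /=.
  by move=> [k _] /=; rewrite !in_itv/= andbT => /andP[].
rewrite in_itv/= andbT => x0; have [k xk] := hT x.
by exists k => //=; rewrite in_itv/= x0.
Qed.

Lemma nondecreasing_itv0 (T : nat -> R) : (forall k, T k <= T k.+1) ->
  nondecreasing_seq (fun k => `[0, T k]%classic : set R).
Proof.
move=> hT; apply/nondecreasing_seqP => k; apply/subsetPset => x /=.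
by rewrite !in_itv/= => /andP[-> /= /le_trans]; apply.
Qed.

(** The integral of a non-integrable function is [0] by convention, so that a bound
    on the truncated integrals always passes to the limit. *)
Lemma Rintegral_le_truncated (T : nat -> R) (h : R -> R) (B : R) :
  (forall k, T k <= T k.+1) -> (forall x, exists k, x <= T k) ->
  measurable_fun (`[0, +oo[%classic : set R) h ->
  (forall k, `|\int[mu]_(l in `[0, T k]) h l| <= B) ->
  `|\int[mu]_(l in `[0%R, +oo[) h l| <= B.
Proof.
move=> T1 T2 mh hB.
have mD : measurable (`[0, +oo[%classic : set R) by exact: measurable_itv.
have sub k : `[0, T k]%classic `<=` (`[0, +oo[%classic : set R).
  by move=> x /=; rewrite !in_itv/= andbT => /andP[].
have meh : measurable_fun (`[0, +oo[%classic : set R) (EFin \o h) by apply/measurable_EFinP.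
have nd := nondecreasing_itv0 T1.
have mF k : measurable (`[0, T k]%classic : set R) by exact: measurable_itv.
pose hp := ((EFin \o h)^\+)%E; pose hn := ((EFin \o h)^\-)%E.
have cp : (\int[mu]_(x in `[0%R, T k]) hp x)%E @[k --> \oo] --> (\int[mu]_(x in `[0%R, +oo[) hp x)%E.
  rewrite -(bigcup_itv0 T2); apply: ge0_nondecreasing_set_cvg_integral => //.
    by move=> k; exact: (measurable_funS mD (sub k) (measurable_funepos meh)).
  by move=> k x _; exact: funepos_ge0.
have cn : (\int[mu]_(x in `[0%R, T k]) hn x)%E @[k --> \oo] --> (\int[mu]_(x in `[0%R, +oo[) hn x)%E.
  rewrite -(bigcup_itv0 T2); apply: ge0_nondecreasing_set_cvg_integral => //.
    by move=> k; exact: (measurable_funS mD (sub k) (measurable_funeneg meh)).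
  by move=> k x _; exact: funeneg_ge0.
have B0 : 0 <= B by exact: le_trans (normr_ge0 _) (hB 0%N).
rewrite /Rintegral integralE -/hp -/hn.
have p0 : (0 <= \int[mu]_(x in `[0%R, +oo[) hp x)%E by apply: integral_ge0 => x _; exact: funepos_ge0.
have n0 : (0 <= \int[mu]_(x in `[0%R, +oo[) hn x)%E by apply: integral_ge0 => x _; exact: funeneg_ge0.
move: cp cn p0 n0; case: (\int[mu]_(x in `[0%R, +oo[) hp x)%E => [p| |];
  case: (\int[mu]_(x in `[0%R, +oo[) hn x)%E => [q| |] cp cn //= p0 n0; rewrite ?normr0//.
have c : (\int[mu]_(l in `[0, T k]) h l) @[k --> \oo] --> p - q.
  rewrite /Rintegral; apply: fine_cvg; rewrite EFinB.
  under eq_fun do rewrite integralE.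
  exact: cvgeB.
rewrite ler_norml; apply/andP; split.
  apply: (@cvgr_to_ge _ _ _ _ _ _ _ c); apply: nearW => k.
  by have := hB k; rewrite ler_norml => /andP[].
apply: (@cvgr_to_le _ _ _ _ _ _ _ c); apply: nearW => k.
by have := hB k; rewrite ler_norml => /andP[].
Qed.

Lemma Rintegral_le_bound (b : R) (f : R -> R) (B : R) : 0 <= b ->
  measurable_fun (`[0, b]%classic : set R) f -> (forall l, `[0, b]%classic l -> `|f l| <= B) ->
  `|\int[mu]_(l in `[0, b]) f l| <= B * b.
Proof.
move=> b0 mf fB.
have mD : measurable (`[0, b]%classic : set R) by exact: measurable_itv.
have muD : mu `[0, b]%classic = b%:E.
  rewrite lebesgue_measure_itv/= lte_fin; have [b0'|b0'] := ltP 0 b; first by rewrite sube0.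
  by congr EFin; apply/eqP; rewrite eq_le b0 b0'.
have finD : (mu `[0%R, b]%classic < +oo)%E by rewrite muD ltry.
have fi := @intble_bounded _ _ _ mu _ mD finD f B mf fB.
apply: (le_trans (@le_normr_Rintegral _ _ _ mu _ f mD fi)).
have ci : mu.-integrable `[0, b] (EFin \o cst B).
  by apply: (@intble_bounded _ _ _ mu _ mD finD _ `|B|).
have ni : mu.-integrable `[0, b] (EFin \o (fun l => `|f l|)).
  apply: (@intble_bounded _ _ _ mu _ mD finD _ B); first exact: measurableT_comp.
  by move=> x Dx; rewrite normr_id fB.
apply: (le_trans (@le_Rintegral _ _ _ mu _ _ _ mD ni ci fB)).
rewrite /cst Rintegral_cst//; have -> : fine (mu (`[0, b]%classic : set R)) = b := congr1 fine muD.
by [].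
Qed.

(** The spectral parameter enters the equation of spherical functions through [l ^ 2],
    which makes this the natural modulus of continuity. *)
Lemma measurable_lipschitz_sqr (F : R -> R) (C : R) :
  (forall l l', `|F l - F l'| <= C * `|l ^+ 2 - l' ^+ 2|) -> measurable_fun [set: R] F.
Proof.
move=> h; apply: continuous_measurable_fun => x; apply/cvgrPdist_le => e e0.
have c : (C * `|x ^+ 2 - t ^+ 2|) @[t --> x] --> C * `|x ^+ 2 - x ^+ 2|.
  apply: cvgM; first exact: cvg_cst.
  by apply: cvg_norm; apply: cvgB; [exact: cvg_cst|exact: exprn_continuous].
move: c; rewrite subrr normr0 mulr0 => /cvgrPdist_le/(_ e e0).
apply: filterS => t; rewrite sub0r normrN => ht.
by apply: (le_trans (h _ _)); apply: le_trans ht; exact: ler_norm.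
Qed.

(** A parameter-dependent integral over the half-line is a limit of differences of
    integrals of positive and negative parts over bounded intervals, which depend
    continuously on the parameter. *)
Lemma measurable_Rintegral_param (H : R -> R -> R) :
  (forall l, measurable_fun (`[0, +oo[%classic : set R) (H l)) ->
  (forall k : nat, exists C, forall l l' s, 0 <= s <= k%:R ->
     `|H l s - H l' s| <= C * `|l ^+ 2 - l' ^+ 2|) ->
  (forall l (k : nat), exists C, forall s, 0 <= s <= k%:R -> `|H l s| <= C) ->
  measurable_fun [set: R] (fun l => \int[mu]_(s in `[0%R, +oo[) H l s).
Proof.
move=> mH lipH bH.
have mD : measurable (`[0, +oo[%classic : set R) by exact: measurable_itv.
have T1 (k : nat) : k%:R <= k.+1%:R :> R by rewrite ler_nat.
have T2 (x : R) : exists k : nat, x <= k%:R.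
  by exists (Num.truncn x).+1; apply/ltW/truncnS_gt.
have sub (k : nat) : `[0, k%:R]%classic `<=` (`[0, +oo[%classic : set R).
  by move=> x /=; rewrite !in_itv/= andbT => /andP[].
have part (P : (R -> \bar R) -> R -> \bar R) (Q : R -> R) :
    (forall f x, P (EFin \o f) x = (Q (f x))%:E) -> (forall x, 0 <= Q x) ->
    (forall x y, `|Q x - Q y| <= `|x - y|) -> measurable_fun [set: R] Q ->
    (forall x, Q x <= `|x|) ->
    measurable_fun [set: R] (fun l => \int[mu]_(s in `[0%R, +oo[) (P (EFin \o H l) s))%E.
  move=> PQ Q0 Qlip mQ Qx.
  have mQH l : measurable_fun (`[0, +oo[%classic : set R) (fun s => Q (H l s)).
    exact: (measurableT_comp mQ (mH l)).
  have bQ l k : exists C, forall s, `[0, k%:R]%classic s -> `|Q (H l s)| <= C.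
    have [C hC] := bH l k; exists C => s /=; rewrite in_itv/= => hs.
    by rewrite ger0_norm// (le_trans (Qx _))// hC.
  have iQ l k : mu.-integrable `[0, k%:R] (EFin \o (fun s => Q (H l s))).
    have [C hC] := bQ l k; apply: (@intble_bounded _ _ _ mu _ _ _ _ C) => //.
    - by rewrite /= lebesgue_measure_itv/=; case: ifP => // _; rewrite -EFinB ltry.
    - exact: (measurable_funS mD (sub k) (mQH l)).
  apply: (@emeasurable_fun_cvg _ _ _ _ (fun k l => (\int[mu]_(s in `[0%R, k%:R]) (Q (H l s))%:E)%E)).
    move=> k; rewrite (_ : (fun l => _) = EFin \o (fun l => \int[mu]_(s in `[0, k%:R]) Q (H l s))); last first.
      by apply/funext => l /=; rewrite /Rintegral fineK//; apply: (integrable_fin_num _ (iQ l k)).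
    apply/measurable_EFinP; have [C hC] := lipH k.
    apply: (@measurable_lipschitz_sqr _ (C * k%:R)) => l l'.
    rewrite -RintegralB//.
    have mk : measurable_fun (`[0, k%:R]%classic : set R) (fun s => Q (H l s) - Q (H l' s)).
      by apply: measurable_funB; exact: (measurable_funS mD (sub k) (mQH _)).
    rewrite -mulrA [_%:R * _]mulrC mulrA; apply: Rintegral_le_bound => // s /=; rewrite in_itv/= => hs.
    exact: le_trans (Qlip _ _) (hC _ _ _ hs).
  move=> l _; under eq_integral do rewrite PQ.
  rewrite -(bigcup_itv0 T2); apply: ge0_nondecreasing_set_cvg_integral => //.
  - exact: nondecreasing_itv0.
  - move=> k; apply/measurable_EFinP; exact: (measurable_funS mD (sub k) (mQH l)).
  - by move=> k x _; rewrite lee_fin.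
rewrite /Rintegral; under eq_fun do rewrite integralE.
apply: (@measurableT_comp _ _ _ _ _ _ (@fine R)); first exact: fine_measurable.
apply: emeasurable_funB.
  apply: (part (fun f => f^\+%E) (fun x => Num.max x 0)).
  - by move=> f x; rewrite funeposE/= EFin_max.
  - by move=> x; rewrite le_max lexx orbT.
  - move=> x y; rewrite /Num.max; do 2 case: ifP => ?; rewrite ler_norml; apply/andP; split; have := ler_norm (x - y); have := ler_norm (- (x - y)); rewrite normrN; lra.
  - exact: measurable_maxr.
  - by move=> x; rewrite ge_max ler_norm normr_ge0.
apply: (part (fun f => f^\-%E) (fun x => Num.max (- x) 0)).
- by move=> f x; rewrite funenegE/= EFin_max.
- by move=> x; rewrite le_max lexx orbT.
- move=> x y; rewrite /Num.max; do 2 case: ifP => ?; rewrite ler_norml; apply/andP; split; have := ler_norm (x - y); have := ler_norm (- (x - y)); rewrite normrN; lra.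
- by apply: measurable_maxr => //; exact: measurableT_comp.
- by move=> x; rewrite ge_max normr_ge0 andbT -normrN ler_norm.
Qed.

End Truncation.

(** * Regularity of spherical functions in the spectral parameter *)

Section Profile.
Context {R : realType} (n : htype R) (phi : R -> R -> R).
Hypothesis hphi : forall l, spherical n l (phi l).
Local Notation lam := (@lebesgue_measure R).
Local Notation Q := (Qdim n).
Local Notation E l := (even_ext (phi l)).
Local Notation D l := (derive1 (even_ext (phi l))).
Local Notation halfline := (`[0%R, +oo[%classic : set R).

Lemma profileE l s : 0 <= s -> E l s = phi l s.
Proof. by move=> s0; rewrite /even_ext ger0_norm. Qed.

Lemma eigenvalue_gt0 (l : R) : 0 < l ^+ 2 + Q ^+ 2 / 4.
Proof. by rewrite ltr_wpDl ?sqr_ge0// divr_gt0// exprn_gt0// Qdim_gt0. Qed.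

Lemma profile_eigenfunction l : exists d2,
  radial_eigenfunction n (l ^+ 2 + Q ^+ 2 / 4) (E l) (D l) d2.
Proof.
have [d1 [d2 [h1 h2 h3 h4 h5]]] := spherical_ode (hphi l).
exists d2; have -> : D l = d1; last by split.
by apply/funext => s; rewrite derive1E; have := h1 s => ?; rewrite derive_val.
Qed.

Lemma profile_le1 l s : 0 <= s -> `|E l s| <= 1.
Proof.
by have [d2 h] := profile_eigenfunction l; exact: eigenfunction_le1 (eigenvalue_gt0 l) h.
Qed.

Lemma continuous_profile l : continuous (E l).
Proof.
by have [d2 [h _ _ _ _]] := profile_eigenfunction l => s; exact: is_derive_continuous (h s).
Qed.

Lemma profile_lipschitz l l' s : 0 <= s ->
  `|E l s - E l' s| <= (2 / Q * expR s) * `|l ^+ 2 - l' ^+ 2| /\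
  `|D l s - D l' s| <= expR s * `|l ^+ 2 - l' ^+ 2|.
Proof.
move=> s0; have [d2 h] := profile_eigenfunction l; have [d2' h'] := profile_eigenfunction l'.
have Q0 := Qdim_gt0 n; have es1 : 1 <= expR s by rewrite -[leLHS]expR0 ler_expR.
have := eigenfunction_continuity (eigenvalue_gt0 l) (eigenvalue_gt0 l') h h' s0.
rewrite (_ : _ - (l ^+ 2 + _) = l' ^+ 2 - l ^+ 2); last ring.
set X := l' ^+ 2 - l ^+ 2; set d := E l s - E l' s; set d' := D l s - D l' s => H.
have XE : `|l ^+ 2 - l' ^+ 2| = `|X| by rewrite distrC.
have P : X ^+ 2 * expR s <= (expR s * `|X|) ^+ 2.
  rewrite exprMn real_normK ?num_real// mulrC ler_wpM2r ?sqr_ge0// expr2 ler_peMr//; lra.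
have R0 : 0 <= expR s * `|X| by rewrite mulr_ge0// expR_ge0.
have d2l : 0 <= (l ^+ 2 + Q ^+ 2 / 4) * d ^+ 2.
  by rewrite mulr_ge0 ?sqr_ge0// ltW// eigenvalue_gt0.
have dl : (Q / 2 * d) ^+ 2 <= (l ^+ 2 + Q ^+ 2 / 4) * d ^+ 2.
  by have := mulr_ge0 (sqr_ge0 l) (sqr_ge0 d); lra.
have d'2 := sqr_ge0 d'.
rewrite XE; split.
  have : `|Q / 2 * d| <= expR s * `|X|.
    by rewrite -(@ler_pXn2r _ 2)// ?nnegrE// real_normK ?num_real//; lra.
  rewrite normrM ger0_norm; last by rewrite divr_ge0// ltW.
  have q2 : 0 < 2 / Q by rewrite divr_gt0.
  rewrite -(ler_pM2l q2) !mulrA (_ : 2 / Q * Q / 2 = 1) ?mul1r//; field.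
  by rewrite gt_eqF.
by rewrite -(@ler_pXn2r _ 2)// ?nnegrE// real_normK ?num_real//; lra.
Qed.

Lemma measurable_profile s : 0 <= s -> measurable_fun [set: R] (fun l => E l s).
Proof.
by move=> s0; apply: measurable_lipschitz_sqr => l l'; exact: (profile_lipschitz l l' s0).1.
Qed.

Lemma measurable_dprofile s : 0 <= s -> measurable_fun [set: R] (fun l => D l s).
Proof.
by move=> s0; apply: measurable_lipschitz_sqr => l l'; exact: (profile_lipschitz l l' s0).2.
Qed.

Lemma continuous_Adens : continuous (Adens n).
Proof.
have h (s : R) : is_derive s 1 (fun s : R => sinh (s / 2)) ((expR (s / 2) + expR (- (s / 2))) / 4).
  by rewrite /sinh; derive_with; field.
have h' (s : R) : is_derive s 1 (fun s : R => cosh (s / 2)) ((expR (s / 2) - expR (- (s / 2))) / 4).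
  by rewrite /cosh; derive_with; field.
move=> s; apply: is_derive_continuous.
exact: (dM (dM (dcst _ _) (dX _ (h s))) (dX _ (h' s))).
Qed.

Lemma continuous_radial (g : R -> R) :
  smooth (radial g : 'rV[R]_(dimS n) -> R) -> continuous (fun s : R => g `|s|).
Proof.
move=> sm s; have hd := sm [::].
have := @is_derive_line _ _ (radial g : 'rV[R]_(dimS n) -> R) (axis n 0) (delta_mx 0 (iA n)) s (hd _).
move=> /is_derive_continuous.
rewrite (_ : (fun t => _) = fun t => g `|t|)//; apply/funext => t.
by rewrite line_A addr0 /radial dist_axis.
Qed.

Lemma measurable_radial_transform (g : R -> R) :
  smooth (radial g : 'rV[R]_(dimS n) -> R) ->
  measurable_fun [set: R] (fun l => \int[lam]_(s in `[0%R, +oo[) (g s * phi l s * Adens n s)).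
Proof.
move=> sm; pose W s := g `|s| * Adens n s.
have cW : continuous W.
  by move=> s; apply: cvgM; [exact: continuous_radial|exact: continuous_Adens].
have bW (k : nat) : exists C, forall s, 0 <= s <= k%:R -> `|W s| <= C.
  have k0 : 0 <= k%:R :> R by [].
  have cn : {within `[0, k%:R], continuous (fun s : R => `|W s|)}.
    by apply: continuous_subspaceT => s; apply: cvg_norm; exact: cW.
  by have [c _ hc] := EVT_max k0 cn; exists `|W c| => s hs; apply: hc; rewrite in_itv.
rewrite (_ : (fun l => _) = fun l => \int[lam]_(s in `[0%R, +oo[) (W s * E l s)); last first.
  apply/funext => l; apply: eq_Rintegral => s; rewrite inE/= in_itv/= andbT => s0.
  by rewrite profileE// /W ger0_norm//; ring.
apply: measurable_Rintegral_param.
- move=> l; apply: measurable_funTS; apply: measurable_funM; apply: continuous_measurable_fun => //.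
  exact: continuous_profile.
- move=> k; have [C hC] := bW k; have Q0 := Qdim_gt0 n.
  exists (C * (2 / Q * expR k%:R)) => l l' s /andP[s0 sk].
  rewrite -mulrBr normrM -[leRHS]mulrA; apply: ler_pM => //; first by apply: hC; rewrite s0.
  apply: (le_trans (profile_lipschitz l l' s0).1); rewrite ler_wpM2r// ler_wpM2l ?ler_expR//.
  by rewrite divr_ge0// ltW.
move=> l k; have [C hC] := bW k; exists C => s /andP[s0 sk].
rewrite normrM -[leRHS]mulr1; apply: ler_pM => //; first by apply: hC; rewrite s0.
exact: profile_le1.
Qed.

Lemma cmeasurable_transform f : schwartz2 n f -> cmeasurable halfline (transform n phi f).
Proof.
move=> [smR smI _]; split; apply: measurable_funTS.
  have := measurable_radial_transform smR; congr measurable_fun; apply/funext => l.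
  by apply: eq_Rintegral => s _; rewrite !Re_mul !Im_mul/= !mulr0 !subr0.
have := measurable_radial_transform smI; congr measurable_fun; apply/funext => l.
by apply: eq_Rintegral => s _; rewrite !Im_mul !Re_mul/= !mulr0 !add0r.
Qed.

End Profile.

(** * The estimate for a dyadic block *)

Section BlockEstimate.
Context {R : realType} (n : htype R) (phi : R -> R -> R).
Hypothesis hphi : forall l, spherical n l (phi l).
Local Notation lam := (@lebesgue_measure R).
Local Notation Q := (Qdim n).
Local Notation m := (dim_v n + dim_z n)%N.
Local Notation E l := (even_ext (phi l)).
Local Notation D l := (derive1 (even_ext (phi l))).
Local Notation halfline := (`[0%R, +oo[%classic : set R).
Local Notation w := (plancherel n).

(** [Gamma 0 = 0] in the formula of Euler's product, as its first factor is inverted. *)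
Lemma plancherel0 : w 0 = 0.
Proof.
rewrite plancherelE /gamma_quotient (_ : Gamma (0 +i* (2 * 0))%C = 0 :> R[i]) ?Normc.normc0 ?invr0 ?mulr0 ?expr0n ?mulr0//.
have z (c : R[i]) k : c = 0 -> Gamma_seq c k = 0.
  by move=> ->; rewrite /Gamma_seq big_ord_recl/= addr0 mul0r invr0 mulr0.
have c0 : (0 +i* (2 * 0))%C = 0 :> R[i] by rewrite mulr0.
rewrite /Gamma.
rewrite (_ : (fun k => complex.Re _) = fun=> 0); last by apply/funext => k; rewrite z.
rewrite (_ : (fun k => complex.Im _) = fun=> 0); last by apply/funext => k; rewrite z.
by rewrite lim_cst.
Qed.

Lemma measurable_plancherel_halfline : measurable_fun halfline w.
Proof. by apply/measurable_fun_itv_obnd_cbndP; exact: measurable_plancherel. Qed.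

Lemma sqrt_plancherel_le : exists2 C, 0 < C &
  forall l, 1 <= l -> Num.sqrt (l ^- m) * Num.sqrt (w l) <= C.
Proof.
have [C C0 hC] := plancherel_le n.
exists (Num.sqrt (C * 2 ^+ m)); first by rewrite sqrtr_gt0 mulr_gt0// exprn_gt0.
move=> l l1; have l0 : 0 < l by lra.
have lm0 : 0 < l ^+ m by rewrite exprn_gt0.
rewrite -sqrtrM ?invr_ge0 ?(ltW lm0)// ler_wsqrtr// ler_pdivrMl//.
apply: (le_trans (hC l l0)); rewrite mulrCA ler_wpM2l//; first exact: ltW.
by rewrite mulrC -exprMn lerXn2r ?nnegrE//; lra.
Qed.

Lemma measurable_coef_cos r : 0 <= r ->
  measurable_fun [set: R] (fun l => coef_cos n l (E l) (D l) r).
Proof.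
move=> r0; have mE := measurable_profile hphi r0; have mD := measurable_dprofile hphi r0.
have mr : measurable_fun [set: R] (fun l : R => l * r) by apply: measurable_funM.
have ms : measurable_fun [set: R] (fun l : R => sin (l * r)).
  by apply: measurableT_comp => //; apply: continuous_measurable_fun; exact: continuous_sin.
rewrite /coef_cos; apply: measurable_funB.
  by apply: measurable_funM; [exact: measurable_funM|exact: measurable_cosT].
apply: measurable_funM => //; apply: measurable_funM; last exact: measurable_inv.
by apply: measurable_funM => //; apply: measurable_funD => //; exact: measurable_funM.
Qed.

Lemma measurable_coef_sin r : 0 <= r ->
  measurable_fun [set: R] (fun l => coef_sin n l (E l) (D l) r).
Proof.
move=> r0; have mE := measurable_profile hphi r0; have mD := measurable_dprofile hphi r0.
have mr : measurable_fun [set: R] (fun l : R => l * r) by apply: measurable_funM.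
have ms : measurable_fun [set: R] (fun l : R => sin (l * r)).
  by apply: measurableT_comp => //; apply: continuous_measurable_fun; exact: continuous_sin.
rewrite /coef_sin; apply: measurable_funD.
  by apply: measurable_funM => //; exact: measurable_funM.
apply: measurable_funM; last exact: measurable_cosT.
apply: measurable_funM; last exact: measurable_inv.
by apply: measurable_funM => //; apply: measurable_funD => //; exact: measurable_funM.
Qed.

Lemma integral_sum3_le (X : set R) (V1 V2 V3 : R -> R) (x1 x2 x3 : R) : measurable X ->
  measurable_fun [set: R] V1 -> measurable_fun [set: R] V2 -> measurable_fun [set: R] V3 ->
  (forall s, 0 <= V1 s) -> (forall s, 0 <= V2 s) -> (forall s, 0 <= V3 s) ->
  (\int[lam]_(s in X) (V1 s)%:E <= x1%:E)%E -> (\int[lam]_(s in X) (V2 s)%:E <= x2%:E)%E ->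
  (\int[lam]_(s in X) (V3 s)%:E <= x3%:E)%E ->
  (\int[lam]_(s in X) (3 * (V1 s + V2 s + V3 s))%:E <= (3 * (x1 + x2 + x3))%:E)%E.
Proof.
move=> mX m1 m2 m3 p1 p2 p3 h1 h2 h3.
have me (V : R -> R) : measurable_fun [set: R] V -> measurable_fun X (fun s => (V s)%:E).
  by move=> mV; apply/measurable_EFinP; exact: measurable_funTS.
have pe (V : R -> R) : (forall s, 0 <= V s) -> forall s, X s -> (0 <= (V s)%:E)%E.
  by move=> V0 s _; rewrite lee_fin.
have q1 := pe _ p1; have q2 := pe _ p2; have q3 := pe _ p3.
under eq_integral do rewrite EFinM !EFinD.
rewrite ge0_integralZl_EFin//; last first.
- by apply: emeasurable_funD; [apply: emeasurable_funD|]; exact: me.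
- by move=> s _; rewrite !adde_ge0 ?lee_fin.
rewrite EFinM lee_pmul2l// ge0_integralD//; try solve [exact: me
  | by apply: emeasurable_funD; exact: me | by move=> s _; rewrite adde_ge0 ?lee_fin].
rewrite ge0_integralD//; try exact: me.
by rewrite !EFinD; apply: leeD => //; exact: leeD.
Qed.

(** The Lorentzian majorizes the squared error [min 1 (1 / (N * s)) ^ 2] and has an
    explicit primitive. *)
Lemma integral_lorentz_le (N r k : R) : 1 <= N -> 0 < r -> 0 <= k ->
  (\int[lam]_(s in `[0%R, r[) (k * (N / (1 + (N * s) ^+ 2)))%:E <= (k * 2)%:E)%E.
Proof.
move=> N1 r0 k0; have N0 : 0 < N by lra.
have pos (s : R) : 0 < 1 + (N * s) ^+ 2 by rewrite ltr_pwDl ?sqr_ge0.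
have dk (s : R) : is_derive s 1 (fun s => k * atan (N * s)) (k * (N / (1 + (N * s) ^+ 2))).
  by derive_with; field; rewrite gt_eqF.
have ck : continuous (fun s : R => k * (N / (1 + (N * s) ^+ 2))).
  move=> s; apply: (@is_derive_continuous _ _ _ (k * (N * (- (1 + (N * s) ^+ 2) ^- 2 * (2 * (N * s) * N))))).
  by derive_with; rewrite ?gt_eqF//=; field; rewrite gt_eqF.
rewrite integral_itv_bndo_bndc; last first.
  by apply/measurable_EFinP; apply: measurable_funTS; exact: continuous_measurable_fun.
have ii : lam.-integrable `[0, r] (EFin \o (fun s => k * (N / (1 + (N * s) ^+ 2)))).
  by apply: continuous_integrable; exact: continuous_subspaceT.
rewrite -[leLHS]fineK; last exact: (integrable_fin_num _ ii).
rewrite lee_fin; apply: (le_trans (@Rintegral_le_derive _ _ _ _ 0 r (ltW r0) (fun x _ => ck x) (fun x _ => dk x) (fun x _ => lexx _))).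
by rewrite mulr0 atan0 mulr0 subr0 ler_wpM2l//; case/andP: (atan_le2 (N * r)).
Qed.

(** On a dyadic block of frequencies the spherical function is, up to an error that
    is square integrable, a combination of [cos (l * s)] and [sin (l * s)] whose
    amplitude is compensated by the Plancherel density. *)
Lemma block_estimate (a e K r : R) : 0 < a < 1 -> 0 < e -> 0 < K -> 0 < r ->
  exists2 C : R, 0 < C & forall (N : R) (psi : R -> R), 1 <= N ->
  measurable_fun (`[N, 2 * N]%classic : set R) psi ->
  (forall l, `[N, 2 * N]%classic l -> `|psi l - l `^ a| <= K) ->
  forall (c : R) (G : R -> R), measurable_fun (`[N, 2 * N]%classic : set R) G ->
  lam.-integrable `[N, 2 * N] (EFin \o (fun l => G l ^+ 2 * w l)) ->
  exists V : R -> R, [/\ measurable_fun [set: R] V, forall s, 0 <= V s,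
    forall s t, 0 < s < r -> 0 <= t <= 1 ->
      (sqrtA n s * \int[lam]_(l in `[N, 2 * N])
          (E l s * cos (t * psi l + c) * (G l * w l))) ^+ 2 <= V s &
    (\int[lam]_(s in `[0%R, r[) (V s)%:E
       <= (C * N `^ (a / 2 + e) * \int[lam]_(l in `[N, 2 * N]) (G l ^+ 2 * w l))%:E)%E].
Proof.
move=> a01 e0 K0 r0; pose r' := r + 1; have r1 : 1 <= r' by rewrite /r'; lra.
have [C0 C00 mb] := maximal_block a01 e0 K0 r0.
have [C1 C11 asy] := spherical_asymptotics n r1.
have [C2 C20 sp] := sqrt_plancherel_le.
pose B := C1 * C2; have B0 : 0 < B by rewrite mulr_gt0//; lra.
have B20 : 0 < B ^+ 2 by rewrite exprn_gt0.
exists (3 * (2 * (C0 * B ^+ 2) + 4 * B ^+ 2)).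
  by have := mulr_gt0 C00 B20; lra.
move=> N psi N1 mpsi hpsi c G mG iG; have N0 : 0 < N by lra.
pose X : set R := `[N, 2 * N]%classic.
have mX : measurable X by exact: measurable_itv.
have muX : lam X = N%:E.
  by rewrite lebesgue_measure_itv/= lte_fin ifT; [rewrite -EFinB; congr EFin; ring|lra].
have finX : (lam X < +oo)%E by rewrite muX ltry.
have Xge l : X l -> N <= l by rewrite /X/= in_itv/= => /andP[].
have Xge1 l : X l -> 1 <= l by move=> /Xge; lra.
have XS : X `<=` halfline.
  by move=> l Xl; have := Xge1 l Xl; rewrite /= in_itv/= andbT; lra.
have mw : measurable_fun X w.
  by apply: measurable_funS measurable_plancherel_halfline => //; exact: measurable_itv.
have msw : measurable_fun X (fun l => Num.sqrt (w l)).
  apply: (@measurableT_comp _ _ _ _ _ _ (@Num.sqrt R)) => //.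
  by apply: continuous_measurable_fun; exact: sqrt_continuous.
pose g l := G l * Num.sqrt (w l).
have g2 l : g l ^+ 2 = G l ^+ 2 * w l by rewrite exprMn sqr_sqrtr// plancherel_ge0.
have mg : measurable_fun X g by apply: measurable_funM.
have ig : lam.-integrable X (EFin \o (fun l => g l ^+ 2)) by under eq_fun do rewrite g2.
have IE : \int[lam]_(l in X) (G l ^+ 2 * w l) = \int[lam]_(l in X) (g l ^+ 2).
  by apply: eq_Rintegral => l _; rewrite g2.
rewrite -/X IE; set I := \int[lam]_(l in X) (g l ^+ 2).
have I0 : 0 <= I by exact: Rintegral_sqr_ge0.
pose cc l := coef_cos n l (E l) (D l) r'; pose cs l := coef_sin n l (E l) (D l) r'.
pose A l := cc l * Num.sqrt (w l); pose A' l := cs l * Num.sqrt (w l).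
have r'0 : 0 <= r' by lra.
have mA : measurable_fun X A.
  by apply: measurable_funM => //; apply: measurable_funTS; exact: measurable_coef_cos.
have mA' : measurable_fun X A'.
  by apply: measurable_funM => //; apply: measurable_funTS; exact: measurable_coef_sin.
have bd (x l : R) : X l -> `|x| <= C1 * Num.sqrt (l ^- m) -> `|x * Num.sqrt (w l)| <= B.
  move=> Xl hx; rewrite normrM [`|Num.sqrt _|]ger0_norm ?sqrtr_ge0//.
  apply: (@le_trans _ _ (C1 * Num.sqrt (l ^- m) * Num.sqrt (w l))); first by rewrite ler_wpM2r ?sqrtr_ge0.
  by rewrite -mulrA ler_wpM2l ?sp ?Xge1//; lra.
have hA l : X l -> `|A l| <= B.
  move=> Xl; have [d2 h] := profile_eigenfunction hphi l.
  by have [h1 _ _] := asy l _ _ _ (Xge1 l Xl) h; exact: bd.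
have hA' l : X l -> `|A' l| <= B.
  move=> Xl; have [d2 h] := profile_eigenfunction hphi l.
  by have [_ h1 _] := asy l _ _ _ (Xge1 l Xl) h; exact: bd.
have igA := @intble_sqr_mul _ _ _ lam X mX g A B mg mA hA ig.
have igA' := @intble_sqr_mul _ _ _ lam X mX g A' B mg mA' hA' ig.
have mgA : measurable_fun X (fun l => g l * A l) by apply: measurable_funM.
have mgA' : measurable_fun X (fun l => g l * A' l) by apply: measurable_funM.
have leI (F : R -> R) : measurable_fun X F -> (forall l, X l -> `|F l| <= B) ->
    lam.-integrable X (EFin \o (fun l => (g l * F l) ^+ 2)) ->
    \int[lam]_(l in X) ((g l * F l) ^+ 2) <= B ^+ 2 * I.
  move=> mF hF iF; rewrite /I -RintegralZl//; apply: le_Rintegral => //.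
    exact: (@intble_scale _ _ _ lam X mX).
  move=> l Xl; rewrite exprMn mulrC ler_wpM2r ?sqr_ge0//.
  by rewrite -(real_normK (num_real (F l))) lerXn2r ?nnegrE ?hF// ltW.
have [V1 [mV1 V10 V1s V1i]] := mb N psi N1 mpsi hpsi 0 c (fun l => g l * A l) mgA igA.
have [V2 [mV2 V20 V2s V2i]] := mb N psi N1 mpsi hpsi (- (pi / 2)) c (fun l => g l * A' l) mgA' igA'.
pose k := 2 * B ^+ 2 * I; have B2 := ltW B20.
have k0 : 0 <= k by rewrite mulr_ge0// mulr_ge0.
pose V3 (s : R) := k * (N / (1 + (N * s) ^+ 2)).
have V30 (s : R) : 0 <= V3 s.
  by rewrite /V3 mulr_ge0// divr_ge0 ?(ltW N0)// addr_ge0 ?sqr_ge0.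
have mV3 : measurable_fun [set: R] V3.
  apply: measurable_funM => //; apply: measurable_funM => //; apply: measurable_inv.
  by apply: measurable_funD => //; apply: measurable_funX; exact: measurable_funM.
have Npos : 1 <= N `^ (a / 2 + e).
  have : 1 `^ (a / 2 + e) <= N `^ (a / 2 + e).
    by apply: ge0_ler_powR; rewrite ?nnegrE//; [case/andP: a01 => a0 _; rewrite addr_ge0 ?divr_ge0// ltW|exact: le_trans N1].
  by rewrite powR1.
exists (fun s => 3 * (V1 s + V2 s + V3 s)); split.
- by apply: measurable_funM => //; apply: measurable_funD => //; exact: measurable_funD.
- by move=> s; rewrite mulr_ge0// !addr_ge0.
- move=> s t /andP[s0 sr] t01.
  have sr' : 0 < s <= r' by rewrite s0 /r' (le_trans (ltW sr))// lerDl.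
  pose Er l := (sqrtA n s * E l s - (cc l * cos (l * s) + cs l * sin (l * s))) * Num.sqrt (w l).
  have ml : measurable_fun X (fun l : R => l * s) by apply: measurable_funM.
  have msin : measurable_fun X (fun l : R => sin (l * s)).
    by apply: measurableT_comp => //; apply: continuous_measurable_fun; exact: continuous_sin.
  have mcc : measurable_fun X cc by apply: measurable_funTS; exact: measurable_coef_cos.
  have mcs : measurable_fun X cs by apply: measurable_funTS; exact: measurable_coef_sin.
  have mE : measurable_fun X (fun l => E l s).
    by apply: measurable_funTS; apply: measurable_profile => //; exact: ltW.
  have mEr : measurable_fun X Er.
    apply: measurable_funM => //; apply: measurable_funB; first exact: measurable_funM.
    by apply: measurable_funD; apply: measurable_funM => //; exact: measurable_cosT.
  pose Y := N / (1 + (N * s) ^+ 2).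
  have D0 : 0 < 1 + (N * s) ^+ 2 by rewrite ltr_pwDl ?sqr_ge0.
  have hEr l : X l -> Er l ^+ 2 <= 2 * B ^+ 2 / (1 + (N * s) ^+ 2) /\ `|Er l| <= B.
    move=> Xl; have [d2 h] := profile_eigenfunction hphi l.
    have [_ _ /(_ s sr') h1] := asy l _ _ _ (Xge1 l Xl) h.
    set y := Num.min 1 (l * s)^-1 in h1.
    have Ns0 : 0 < N * s by rewrite mulr_gt0.
    have ls0 : 0 < l * s by rewrite mulr_gt0// (lt_le_trans ltr01)// Xge1.
    have y0 : 0 <= y by rewrite le_min ler01 invr_ge0 ltW.
    have y1 : y <= 1 by rewrite ge_min lexx.
    have yN : y * (N * s) <= 1.
      have : y <= (l * s)^-1 by rewrite ge_min lexx orbT.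
      move=> hy; apply: (@le_trans _ _ ((l * s)^-1 * (N * s))); first by rewrite ler_wpM2r// ltW.
      by rewrite mulrC ler_pdivrMr// mul1r ler_wpM2r ?Xge// ltW.
    have ab : `|Er l| <= B * y.
      rewrite /Er normrM [`|Num.sqrt _|]ger0_norm ?sqrtr_ge0//.
      apply: (le_trans (ler_wpM2r (sqrtr_ge0 (w l)) h1)).
      rewrite /B -!mulrA ler_wpM2l//; first exact: le_trans C11.
      by rewrite mulrCA mulrC ler_wpM2r// sp// Xge1.
    split; last by rewrite (le_trans ab)// ler_piMr// ltW.
    rewrite -(real_normK (num_real (Er l))).
    apply: (@le_trans _ _ ((B * y) ^+ 2)); first by rewrite lerXn2r ?nnegrE// mulr_ge0// ltW.
    rewrite ler_pdivlMr// exprMn -mulrA [leRHS]mulrC ler_wpM2l ?sqr_ge0//.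
    have q1 : y ^+ 2 <= 1 by rewrite expr_le1.
    have q2 : (y * (N * s)) ^+ 2 <= 1 by rewrite expr_le1// mulr_ge0// ltW.
    by move: q2; rewrite exprMn mulrDr mulr1 => q2; exact: lerD.
  have mc : measurable_fun X (fun l => cos (t * psi l + c)).
    by apply: measurable_cosT; apply: measurable_funD => //; exact: measurable_funM.
  pose er l := Er l * cos (t * psi l + c).
  have mer : measurable_fun X er by apply: measurable_funM.
  have her l : X l -> `|er l| <= B.
    move=> /hEr[_ h]; rewrite normrM -[leRHS]mulr1; apply: ler_pM => //; exact: abs_cos_le1.
  have CS := @cauchy_schwarz_bounded _ _ _ lam X mX finX er B g mer her mg ig.
  have er2 : \int[lam]_(l in X) (er l ^+ 2) <= 2 * B ^+ 2 * Y.
    have H l : X l -> `|er l ^+ 2| <= 2 * B ^+ 2 / (1 + (N * s) ^+ 2).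
      move=> Xl; rewrite ger0_norm ?sqr_ge0//; apply: le_trans (hEr l Xl).1.
      rewrite /er [leLHS]exprMn ler_piMr ?sqr_ge0// -(cos2Dsin2 (t * psi l + c)) lerDl.
    have := @Rintegral_le_cst R N N1 _ _ (measurable_funX 2 mer) H.
    rewrite mulrAC -mulrA => h; apply: le_trans h; exact: ler_norm.
  have x3 : (\int[lam]_(l in X) (g l * er l)) ^+ 2 <= V3 s.
    apply: (le_trans CS); rewrite -/I /V3 /k -/Y mulrAC.
    by rewrite ler_wpM2r.
  have s01 : 0 <= s < r by rewrite ltW.
  have x1 := V1s s t s01 t01; have x2 := V2s s t s01 t01.
  have cb (z z' l : R) : X l -> `|cos z * cos z'| <= 1.
    by move=> _; rewrite normrM -[leRHS]mulr1; apply: ler_pM => //; exact: abs_cos_le1.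
  have ms (z : R) : measurable_fun X (fun l : R => cos (s * l + z) * cos (t * psi l + c)).
    apply: measurable_funM => //; apply: measurable_cosT; apply: measurable_funD => //.
  have i1 := @intble_mul_bounded _ _ _ lam X mX finX _ _ 1 mgA (ms 0) (fun l => @cb _ _ l) igA.
  have i2 := @intble_mul_bounded _ _ _ lam X mX finX _ _ 1 mgA' (ms (- (pi / 2))) (fun l => @cb _ _ l) igA'.
  have i3 := @intble_mul_bounded _ _ _ lam X mX finX _ _ B mg mer her ig.
  pose F l := g l * A l * (cos (s * l + 0) * cos (t * psi l + c)) +
    g l * A' l * (cos (s * l + - (pi / 2)) * cos (t * psi l + c)) + g l * er l.
  have FE l : sqrtA n s * (E l s * cos (t * psi l + c) * (G l * w l)) = F l.
    rewrite /F cosB cos_pihalf sin_pihalf addr0 [s * l]mulrC.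
    rewrite /er /Er /A /A' /g -{1}(sqr_sqrtr (plancherel_ge0 n l)); ring.
  have i12 := @intble_add _ _ _ lam X mX _ _ i1 i2.
  have iF : lam.-integrable X (EFin \o F) := @intble_add _ _ _ lam X mX _ _ i12 i3.
  have sA : sqrtA n s != 0 by rewrite gt_eqF// sqrtr_gt0 Adens_gt0.
  have i0 : lam.-integrable X (EFin \o (fun l => E l s * cos (t * psi l + c) * (G l * w l))).
    have := @intble_scale _ _ _ lam X mX (sqrtA n s)^-1 _ iF.
    by congr (lam.-integrable X _); apply/funext => l /=; rewrite -FE mulKf.
  rewrite -RintegralZl//; under eq_Rintegral do rewrite FE.
  rewrite /F RintegralD// RintegralD//.
  move: x1 x2 x3; set z1 := \int[lam]_(l in X) _; set z2 := \int[lam]_(l in X) _; set z3 := \int[lam]_(l in X) _.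
  move: (V1 s) (V2 s) (V3 s) => v1 v2 v3; clear; move: z1 z2 z3 => z1 z2 z3 x1 x2 x3.
  have := sqr_ge0 (z1 - z2); have := sqr_ge0 (z1 - z3); have := sqr_ge0 (z2 - z3).
  lra.
apply: le_trans (integral_sum3_le _ mV1 mV2 mV3 V10 V20 V30 V1i V2i (integral_lorentz_le N1 r0 k0)) _ => //.
have CN : 0 <= C0 * N `^ (a / 2 + e) by rewrite mulr_ge0 ?powR_ge0// ltW.
have h1 := ler_wpM2l CN (leI A mA hA igA); have h2 := ler_wpM2l CN (leI A' mA' hA' igA').
have h3 : k * 2 <= 4 * B ^+ 2 * I * N `^ (a / 2 + e).
  rewrite (_ : k * 2 = 4 * B ^+ 2 * I); last by rewrite /k; ring.
  by rewrite ler_peMr// mulr_ge0// mulr_ge0.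
rewrite lee_fin [leRHS](_ : _ = 3 * (C0 * N `^ (a / 2 + e) * (B ^+ 2 * I) +
  C0 * N `^ (a / 2 + e) * (B ^+ 2 * I) + 4 * B ^+ 2 * I * N `^ (a / 2 + e))); last by ring.
by rewrite ler_wpM2l// lerD// lerD.
Qed.

End BlockEstimate.

(** * Summation over the dyadic blocks *)

Section DyadicSum.
Context {R : realType} (n : htype R) (phi : R -> R -> R).
Hypothesis hphi : forall l, spherical n l (phi l).
Local Notation lam := (@lebesgue_measure R).
Local Notation Q := (Qdim n).
Local Notation m := (dim_v n + dim_z n)%N.
Local Notation E l := (even_ext (phi l)).
Local Notation halfline := (`[0%R, +oo[%classic : set R).
Local Notation w := (plancherel n).

Lemma geometric_sum_le (x : R) k : 0 <= x < 1 -> \sum_(j < k) x ^+ j <= (1 - x)^-1.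
Proof.
move=> /andP[x0 x1]; have d0 : 0 < 1 - x by lra.
rewrite -[leRHS]mul1r ler_pdivlMr//.
have -> : (\sum_(j < k) x ^+ j) * (1 - x) = 1 - x ^+ k.
  have := subrX1 x k; have -> : \sum_(i < k) x ^+ i = \sum_(j < k) x ^+ j by [].
  by move: (\sum_(j < k) x ^+ j) => z; lra.
by rewrite gerBl exprn_ge0.
Qed.

Lemma lebesgue_integrableS (X Y : set R) (f : R -> \bar R) : measurable Y -> measurable X ->
  X `<=` Y -> lam.-integrable Y f -> lam.-integrable X f.
Proof. by move=> mY mX XY; apply: integrableS. Qed.

Lemma Rintegral_subset_le (X Y : set R) (f : R -> R) : measurable X -> measurable Y ->
  X `<=` Y -> lam.-integrable Y (EFin \o f) -> (forall l, Y l -> 0 <= f l) ->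
  \int[lam]_(l in X) f l <= \int[lam]_(l in Y) f l.
Proof.
move=> mX mY XY iY f0; have iX := lebesgue_integrableS mY mX XY iY.
apply: fine_le; [exact: (integrable_fin_num _ iX)|exact: (integrable_fin_num _ iY)|].
by apply: ge0_subset_integral => //; exact: (measurable_int _ iY).
Qed.

Lemma Rintegral_dyadic_step (f : R -> R) (N : R) : 0 <= N ->
  lam.-integrable `[0, 2 * N] (EFin \o f) ->
  \int[lam]_(l in `[0, 2 * N]) f l =
  \int[lam]_(l in `[0, N]) f l + \int[lam]_(l in `[N, 2 * N]) f l.
Proof.
move=> N0 i0; have N2 : N <= 2 * N by lra.
have iN : lam.-integrable `]N, 2 * N] (EFin \o f).
  apply: integrableS i0 => //.
  by move=> x /=; rewrite !in_itv/= => /andP[Nx ->]; rewrite andbT (le_trans N0)// ltW.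
have := @Rintegral_itvB R f (BLeft 0) (BRight (2 * N)) N i0.
rewrite !bnd_simp => /(_ N0 N2); rewrite Rintegral_itv_obnd_cbnd// => <-.
by rewrite addrC subrK.
Qed.

Definition sobolev_weight (b l : R) : R := (l ^+ 2 + Q ^+ 2 / 4) `^ b.

Lemma sobolev_weight_ge_low (b l : R) : 0 <= b -> (Q ^+ 2 / 4) `^ b <= sobolev_weight b l.
Proof.
move=> b0; have q0 : 0 <= Q ^+ 2 / 4 by rewrite divr_ge0 ?sqr_ge0.
by apply: ge0_ler_powR; rewrite ?nnegrE ?addr_ge0 ?sqr_ge0// lerDr sqr_ge0.
Qed.

Lemma sobolev_weight_ge (b N l : R) : 0 <= b -> 0 < N -> N <= l -> N `^ (2 * b) <= sobolev_weight b l.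
Proof.
move=> b0 N0 Nl; have q0 : 0 <= Q ^+ 2 / 4 by rewrite divr_ge0 ?sqr_ge0.
rewrite powRrM (powR_mulrn 2 (ltW N0)).
apply: ge0_ler_powR; rewrite ?nnegrE ?addr_ge0 ?sqr_ge0//.
have : N ^+ 2 <= l ^+ 2 by rewrite lerXn2r ?nnegrE ?(ltW N0)// (le_trans (ltW N0)).
lra.
Qed.

(** If [V j] is the majorant of the block [j], whose integral is of order [q ^ (4 * j)],
    then [W = \sum_j V j / q ^ (2 * j)] is integrable, and the block [j] of the solution
    is at most [q ^ j * sqrt W], which is summable in [j]. *)
Lemma summed_estimate (a b M K r : R) : 0 < a < 1 -> a / 4 < b -> 1 < M -> 0 < r ->
  exists2 C : R, 0 < C & forall psi, asymptotically_concave a M K psi ->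
  forall (c : R) (G : R -> R), measurable_fun halfline G ->
  lam.-integrable halfline (EFin \o (fun l => sobolev_weight b l * (G l ^+ 2 * w l))) ->
  exists H : R -> \bar R, [/\ measurable_fun [set: R] H, forall s, (0 <= H s)%E,
    forall s t k, 0 < s < r -> 0 <= t <= 1 ->
      lam.-integrable `[0, M * 2 ^+ k]
        (EFin \o (fun l => E l s * cos (t * psi l + c) * (G l * w l))) /\
      (((sqrtA n s * \int[lam]_(l in `[0%R, (M * 2 ^+ k)%R])
          (E l s * cos (t * psi l + c) * (G l * w l))) ^+ 2)%:E <= H s)%E &
    (\int[lam]_(s in `[0%R, r[) H s
       <= (C * \int[lam]_(l in `[0%R, +oo[) (sobolev_weight b l * (G l ^+ 2 * w l)))%:E)%E].
Proof.
move=> a01 hb M1 r0; have [a0 a1] := andP a01.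
have b0 : 0 < b by rewrite (le_lt_trans _ hb)// divr_ge0// ltW.
pose e := b - a / 4; have e0 : 0 < e by rewrite subr_gt0.
have K0 : 0 < `|K| + 1 by rewrite ltr_wpDl.
have [C1 C10 block] := block_estimate hphi a01 e0 K0 r0.
have [CW CW0 hW] := plancherel_le n.
have [CA CA1 geo] := geometry_bounds n r0.
have CA0 : 0 < CA by exact: lt_le_trans CA1.
have M0 : 0 < M by exact: lt_trans M1.
have Qb0 : 0 < (Q ^+ 2 / 4) `^ b by rewrite powR_gt0// divr_gt0// exprn_gt0// Qdim_gt0.
have wle l T : 0 <= l <= T -> `|w l| <= CW * (1 + T) ^+ m.
  move=> /andP[]; rewrite le_eqVlt => /predU1P[<-|l0] lT.
    by rewrite plancherel0 normr0 mulr_ge0 ?exprn_ge0 ?addr_ge0// ltW.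
  rewrite ger0_norm ?plancherel_ge0//; apply: (le_trans (hW l l0)); rewrite ler_wpM2l ?(ltW CW0)//.
  by rewrite lerXn2r ?nnegrE ?lerD2l// addr_ge0// ltW// (lt_le_trans l0).
(* the Sobolev weight leaves the gain [N ^ (- e)], of which [q] is the fourth root
   for one dyadic step *)
pose q : R := 2 `^ (- (e / 4)).
have q0 : 0 < q by rewrite powR_gt0.
have q1 : q < 1.
  rewrite /q powRN invf_lt1 ?powR_gt0//.
  have : 1 `^ (e / 4) < 2 `^ (e / 4) :> R.
    by apply: gt0_ltr_powR; rewrite ?nnegrE ?divr_gt0 ?ltr1n.
  by rewrite powR1.
have qd : 0 < 1 - q by rewrite subr_gt0.
pose c2 := 2 / (1 - q) ^+ 2; have c20 : 0 < c2 by rewrite divr_gt0// exprn_gt0.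
pose cL := CA * r ^+ m * (CW * (1 + M) ^+ m * M) / (Q ^+ 2 / 4) `^ b.
have cL0 : 0 <= cL.
  rewrite divr_ge0 ?(ltW Qb0)// mulr_ge0//; first by rewrite mulr_ge0 ?exprn_ge0// ltW.
  by rewrite mulr_ge0 ?(ltW M0)// mulr_ge0 ?(ltW CW0)// exprn_ge0// addr_ge0// ltW.
exists (2 * cL * r + c2 * (C1 / (1 - q)) + 1).
  have h1 : 0 <= 2 * cL * r := mulr_ge0 (mulr_ge0 (ler0n _ 2) cL0) (ltW r0).
  have h2 : 0 <= c2 * (C1 / (1 - q)) := mulr_ge0 (ltW c20) (divr_ge0 (ltW C10) (ltW qd)).
  by rewrite ltr_wpDl// addr_ge0.
move=> psi [cpsi _ hpsi] c G mG iS.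
set S := \int[lam]_(l in `[0%R, +oo[) _.
have mH : measurable halfline by exact: measurable_itv.
have mw := measurable_plancherel_halfline n.
have mpsi : measurable_fun halfline psi by exact: subspace_continuous_measurable_fun.
have Gw0 l : 0 <= G l ^+ 2 * w l by rewrite mulr_ge0 ?sqr_ge0// plancherel_ge0.
have sw0 l : 0 <= sobolev_weight b l * (G l ^+ 2 * w l) by rewrite mulr_ge0 ?powR_ge0.
have S0 : 0 <= S by exact: Rintegral_ge0.
have mGw : measurable_fun halfline (fun l => G l ^+ 2 * w l).
  by apply: measurable_funM => //; exact: measurable_funX.
have iGw : lam.-integrable halfline (EFin \o (fun l => G l ^+ 2 * w l)).
  apply: (@intble_le _ _ _ lam _ mH _ _ mGw _ (@intble_scale _ _ _ lam _ mH ((Q ^+ 2 / 4) `^ b)^-1 _ iS)).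
  move=> l _; rewrite ger0_norm// ler_pdivlMl// ler_wpM2r// sobolev_weight_ge_low//; exact: ltW.
have lowS (X : set R) : measurable X -> X `<=` halfline ->
    \int[lam]_(l in X) (G l ^+ 2 * w l) <= S / (Q ^+ 2 / 4) `^ b.
  move=> mX XH; apply: (le_trans (Rintegral_subset_le mX mH XH iGw (fun l _ => Gw0 l))).
  rewrite ler_pdivlMr// mulrC -RintegralZl//; apply: le_Rintegral => //.
    exact: (@intble_scale _ _ _ lam _ mH).
  by move=> l _; rewrite ler_wpM2r// sobolev_weight_ge_low//; exact: ltW.
pose N (j : nat) : R := M * 2 ^+ j.
have N0 j : 0 < N j by rewrite mulr_gt0// exprn_gt0.
have NM j : M <= N j by rewrite ler_peMr ?(ltW M0)// exprn_ege1// ler1n.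
have N1 j : 1 <= N j := le_trans (ltW M1) (NM j).
have NS j : N j.+1 = 2 * N j by rewrite /N exprS; ring.
have XH (j : nat) : `[N j, 2 * N j]%classic `<=` halfline.
  by move=> l /=; rewrite !in_itv/= andbT => /andP[h _]; exact: le_trans (ltW (N0 j)) h.
have mX (j : nat) : measurable (`[N j, 2 * N j]%classic : set R) by exact: measurable_itv.
have hpsi' j l : `[N j, 2 * N j]%classic l -> `|psi l - l `^ a| <= `|K| + 1.
  rewrite /= in_itv/= => /andP[Nl _]; apply: (le_trans (hpsi l (le_trans (NM j) Nl))).
  by rewrite (le_trans (ler_norm K))// lerDl.
have iX j := lebesgue_integrableS mH (mX j) (XH j) iGw.
have blockj (j : nat) : exists V : R -> R, [/\ measurable_fun [set: R] V, forall s, 0 <= V s,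
    forall s t, 0 < s < r -> 0 <= t <= 1 ->
      (sqrtA n s * \int[lam]_(l in `[N j, 2 * N j])
          (E l s * cos (t * psi l + c) * (G l * w l))) ^+ 2 <= V s &
    (\int[lam]_(s in `[0%R, r[) (V s)%:E
       <= (C1 * N j `^ (a / 2 + e) * \int[lam]_(l in `[N j, 2 * N j]) (G l ^+ 2 * w l))%:E)%E].
  exact: (block _ psi (N1 j) (measurable_funS mH (XH j) mpsi) (hpsi' j) c G (measurable_funS mH (XH j) mG) (iX j)).
have [V hV] := choice blockj.
have Vint j : (\int[lam]_(s in `[0%R, r[) (V j s)%:E <= (C1 * q ^+ (4 * j) * S)%:E)%E.
  have [_ _ _ h] := hV j; apply: (le_trans h); rewrite lee_fin -!mulrA ler_wpM2l ?(ltW C10)//.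
  set I := \int[lam]_(l in _) _.
  have NI : N j `^ (2 * b) * I <= S.
    rewrite /I -RintegralZl//; try exact: (iX j).
    apply: (@le_trans _ _ (\int[lam]_(l in `[N j, 2 * N j]) (sobolev_weight b l * (G l ^+ 2 * w l)))).
      apply: le_Rintegral => //; first exact: (@intble_scale _ _ _ lam _ (mX j)).
        exact: (lebesgue_integrableS mH (mX j) (XH j) iS).
      move=> l /=; rewrite in_itv/= => /andP[Nl _]; rewrite ler_wpM2r//.
      by apply: sobolev_weight_ge => //; exact: ltW.
    exact: Rintegral_subset_le.
  have -> : a / 2 + e = - e + 2 * b by rewrite /e; field.
  rewrite gt0_powRD// -mulrA; apply: ler_pM => //; rewrite ?powR_ge0 ?mulr_ge0 ?powR_ge0//.
    by apply: Rintegral_ge0.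
  have -> : q ^+ (4 * j) = (2 ^+ j) `^ (- e).
    rewrite exprM /q -(powR_mulrn 4 (powR_ge0 _ _)) -powRrM.
    rewrite -(powR_mulrn j (powR_ge0 _ _)) -powRrM -(@powR_mulrn _ 2 j)// -powRrM.
    by congr (_ `^ _); field.
  rewrite !powRN lef_pV2 ?posrE ?powR_gt0// ?exprn_gt0//.
  apply: ge0_ler_powR; rewrite ?nnegrE ?exprn_ge0 ?(ltW e0) ?(ltW (N0 j))//.
  by rewrite ler_peMl ?exprn_ge0// ltW.
pose u (j : nat) (s : R) : \bar R := (V j s / q ^+ (2 * j))%:E.
have u0 j s : (0 <= u j s)%E.
  by have [_ V0 _ _] := hV j; rewrite lee_fin divr_ge0// exprn_ge0// ltW.
have mu_ j : measurable_fun [set: R] (u j).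
  by have [mV _ _ _] := hV j; apply/measurable_EFinP; exact: measurable_funM.
pose W (s : R) : \bar R := (\sum_(j <oo) u j s)%E.
have W0 s : (0 <= W s)%E by apply: nneseries_ge0.
have mW : measurable_fun [set: R] W.
  rewrite (_ : W = fun s => (\sum_(j <oo | j \in predT) u j s)%E)//.
  exact: ge0_emeasurable_sum.
have uW j s : (u j s <= W s)%E.
  apply: le_trans (nneseries_lim_ge j.+1 _) => //.
  by rewrite big_nat_recr//= leeDr// sume_ge0.
have Wint : (\int[lam]_(s in `[0%R, r[) W s <= (C1 / (1 - q) * S)%:E)%E.
  rewrite integral_nneseries//; try solve [by move=> j; apply: measurable_funTS; exact: mu_
    | by move=> j s _; exact: u0].
  apply: lime_le; first by apply: is_cvg_nneseries => j _ _; exact: integral_ge0.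
  apply: nearW => k.
  apply: (@le_trans _ _ (\sum_(0 <= j < k) (C1 * S * (q ^+ 2) ^+ j)%:E)%E).
    apply: lee_sum => j _; rewrite /u.
    have [mV V0 _ _] := hV j.
    have qj : 0 < q ^+ (2 * j) by rewrite exprn_gt0.
    under eq_integral do rewrite mulrC EFinM.
    rewrite ge0_integralZl_EFin//; try solve [by move=> s _; rewrite lee_fin
      | by apply/measurable_EFinP; exact: measurable_funTS | by rewrite invr_ge0 ltW].
    apply: (@le_trans _ _ ((q ^+ (2 * j))^-1%:E * (C1 * q ^+ (4 * j) * S)%:E)%E).
      by rewrite lee_pmul2l// ?lte_fin ?invr_gt0// Vint.
    rewrite -EFinM lee_fin (_ : 4 * j = 2 * j + 2 * j)%N; last by rewrite -mulnDl.
    rewrite exprD -exprM; move: (q ^+ (2 * j)) qj => z z0.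
    by rewrite [leLHS](_ : _ = C1 * S * z)//; field; rewrite gt_eqF.
  rewrite sumEFin lee_fin -mulr_sumr big_mkord mulrAC ler_wpM2r//.
  rewrite mulrC [leRHS]mulrC ler_wpM2r ?(ltW C10)//.
  have q21 : 0 <= q ^+ 2 < 1 by rewrite sqr_ge0 expr_lt1// ltW.
  apply: (le_trans (geometric_sum_le k q21)).
  have q2q : q ^+ 2 <= q by rewrite expr2 ler_piMl// ltW.
  have q2d : 0 < 1 - q ^+ 2 by case/andP: q21 => _; rewrite subr_gt0.
  by rewrite lef_pV2 ?posrE// lerD2l lerN2.
exists (fun s => ((2 * (cL * S))%:E + c2%:E * W s)%E); split.
- by apply: emeasurable_funD => //; exact: measurable_funeM.
- move=> s; apply: adde_ge0; first by rewrite lee_fin; exact: (mulr_ge0 (ler0n _ 2) (mulr_ge0 cL0 S0)).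
  by apply: mule_ge0 => //; rewrite lee_fin ltW.
- move=> s t k s0r t01; have [s0 sr] := andP s0r.
  pose F l := E l s * cos (t * psi l + c) * (G l * w l).
  have mE : measurable_fun halfline (fun l => E l s).
    by apply: measurable_funTS; apply: measurable_profile => //; exact: ltW.
  have mc : measurable_fun halfline (fun l => cos (t * psi l + c)).
    by apply: measurable_cosT; apply: measurable_funD => //; exact: measurable_funM.
  have msw : measurable_fun halfline (fun l => Num.sqrt (w l)).
    apply: (@measurableT_comp _ _ _ _ _ _ (@Num.sqrt R)) => //.
    by apply: continuous_measurable_fun; exact: sqrt_continuous.
  pose f1 l := Num.sqrt (w l) * (E l s * cos (t * psi l + c)).
  pose g l := G l * Num.sqrt (w l).
  have mf1 : measurable_fun halfline f1 by apply: measurable_funM => //; exact: measurable_funM.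
  have mg : measurable_fun halfline g by exact: measurable_funM.
  have Fg l : F l = g l * f1 l.
    by rewrite /F /g /f1 -{1}(sqr_sqrtr (plancherel_ge0 n l)); ring.
  have g2 l : g l ^+ 2 = G l ^+ 2 * w l by rewrite exprMn sqr_sqrtr// plancherel_ge0.
  have TH (T : R) : `[0, T]%classic `<=` halfline.
    by move=> l /=; rewrite !in_itv/= andbT => /andP[].
  have mT (T : R) : measurable (`[0, T]%classic : set R) by exact: measurable_itv.
  have finT (T : R) : (lam (`[0%R, T]%classic : set R) < +oo)%E.
    by rewrite lebesgue_measure_itv/=; case: ifP => // _; rewrite -EFinB ltry.
  have f1b (T l : R) : `[0, T]%classic l -> `|f1 l| <= Num.sqrt (CW * (1 + T) ^+ m).
    rewrite /= in_itv/= => lT; rewrite normrM -[leRHS]mulr1; apply: ler_pM => //.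
      rewrite ger0_norm ?sqrtr_ge0// ler_wsqrtr//.
      by rewrite -[leLHS](ger0_norm (plancherel_ge0 n l)) wle.
    rewrite normrM -[leRHS]mulr1; apply: ler_pM; rewrite ?abs_cos_le1//.
    by apply: profile_le1 => //; exact: ltW.
  have ig2 (T : R) : lam.-integrable `[0, T] (EFin \o (fun l => g l ^+ 2)).
    have -> : (fun l => g l ^+ 2) = (fun l => G l ^+ 2 * w l) by apply/funext.
    exact: (lebesgue_integrableS mH (mT T) (@TH T) iGw).
  have iF (T : R) : lam.-integrable `[0, T] (EFin \o F).
    have := @intble_mul_bounded _ _ _ lam _ (mT T) (finT T) _ _ _ (measurable_funS mH (@TH T) mg)
      (measurable_funS mH (@TH T) mf1) (@f1b T) (ig2 T).
    by congr (lam.-integrable _ _); apply/funext => l /=; rewrite Fg.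
  split; first exact: iF.
  have := W0 s; have := uW ^~ s; case: (W s) => [v| |]//; last first.
    by move=> _ _; rewrite gt0_muley ?lte_fin// addey// leey.
  rewrite lee_fin => uv v0; rewrite -EFinM -EFinD lee_fin.
  pose x j := sqrtA n s * \int[lam]_(l in `[0, N j]) F l.
  have sv0 := sqrtr_ge0 v.
  have step j : `|x j.+1 - x j| <= Num.sqrt v * q ^+ j.
    rewrite /x NS Rintegral_dyadic_step ?(ltW (N0 j))//.
    rewrite mulrDr addrC addKr.
    have [_ _ h _] := hV j; have := h s t s0r t01; rewrite -/F => h1.
    have qj : 0 <= q ^+ j by rewrite exprn_ge0// ltW.
    rewrite -(@ler_pXn2r _ 2)// ?nnegrE ?mulr_ge0// real_normK ?num_real// [leRHS]exprMn sqr_sqrtr//.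
    apply: (le_trans h1); have := uv j; rewrite /u lee_fin ler_pdivrMr ?exprn_gt0//.
    by rewrite -exprM mulnC.
  have xk : `|x k - x 0%N| <= Num.sqrt v * (1 - q)^-1.
    apply: (@le_trans _ _ (Num.sqrt v * \sum_(j < k) q ^+ j)).
      elim: k => [|k IH]; first by rewrite subrr normr0 big_ord0 mulr0.
      rewrite big_ord_recr/= mulrDr (_ : _ - _ = (x k - x 0%N) + (x k.+1 - x k)); last by ring.
      by apply: (le_trans (ler_normD _ _)); exact: lerD.
    by rewrite ler_wpM2l// geometric_sum_le// q1 ltW.
  have x0 : x 0%N ^+ 2 <= cL * S.
    have N00 : N 0%N = M by rewrite /N expr0 mulr1.
    rewrite /x N00 exprMn sqr_sqrtr ?Adens_ge0 ?(ltW s0)//.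
    have -> : \int[lam]_(l in `[0, M]) F l = \int[lam]_(l in `[0, M]) (g l * f1 l).
      by apply: eq_Rintegral => l _; rewrite Fg.
    have CS := @cauchy_schwarz_bounded _ _ _ lam _ (mT M) (finT M) _ _ _
      (measurable_funS mH (@TH M) mf1) (@f1b M) (measurable_funS mH (@TH M) mg) (ig2 M).
    have e1 : \int[lam]_(l in `[0, M]) (f1 l ^+ 2) <= CW * (1 + M) ^+ m * M.
      apply: (le_trans (ler_norm _)); apply: Rintegral_le_bound; first exact: ltW.
        by apply: measurable_funX; exact: (measurable_funS mH (@TH M) mf1).
      move=> l Tl; have C0 : 0 <= CW * (1 + M) ^+ m.
        by rewrite mulr_ge0 ?(ltW CW0)// exprn_ge0// addr_ge0// ltW.
      rewrite ger0_norm ?sqr_ge0// -(real_normK (num_real (f1 l))) -[leRHS](sqr_sqrtr C0).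
      by rewrite lerXn2r ?nnegrE ?sqrtr_ge0// f1b.
    have e2 : \int[lam]_(l in `[0, M]) (g l ^+ 2) <= S / (Q ^+ 2 / 4) `^ b.
      under eq_Rintegral do rewrite g2; exact: lowS.
    have e3 : Adens n s <= CA * r ^+ m.
      have [_ _ h] := geo s (introT andP (conj s0 (ltW sr))).
      apply: (le_trans h); rewrite ler_wpM2l ?(ltW CA0)//.
      by rewrite lerXn2r ?nnegrE ?(ltW s0) ?(ltW r0)// ltW.
    rewrite [leRHS](_ : _ = CA * r ^+ m * ((CW * (1 + M) ^+ m * M) * (S / (Q ^+ 2 / 4) `^ b))); last first.
      by rewrite /cL; ring.
    apply: ler_pM => //; rewrite ?sqr_ge0 ?Adens_ge0 ?(ltW s0)//.
    apply: (le_trans CS); apply: ler_pM => //; exact: Rintegral_sqr_ge0.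
  have dk : (x k - x 0%N) ^+ 2 <= v / (1 - q) ^+ 2.
    rewrite -(real_normK (num_real (_ - _))) -[in v / _](sqr_sqrtr v0) -exprVn -exprMn.
    by rewrite lerXn2r ?nnegrE// mulr_ge0// invr_ge0 ltW.
  have -> : c2 * v = 2 * (v / (1 - q) ^+ 2) by rewrite /c2; ring.
  rewrite -/(N k) -/F -/(x k); move: x0 dk; clear; move: (x k) (x 0%N) (cL * S) (v / _) => y z A B h1 h2.
  by have := sqr_ge0 (y - z - z); lra.
have cS0 : 0 <= 2 * (cL * S) := mulr_ge0 (ler0n _ 2) (mulr_ge0 cL0 S0).
rewrite ge0_integralD//=; try solve [by move=> s _; rewrite lee_fin
  | by move=> s _; rewrite mule_ge0// lee_fin ltW
  | by apply: measurable_funTS; exact: measurable_funeM].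
rewrite integral_cst//=.
rewrite ge0_integralZl_EFin//; try solve [exact: ltW | exact: measurable_funTS].
rewrite lebesgue_measure_itv/= lte_fin r0 sube0.
apply: (@le_trans _ _ ((2 * (cL * S))%:E * r%:E + c2%:E * (C1 / (1 - q) * S)%:E)%E).
  by apply: leeD => //; rewrite lee_pmul2l// lte_fin.
rewrite -!EFinM -EFinD lee_fin.
rewrite [leRHS](_ : _ = 2 * (cL * S) * r + c2 * (C1 / (1 - q) * S) + S); last by ring.
by rewrite lerDl.
Qed.

End DyadicSum.

(** * The maximal estimate *)

Section Assembly.
Context {R : realType}.
Local Notation lam := (@lebesgue_measure R).
Local Notation halfline := (`[0%R, +oo[%classic : set R).

(** The maximal function is a supremum over uncountably many times; its integral is a
    supremum over simple functions, which is monotone without measurability. *)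
Lemma integral_monotone d (T : measurableType d) (mu : {measure set T -> \bar R}) (f g : T -> \bar R) :
  (forall x, 0 <= f x)%E -> (forall x, f x <= g x)%E ->
  (\int[mu]_x f x <= \int[mu]_x g x)%E.
Proof.
move=> f0 fg; have g0 x : (0 <= g x)%E := le_trans (f0 x) (fg x).
rewrite !ge0_integralTE//; apply: ereal_sup_le => _ [h hf <-].
by exists h => // x; exact: le_trans (hf x) (fg x).
Qed.

(** The real and imaginary parts of the solution are sums of two oscillatory integrals,
    which are separated only after truncation, where they converge absolutely. *)
Lemma truncated_pair_bound (A : R) (T : nat -> R) (h1 h2 : R -> R) (X1 X2 : \bar R) : 0 < A ->
  (forall k, T k <= T k.+1) -> (forall x, exists k, x <= T k) ->
  measurable_fun halfline h1 -> measurable_fun halfline h2 ->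
  (forall k, lam.-integrable `[0, T k] (EFin \o h1) /\
    (((A * \int[lam]_(l in `[0%R, T k]) h1 l) ^+ 2)%:E <= X1)%E) ->
  (forall k, lam.-integrable `[0, T k] (EFin \o h2) /\
    (((A * \int[lam]_(l in `[0%R, T k]) h2 l) ^+ 2)%:E <= X2)%E) ->
  (((A * \int[lam]_(l in `[0%R, +oo[) (h1 l + h2 l)) ^+ 2)%:E <= 2%:E * (X1 + X2))%E.
Proof.
move=> A0 T1 T2 m1 m2 H1 H2.
have X10 : (0 <= X1)%E by apply: le_trans (H1 0%N).2; rewrite lee_fin sqr_ge0.
have X20 : (0 <= X2)%E by apply: le_trans (H2 0%N).2; rewrite lee_fin sqr_ge0.
case: X1 X10 H1 => [x1| |] X10 H1 //; last by rewrite addye ?gt0_muley ?lte_fin ?leey// -ltNye (lt_le_trans _ X20).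
case: X2 X20 H2 => [x2| |] X20 H2 //; last by rewrite addey ?gt0_muley ?lte_fin ?leey.
rewrite -EFinD -EFinM lee_fin; rewrite !lee_fin in X10 X20.
have B0 : 0 <= 2 * (x1 + x2) by rewrite mulr_ge0// addr_ge0.
have := @Rintegral_le_truncated R T (fun l => h1 l + h2 l) (Num.sqrt (2 * (x1 + x2)) / A) T1 T2
  (measurable_funD m1 m2).
move=> /(_ _) H.
have {}H : `|\int[lam]_(l in `[0%R, +oo[) (h1 l + h2 l)| <= Num.sqrt (2 * (x1 + x2)) / A.
  apply: H => k; have [i1 b1] := H1 k; have [i2 b2] := H2 k; rewrite !lee_fin in b1 b2.
  rewrite RintegralD//.
  rewrite ler_pdivlMr// mulrC -[A in A * _](gtr0_norm A0) -normrM.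
  rewrite -(@ler_pXn2r _ 2)// ?nnegrE ?sqrtr_ge0// real_normK ?num_real// sqr_sqrtr// mulrDr.
  move: b1 b2; move: (A * _) (A * _) => y z b1 b2; have := sqr_ge0 (y - z); lra.
rewrite -[leRHS](sqr_sqrtr B0) -(real_normK (num_real (A * _))).
rewrite lerXn2r ?nnegrE ?sqrtr_ge0// normrM (gtr0_norm A0) mulrC.
by rewrite -ler_pdivlMr.
Qed.

Lemma Adens0 (n : htype R) : Adens n 0 = 0.
Proof.
have m0 : (dim_v n + dim_z n == 0)%N = false by rewrite addn_eq0 (gtn_eqF (dim_z_gt0 n)) andbF.
by rewrite /Adens mul0r /sinh oppr0 subrr mul0r expr0n m0 mulr0 mul0r.
Qed.

Lemma cexp_i (x : R) : cexp (0 +i* x)%C = (cos x +i* sin x)%C.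
Proof. by apply: complex_ext; rewrite ?Re_cexp ?Im_cexp/= expR0 mul1r. Qed.

Lemma ereal_sup_sqr_le (S : set \bar R) (z : \bar R) : (exists2 y, S y & (0 <= y)%E) -> (0 <= z)%E ->
  (forall y, S y -> exists2 v : R, y = v%:E & 0 <= v /\ ((v ^+ 2)%:E <= z)%E) ->
  (ereal_sup S ^+ 2 <= z)%E.
Proof.
move=> [y0 Sy0 y00]; case: z => [z| |]// z0 h; last by rewrite leey.
rewrite lee_fin in z0.
have s0 : (0 <= ereal_sup S)%E by apply: le_trans y00 _; exact: ereal_sup_ubound.
have sz : (ereal_sup S <= (Num.sqrt z)%:E)%E.
  apply: ge_ereal_sup => _ /h[v -> [v0]]; rewrite !lee_fin => vz.
  by rewrite -(@ler_pXn2r _ 2)// ?nnegrE ?sqrtr_ge0// sqr_sqrtr.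
apply: (@le_trans _ _ (((Num.sqrt z)%:E) ^+ 2)%E); first by rewrite lee_sqr// lee_fin sqrtr_ge0.
by rewrite -EFin_expe lee_fin sqr_sqrtr.
Qed.

End Assembly.

Theorem theorem1p3 (R : realType) (n : htype R)
    (mu : {measure set (borelS n) -> \bar R})
    (hmu : normalized_left_haar mu)
    (phi : R -> R -> R) (hphi : forall l : R, spherical n l (phi l))
    (r a b M K : R) (hr : 0 < r) (ha0 : 0 < a) (ha1 : a < 1)
    (hb : a / 4 < b) (hM : 1 < M) :
  exists C : R, 1 <= C /\
    forall (L : laplace_operator) (Psi : R -> R),
      asymptotically_concave a M K (phase n L Psi) ->
      forall f : R -> R[i], schwartz2 n f ->
        (L2norm mu (gball r) (maximal phi (phase n L Psi) f)
         <= C%:E * sobolev_norm n phi b f)%E.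
Proof.
have a01 : 0 < a < 1 by rewrite ha0.
have [C0 C00 est] := @summed_estimate R n phi hphi a b M K r a01 hb hM hr.
exists (1 + Num.sqrt (4 * C0)); split; first by rewrite lerDl sqrtr_ge0.
move=> L Psi hpsi f hf; set psi := phase n L Psi in hpsi *.
pose lam := @lebesgue_measure R.
pose H := (`[0%R, +oo[%classic : set R).
have mH : measurable H by exact: measurable_itv.
pose g := transform n phi f; pose w := plancherel n.
pose gR l := complex.Re (g l); pose gI l := complex.Im (g l).
have [mR mI] : measurable_fun H gR /\ measurable_fun H gI := cmeasurable_transform hphi hf.
have w0 l : 0 <= w l := plancherel_ge0 n l.
have mw : measurable_fun H w := measurable_plancherel_halfline n.
have mpsi : measurable_fun H psi.
  by case: hpsi => cpsi _ _; exact: subspace_continuous_measurable_fun.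
have mp : measurable_fun H (sobolev_weight n b).
  apply: measurable_funTS; apply: (@measurableT_comp _ _ _ _ _ _ (fun x : R => x `^ b)) => //.
  by apply: measurable_funD => //; exact: measurable_funX.
have p0 l : 0 <= sobolev_weight n b l by exact: powR_ge0.
pose nR l := sobolev_weight n b l * (gR l ^+ 2 * w l).
pose nI l := sobolev_weight n b l * (gI l ^+ 2 * w l).
have nR0 l : 0 <= nR l by rewrite mulr_ge0// mulr_ge0// sqr_ge0.
have nI0 l : 0 <= nI l by rewrite mulr_ge0// mulr_ge0// sqr_ge0.
have mnR : measurable_fun H nR.
  by apply: measurable_funM => //; apply: measurable_funM => //; exact: measurable_funX.
have mnI : measurable_fun H nI.
  by apply: measurable_funM => //; apply: measurable_funM => //; exact: measurable_funX.
have sobE : sobolev_norm n phi b f = ((\int[lam]_(l in H) (nR l + nI l)%:E) `^ 2^-1)%E.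
  congr (_ `^ _)%E; apply: eq_integral => l _; congr EFin.
  rewrite -/(g l) normc_sqrt sqr_sqrtr ?addr_ge0 ?sqr_ge0//.
  by rewrite /nR /nI /gR /gI /sobolev_weight /w; ring.
have mS : measurable_fun H (fun l => (nR l + nI l)%:E).
  by apply/measurable_EFinP; exact: measurable_funD.
have S0 : (0 <= \int[lam]_(l in H) (nR l + nI l)%:E)%E.
  by apply: integral_ge0 => l _; rewrite lee_fin addr_ge0.
have Cp : 0 < 1 + Num.sqrt (4 * C0) by rewrite ltr_pwDl// sqrtr_ge0.
have [Sfin|Sinf] := boolP (\int[lam]_(l in H) (nR l + nI l)%:E < +oo)%E; last first.
  have -> : sobolev_norm n phi b f = +oo%E.
    move: Sinf; rewrite sobE -leNgt leye_eq => /eqP ->.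
    by rewrite poweRyr// invr_eq0.
  by rewrite gt0_muley ?lte_fin// leey.
have iS : lam.-integrable H (EFin \o (fun l => nR l + nI l)).
  apply/integrableP; split => //.
  under eq_integral => l _ do rewrite /= ger0_norm ?addr_ge0//.
  exact: Sfin.
have iR : lam.-integrable H (EFin \o nR).
  apply: (@intble_le _ _ _ lam _ mH _ _ mnR _ iS) => l _.
  by rewrite ger0_norm// lerDl.
have iI : lam.-integrable H (EFin \o nI).
  apply: (@intble_le _ _ _ lam _ mH _ _ mnI _ iS) => l _.
  by rewrite ger0_norm// lerDr.
pose S := \int[lam]_(l in H) (nR l + nI l).
have SE : (\int[lam]_(l in H) (nR l + nI l)%:E)%E = S%:E.
  by rewrite /S /Rintegral fineK//; apply: (integrable_fin_num _ iS).
have SD : S = \int[lam]_(l in H) nR l + \int[lam]_(l in H) nI l by rewrite /S RintegralD.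
have [H1 [mH1 H10 H1s H1i]] := est psi hpsi 0 gR mR iR.
have [H2 [mH2 H20 H2s H2i]] := est psi hpsi (pi / 2) gI mI iI.
have [H3 [mH3 H30 H3s H3i]] := est psi hpsi (- (pi / 2)) gR mR iR.
have [H4 [mH4 H40 H4s H4i]] := est psi hpsi 0 gI mI iI.
pose Z s := (2%:E * (H1 s + H2 s) + 2%:E * (H3 s + H4 s))%E.
have Z0 s : (0 <= Z s)%E by rewrite adde_ge0// mule_ge0// adde_ge0.
have mZ : measurable_fun [set: R] Z.
  by apply: emeasurable_funD; apply: measurable_funeM; exact: emeasurable_funD.
have Zi : (\int[lam]_(s in `[0%R, r[) Z s <= (4 * C0 * S)%:E)%E.
  have mr : measurable (`[0%R, r[%classic : set R) by exact: measurable_itv.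
  have pair (F G : R -> \bar R) (x y : R) : measurable_fun [set: R] F -> measurable_fun [set: R] G ->
      (forall s, 0 <= F s)%E -> (forall s, 0 <= G s)%E ->
      (\int[lam]_(s in `[0%R, r[) F s <= x%:E)%E -> (\int[lam]_(s in `[0%R, r[) G s <= y%:E)%E ->
      (\int[lam]_(s in `[0%R, r[) (F s + G s) <= (x + y)%:E)%E.
    move=> mF mG F0 G0 hx hy.
    rewrite ge0_integralD//; try exact: measurable_funTS.
    by rewrite EFinD; exact: leeD.
  have twice (F : R -> \bar R) (x : R) : measurable_fun [set: R] F -> (forall s, 0 <= F s)%E ->
      (\int[lam]_(s in `[0%R, r[) F s <= x%:E)%E ->
      (\int[lam]_(s in `[0%R, r[) (2%:E * F s) <= (2 * x)%:E)%E.
    move=> mF F0 hx; rewrite ge0_integralZl_EFin//; try exact: measurable_funTS.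
    by rewrite EFinM lee_pmul2l// lte_fin.
  have e12 := pair H1 H2 _ _ mH1 mH2 H10 H20 H1i H2i.
  have e34 := pair H3 H4 _ _ mH3 mH4 H30 H40 H3i H4i.
  have m12 : measurable_fun [set: R] (fun s => H1 s + H2 s)%E by exact: emeasurable_funD.
  have m34 : measurable_fun [set: R] (fun s => H3 s + H4 s)%E by exact: emeasurable_funD.
  have p12 s : (0 <= H1 s + H2 s)%E by exact: adde_ge0.
  have p34 s : (0 <= H3 s + H4 s)%E by exact: adde_ge0.
  have t12 := twice _ _ m12 p12 e12; have t34 := twice _ _ m34 p34 e34.
  apply: le_trans (pair _ _ _ _ (measurable_funeM 2%:E m12) (measurable_funeM 2%:E m34) _ _ t12 t34) _.
  - by move=> s; rewrite mule_ge0.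
  - by move=> s; rewrite mule_ge0.
  rewrite lee_fin SD -/lam -/H.
  by rewrite [leLHS](_ : _ = 4 * C0 * (\int[lam]_(l in H) nR l + \int[lam]_(l in H) nI l))//; rewrite /nR /nI; ring.
(* a radial majorant of the squared maximal function; the value [+oo] at [0] is
   harmless because the density vanishes there *)
pose h (s : R) : \bar R := if s <= 0 then +oo%E else
  if s < r then (Z s * (Adens n s)^-1%:E)%E else 0%E.
have h0 s : (0 <= h s)%E.
  rewrite /h; have [//|s0] := leP s 0; case: ifP => // _.
  by rewrite mule_ge0// lee_fin invr_ge0 Adens_ge0// ltW.
have mh : measurable_fun [set: R] h.
  apply: measurable_fun_ifT; [exact: measurable_fun_ler|exact: measurable_cst|].
  apply: measurable_fun_ifT; [exact: measurable_fun_ltr| |exact: measurable_cst].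
  apply: emeasurable_funM => //; apply/measurable_EFinP; apply: measurable_inv.
  by apply: continuous_measurable_fun; exact: continuous_Adens.
have [_ _ /(_ h mh h0) hint] := hmu.
have hZ : (\int[mu]_x radial h x <= (4 * C0 * S)%:E)%E.
  rewrite hint; apply: le_trans Zi; rewrite integral_mkcond [leRHS]integral_mkcond.
  apply: integral_monotone => s; rewrite /patch !mem_setE !in_itv/= andbT.
    case: ifP => // s0; by rewrite mule_ge0// lee_fin Adens_ge0.
  case: (leP 0 s) => s0 /=; last by [].
  rewrite /h; have [s00|s00] := leP s 0.
    have -> : s = 0 by apply/eqP; rewrite eq_le s00.
    by rewrite Adens0 mule0 hr.
  case: ifP => _; last by rewrite mul0e.
  have A0 := Adens_gt0 n s00.
  by rewrite -muleA -EFinM mulVf ?gt_eqF// mule1.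
have trunc1 k : M * 2 ^+ k <= M * 2 ^+ k.+1.
  by rewrite ler_pM2l ?(lt_trans _ hM)// ler_eXn2l// ltr1n.
have trunc2 x : exists k, x <= M * 2 ^+ k.
  exists (Num.truncn x).+1; apply: (@le_trans _ _ (Num.truncn x).+1%:R); first exact/ltW/truncnS_gt.
  apply: (@le_trans _ _ (2 ^+ (Num.truncn x).+1)).
    by rewrite -natrX ler_nat ltnW// ltn_expl.
  by rewrite ler_peMl ?exprn_ge0// ltW.
have bound (s t : R) (x : DR n) : dist 0 x = s -> 0 < s < r -> 0 <= t <= 1 ->
    ((Normc.normc (solution phi psi t f x) ^+ 2 * Adens n s)%:E <= Z s)%E.
  move=> dx s0r t01; have [s0 sr] := andP s0r.
  have A0 : 0 < sqrtA n s by rewrite sqrtr_gt0 Adens_gt0.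
  have mE : measurable_fun H (fun l => even_ext (phi l) s).
    by apply: measurable_funTS; apply: (measurable_profile hphi); exact: ltW.
  have ms c (G : R -> R) : measurable_fun H G ->
      measurable_fun H (fun l => even_ext (phi l) s * cos (t * psi l + c) * (G l * w l)).
    move=> mG; apply: measurable_funM; last exact: measurable_funM.
    apply: measurable_funM => //; apply: measurable_cosT; apply: measurable_funD => //.
    exact: measurable_funM.
  have b12 := truncated_pair_bound A0 trunc1 trunc2 (ms 0 gR mR) (ms (pi / 2) gI mI)
    (fun k => H1s s t k s0r t01) (fun k => H2s s t k s0r t01).
  have b34 := truncated_pair_bound A0 trunc1 trunc2 (ms (- (pi / 2)) gR mR) (ms 0 gI mI)
    (fun k => H3s s t k s0r t01) (fun k => H4s s t k s0r t01).
  rewrite normc_sqrt sqr_sqrtr ?addr_ge0 ?sqr_ge0//.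
  have -> : Adens n s = sqrtA n s ^+ 2 by rewrite sqr_sqrtr// Adens_ge0// ltW.
  rewrite mulrDl -!exprMn EFinD; apply: leeD.
    apply: le_trans b12; rewrite lee_fin mulrC le_eqVlt; apply/orP; left; apply/eqP; congr ((_ * _) ^+ 2).
    apply: eq_Rintegral => l _; rewrite /radial dx -(profileE phi l (ltW s0)) -/psi -/(g l) -/(w l).
    rewrite cexp_i /gR /gI; move: (g l) => [u v].
    rewrite !Re_mul !Im_mul /= addr0 cosD cos_pihalf sin_pihalf.
    by ring.
  apply: le_trans b34; rewrite lee_fin mulrC le_eqVlt; apply/orP; left; apply/eqP; congr ((_ * _) ^+ 2).
  apply: eq_Rintegral => l _; rewrite /radial dx -(profileE phi l (ltW s0)) -/psi -/(g l) -/(w l).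
  rewrite cexp_i /gR /gI; move: (g l) => [u v].
  rewrite !Im_mul !Re_mul /= addr0 cosB cos_pihalf sin_pihalf.
  by ring.
have main : (\int[mu]_(x in (gball r : set (borelS n))) (maximal phi psi f x) ^+ 2 <= (4 * C0 * S)%:E)%E.
  apply: le_trans hZ; rewrite integral_mkcond; apply: integral_monotone => x; rewrite /patch.
    by case: ifP => // _; exact: sqre_ge0.
  case: ifPn => [|_]; last exact: h0.
  rewrite inE /gball/= => xr; rewrite /radial; set s := dist 0 x in xr *.
  apply: ereal_sup_sqr_le; last first.
  - move=> _ [t t01 <-]; exists (Normc.normc (solution phi psi t f x)) => //.
    split; first exact: normc_ge0.
    rewrite /h; have [_|s0] := leP s 0; first by rewrite leey.
    rewrite xr; have A0 := Adens_gt0 n s0.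
    rewrite muleC lee_pdivlMl// -EFinM mulrC; apply: bound => //; first by rewrite s0.
    by move: t01; rewrite /= in_itv/= => /andP[t0 t1]; rewrite !ltW.
  - exact: h0.
  exists (Normc.normc (solution phi psi 2^-1 f x))%:E; last by rewrite lee_fin normc_ge0.
  by exists 2^-1 => //=; rewrite in_itv/=; apply/andP; split; lra.
have S0' : 0 <= S by apply: Rintegral_ge0 => l _; exact: addr_ge0.
have CS0 : 0 <= 4 * C0 * S by rewrite mulr_ge0// mulr_ge0// ltW.
rewrite sobE SE poweR_EFin powR12_sqrt//.
apply: (@le_trans _ _ ((4 * C0 * S)%:E `^ 2^-1)%E).
  apply: gt0_ler_poweR => //; rewrite in_itv/= ?leey ?andbT//.
  by apply: integral_ge0 => x _; exact: sqre_ge0.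
rewrite poweR_EFin powR12_sqrt// -EFinM lee_fin sqrtrM; last by rewrite mulr_ge0// ltW.
by rewrite ler_wpM2r ?sqrtr_ge0// lerDr.
Qed.
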